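(* The $W$-graphs $\Upsilon^{\mathbf m|\sigma}$ (on $\mathcal K^J$) and $\Upsilon^{\mathbf n|\sigma^\vee}$ (on $\mathcal K^{J^\vee}$) are dual via the map $\tau\mapsto\tau^\vee$; likewise $\Upsilon^{\mathbf n|\sigma}$ and $\Upsilon^{\mathbf m|\sigma^\vee}$ are dual via $\tau\mapsto\tau^\vee$.
   Context: Let $(W,S)$ be a finite Coxeter system with length $\ell$, Bruhat order $\le$, reflections $T=\{wsw^{-1}\}$. $\mathrm{Aut}(W,S)$: automorphisms preserving $S$; $W^+=W\rtimes\mathrm{Aut}(W,S)$, $(v,\alpha)(w,\beta)=(v\,\alpha(w),\alpha\beta)$, $\ell(w,\varphi)=\ell(w)$, $w\equiv(w,1)$. Perfect involution: $z\in W^+$ with $z^2=1$, $(zt)^4=1$ for all $t\in T$. For $K\subseteq S$: $W_K=\langle K\rangle$; $\mathscr I_K$ = perfect involutions of $W_K\rtimes\mathrm{Aut}(W_K,K)$, with $W_K$ acting by $v:(y,\theta)\mapsto(vy\theta(v)^{-1},\theta)$; $W_K$-minimal: $\ell(szs)\ge\ell(z)$ for $s\in K$ (unique per class). $W^K=\{w:\ell(ws)>\ell(w)\ \forall s\in K\}$, $\mathcal K^K=W^K\times\mathscr I_K$, $\mathrm{ht}(w,z)=\ell(w)+\tfrac12(\ell(z)-\ell(z_{\min}))$. $W$ acts on $\mathcal K^K$ by $s(w,z)=(sw,z)$ if $sw\in W^K$, else $(w,tzt)$, $t=w^{-1}sw\in K$. Quasiparabolic Bruhat order on $\mathscr I_K$: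 transitive closure of $z<tzt$ ($t$ a reflection of $W_K$, $\ell(z)<\ell(tzt)$). $\prec$ on $\mathcal K^K$: $(w,z)\prec(w',z')$ iff same $W$-orbit, smaller $\mathrm{ht}$, and ($w<w'$ in Bruhat order, or $w=w'$ and $z<z'$). For a homomorphism $\rho:W_K\to\{\pm1\}$ and $\tau=(w,z)$: $\mathrm{Asc}^<(\tau;\rho)=\{s:\mathrm{ht}(s\tau)>\mathrm{ht}(\tau)\}$, $\mathrm{Des}^<(\tau;\rho)=\{s:\mathrm{ht}(s\tau)<\mathrm{ht}(\tau)\}$, $\mathrm{Asc}^=(\tau;\rho)=\{s:\mathrm{ht}(s\tau)=\mathrm{ht}(\tau),\rho(w^{-1}sw)=-1\}$, $\mathrm{Des}^=(\tau;\rho)=\{s:\mathrm{ht}(s\tau)=\mathrm{ht}(\tau),\rho(w^{-1}sw)=1\}$; $\mathrm{Asc}^{\mathbf m|\rho}(\tau)=\mathrm{Asc}^<(\tau;\rho)\sqcup\mathrm{Asc}^=(\tau;\rho)$ and $\mathrm{Asc}^{\mathbf n|\rho}(\tau)=\mathrm{Asc}^<(\tau;\rho)\sqcup\mathrm{Des}^=(\tau;\rho)$. $\mathcal H$: Iwahori–Hecke algebra over $\mathbb Z[x,x^{-1}]$, basis $H_w$, $H_sH_w=H_{sw}$ if $\ell(sw)>\ell(w)$, else $H_{sw}+(x-x^{-1})H_w$; bar operator: antilinear ($x\mapsto x^{-1}$) ring involution with $\overline{H_w}=(H_{w^{-1}})^{-1}$. $\mathcal M^\rho$: free module with basis $M^\rho_\tau$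 ($\tau\in\mathcal K^K$) with $H_sM^\rho_\tau=M^\rho_{s\tau}$, $M^\rho_{s\tau}+(x-x^{-1})M^\rho_\tau$, $-x^{-1}M^\rho_\tau$, $xM^\rho_\tau$ according as $s\in\mathrm{Asc}^<,\mathrm{Des}^<,\mathrm{Asc}^=,\mathrm{Des}^=$ of $(\tau;\rho)$, with the unique antilinear $\overline{\cdot}$ satisfying $\overline{HM}=\overline H\,\overline M$ and fixing $M^\rho_\tau$ whenever $\mathrm{Des}^<(\tau;\rho)=\varnothing$, and unique basis $\underline M^\rho_\tau$ with $\overline{\underline M^\rho_\tau}=\underline M^\rho_\tau\in M^\rho_\tau+\sum_{\upsilon\prec\tau}x^{-1}\mathbb Z[x^{-1}]M^\rho_\upsilon$. Write $\underline M^\rho_\tau=\sum_\upsilon\mathbf m^\rho_{\upsilon\tau}M^\rho_\upsilon$, $\mu^{\mathbf m|\rho}_{\upsilon\tau}$ for the $x^{-1}$-coefficient of $\mathbf m^\rho_{\upsilon\tau}$, and $\omega^{\mathbf m|\rho}(\tau,\upsilon)=\mu^{\mathbf m|\rho}_{\upsilon\tau}+\mu^{\mathbf m|\rho}_{\tau\upsilon}$ if $\mathrm{Asc}^{\mathbf m|\rho}(\tau)\not\subset\mathrm{Asc}^{\mathbf m|\rho}(\upsilon)$, else $0$. Put $\omega^{\mathbf n|\rho}=\omega^{\mathbf m|\mathrm{sgn}\cdot\rho}$ (with $\mathrm{sgn}(w)=(-1)^{\ell(w)}$; note $\mathrm{Asc}^{\mathbf n|\rho}=\mathrm{Asc}^{\mathbf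 m|\mathrm{sgn}\cdot\rho}$). $\Upsilon^{\mathbf m|\rho}=(\mathcal K^K,\omega^{\mathbf m|\rho},\mathrm{Asc}^{\mathbf m|\rho})$ and $\Upsilon^{\mathbf n|\rho}=(\mathcal K^K,\omega^{\mathbf n|\rho},\mathrm{Asc}^{\mathbf n|\rho})$ (these are $W$-graphs). Fix $J\subseteq S$, $\sigma:W_J\to\{\pm1\}$. Let $w_0,w_J$ be the longest elements of $W,W_J$, $\mathrm{Ad}(v):w\mapsto vwv^{-1}$, $J^\vee=w_0Jw_0$, $\sigma^\vee=\sigma\circ\mathrm{Ad}(w_0)$. For $z=(y,\theta)\in\mathscr I_J$, $z^\vee=(w_0w_Jyw_0,\ \mathrm{Ad}(w_0)\circ\mathrm{Ad}(w_J)\circ\theta\circ\mathrm{Ad}(w_0))$; for $\tau=(w,z)\in\mathcal K^J$, $\tau^\vee=(ww_Jw_0,z^\vee)\in\mathcal K^{J^\vee}$. $S$-labeled graphs $(V,\omega,I)$ and $(V',\omega',I')$ are dual via a bijection $v\mapsto v'$ if $\omega'(u',v')=\overline{\omega(v,u)}$ and $I'(v')=S\setminus I(v)$ for all $u,v\in V$. *)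

(* Defs.v *)
From HB Require Import structures.
From mathcomp Require Import all_boot all_order all_algebra all_fingroup.
From Stdlib Require Import ClassicalEpsilon.
Set Implicit Arguments. Unset Strict Implicit. Unset Printing Implicit Defensive.

Import GRing.Theory.

(* Coxeter systems (W,S) with W = <<S>> inside a finite group gT.      *)

Definition ball (gT : finGroupType) (S : {set gT}) (n : nat) : {set gT} :=
  iter n (fun A => (A :|: A * S)%g) [set 1%g].

(* Coxeter length with respect to S (meaningful on <<S>>) *)
Definition len (gT : finGroupType) (S : {set gT}) (w : gT) : nat :=
  find (fun n => w \in ball S n) (iota 0 #|gT|).

Definition wprod (gT : finGroupType) (ws : seq gT) : gT := foldr (fun a b => (a * b)%g) 1%g ws.

Definition exchange_cond (gT : finGroupType) (S : {set gT}) : Prop :=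
  forall (s : gT) (ws : seq gT),
    s \in S -> all (mem S) ws -> len S (wprod ws) = size ws ->
    (len S (s * wprod ws)%g <= size ws)%N ->
    exists2 i, (i < size ws)%N &
      (s * wprod ws)%g = wprod (take i ws ++ drop i.+1 ws).

(* (<<S>>, S) is a Coxeter system: S consists of involutions and (E) holds
   (Bourbaki, Lie IV, 1.6, Thm 1). *)
Definition coxeter_system (gT : finGroupType) (S : {set gT}) : Prop :=
  (forall s, s \in S -> s != 1%g /\ (s * s)%g = 1%g) /\ exchange_cond S.

Definition refls (gT : finGroupType) (K : {set gT}) : {set gT} :=
  [set (v * s * v^-1)%g | v in <<K>>%g, s in K].

Definition bruhat_step (gT : finGroupType) (S : {set gT}) : rel gT :=
  fun v w => [exists t in refls S, (w == (v * t)%g) && (len S v < len S w)%N].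
Definition bruhat_lt (gT : finGroupType) (S : {set gT}) (v w : gT) : bool :=
  (v != w) && connect (bruhat_step S) v w.

Definition longest (gT : finGroupType) (S K : {set gT}) : gT :=
  [arg max_(w > 1%g in <<K>>%g) len S w]%N.

(* W_K x| Aut(W_K,K).  An automorphism of W_K is represented, as in
   MathComp's [Aut], by a permutation of gT that is an automorphism on
   W_K and the identity outside W_K.                                   *)

Definition sdmul (gT : finGroupType) (a b : gT * {perm gT}) : gT * {perm gT} :=
  ((a.1 * a.2 b.1)%g, (b.2 * a.2)%g).  (* (v,al)(w,be) = (v al(w), al o be) *)

Definition sdone (gT : finGroupType) : gT * {perm gT} := (1%g, 1%g).

Definition emb (gT : finGroupType) (t : gT) : gT * {perm gT} := (t, 1%g).

Definition autKK (gT : finGroupType) (K : {set gT}) : {set {perm gT}} :=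
  [set th in Aut <<K>>%g | th @: K == K].

Definition perfect (gT : finGroupType) (K : {set gT}) (z : gT * {perm gT}) : bool :=
  [&& z.1 \in <<K>>%g, z.2 \in autKK K, sdmul z z == sdone gT &
      [forall t in refls K,
         let u := sdmul z (emb t) in
         sdmul (sdmul u u) (sdmul u u) == sdone gT]].

Definition twact (gT : finGroupType) (v : gT) (z : gT * {perm gT}) : gT * {perm gT} :=
  ((v * z.1 * (z.2 v)^-1)%g, z.2).

Definition Korbit (gT : finGroupType) (K : {set gT}) (z : gT * {perm gT})
  : {set gT * {perm gT}} := [set twact v z | v in <<K>>%g].

Definition cnj (gT : finGroupType) (t : gT) (z : gT * {perm gT}) : gT * {perm gT} :=
  sdmul (sdmul (emb t) z) (emb t).

Definition Kminimal (gT : finGroupType) (S K : {set gT}) (z : gT * {perm gT}) : bool :=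
  [forall s in K, len S z.1 <= len S (cnj s z).1]%N.

(* length of the (unique) W_K-minimal element z_min of the W_K-orbit of z *)
Definition lenzmin (gT : finGroupType) (S K : {set gT}) (z : gT * {perm gT}) : nat :=
  if [pick z' in Korbit K z | Kminimal S K z'] is Some z' then len S z'.1 else 0.

Definition elt (gT : finGroupType) := (gT * (gT * {perm gT}))%type.

Definition minrep (gT : finGroupType) (S K : {set gT}) (w : gT) : bool :=
  (w \in <<S>>%g) && [forall s in K, len S w < len S (w * s)%g]%N.

Definition inKK (gT : finGroupType) (S K : {set gT}) (tau : elt gT) : bool :=
  minrep S K tau.1 && perfect K tau.2.

Definition KKset (gT : finGroupType) (S K : {set gT}) : {set elt gT} :=
  [set tau | inKK S K tau].

Definition sact (gT : finGroupType) (S K : {set gT}) (s : gT) (tau : elt gT) : elt gT :=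
  if minrep S K (s * tau.1)%g then ((s * tau.1)%g, tau.2)
  else (tau.1, cnj (tau.1^-1 * s * tau.1)%g tau.2).

(* twice the height: 2 ht(w,z) = 2 l(w) + l(z) - l(z_min) *)
Definition ht2 (gT : finGroupType) (S K : {set gT}) (tau : elt gT) : int :=
  ((2 * len S tau.1 + len S tau.2.1)%N%:Z - (lenzmin S K tau.2)%:Z)%R.

Definition qp_step (gT : finGroupType) (S K : {set gT}) : rel (gT * {perm gT}) :=
  fun z z' => [exists t in refls K, (z' == cnj t z) && (len S z.1 < len S z'.1)%N].
Definition qp_lt (gT : finGroupType) (S K : {set gT}) (z z' : gT * {perm gT}) : bool :=
  (z != z') && connect (qp_step S K) z z'.

Definition sameorbit (gT : finGroupType) (S K : {set gT}) (a b : elt gT) : bool :=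
  connect (fun x y => [exists s in S, y == sact S K s x]) a b.

Definition prec (gT : finGroupType) (S K : {set gT}) (u t : elt gT) : bool :=
  [&& sameorbit S K u t, (ht2 S K u < ht2 S K t)%R &
      bruhat_lt S u.1 t.1 || ((u.1 == t.1) && qp_lt S K u.2 t.2)].

Definition ascL (gT : finGroupType) (S K : {set gT}) (tau : elt gT) : {set gT} :=
  [set s in S | (ht2 S K tau < ht2 S K (sact S K s tau))%R].
Definition desL (gT : finGroupType) (S K : {set gT}) (tau : elt gT) : {set gT} :=
  [set s in S | (ht2 S K (sact S K s tau) < ht2 S K tau)%R].
Definition ascE (gT : finGroupType) (S K : {set gT}) (rho : gT -> int) (tau : elt gT)
  : {set gT} :=
  [set s in S | (ht2 S K (sact S K s tau) == ht2 S K tau)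
                && (rho (tau.1^-1 * s * tau.1)%g == (-1)%R)].
Definition desE (gT : finGroupType) (S K : {set gT}) (rho : gT -> int) (tau : elt gT)
  : {set gT} :=
  [set s in S | (ht2 S K (sact S K s tau) == ht2 S K tau)
                && (rho (tau.1^-1 * s * tau.1)%g == 1%R)].

Definition asc_m (gT : finGroupType) (S K : {set gT}) (rho : gT -> int) (tau : elt gT)
  : {set gT} := ascL S K tau :|: ascE S K rho tau.
Definition asc_n (gT : finGroupType) (S K : {set gT}) (rho : gT -> int) (tau : elt gT)
  : {set gT} := ascL S K tau :|: desE S K rho tau.

Definition sign_hom (gT : finGroupType) (K : {set gT}) (rho : gT -> int) : Prop :=
  {in <<K>>%g &, forall a b, rho (a * b)%g = (rho a * rho b)%R} /\
  {in <<K>>%g, forall a, rho a = 1%R \/ rho a = (-1)%R}.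

Definition sgnrho (gT : finGroupType) (S : {set gT}) (rho : gT -> int) : gT -> int :=
  fun v => ((-1) ^+ len S v * rho v)%R.

(* The module M^rho over Z[x,x^-1].  An element is given by its
   coefficients: m tau k = coefficient of x^k M_tau.                    *)

Definition mvec (gT : finGroupType) := elt gT -> int -> int.

Definition Mel (gT : finGroupType) (S K : {set gT}) (m : mvec gT) : Prop :=
  (forall tau k, ~~ inKK S K tau -> m tau k = 0%R) /\
  exists N : nat, forall tau k, (N < absz k)%N -> m tau k = 0%R.

Local Open Scope ring_scope.

Definition Hs (gT : finGroupType) (S K : {set gT}) (rho : gT -> int) (s : gT)
  (m : mvec gT) : mvec gT := fun u k =>
  \sum_(tau in KKset S K)
    (if s \in ascL S K tau then (u == sact S K s tau)%:R * m tau k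
     else if s \in desL S K tau then
       (u == sact S K s tau)%:R * m tau k + (u == tau)%:R * (m tau (k - 1) - m tau (k + 1))
     else if s \in ascE S K rho tau then (u == tau)%:R * - m tau (k + 1)
     else if s \in desE S K rho tau then (u == tau)%:R * m tau (k - 1)
     else 0).

(* H_s^{-1} = H_s - (x - x^{-1}) *)
Definition Hsinv (gT : finGroupType) (S K : {set gT}) (rho : gT -> int) (s : gT)
  (m : mvec gT) : mvec gT := fun u k =>
  Hs S K rho s m u k - (m u (k - 1) - m u (k + 1)).

Definition madd (gT : finGroupType) (m1 m2 : mvec gT) : mvec gT :=
  fun u k => m1 u k + m2 u k.
Definition mx (gT : finGroupType) (m : mvec gT) : mvec gT := fun u k => m u (k - 1).
Definition mxinv (gT : finGroupType) (m : mvec gT) : mvec gT := fun u k => m u (k + 1).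
Definition basisv (gT : finGroupType) (tau : elt gT) : mvec gT :=
  fun u k => ((u == tau) && (k == 0))%:R.

(* the bar involution of M^rho: antilinear, compatible with the bar of H
   (tested on the generators H_s), fixing M_tau when Des^<(tau) is empty *)
Definition is_bar (gT : finGroupType) (S K : {set gT}) (rho : gT -> int)
  (B : mvec gT -> mvec gT) : Prop :=
  (forall m, Mel S K m ->
    [/\ Mel S K (B m),
        (forall m', Mel S K m' -> B (madd m m') =2 madd (B m) (B m')),
        B (mx m) =2 mxinv (B m) &
        (forall s, s \in S -> B (Hs S K rho s m) =2 Hsinv S K rho s (B m))]) /\
  (forall tau, inKK S K tau -> desL S K tau == set0 -> B (basisv tau) =2 basisv tau).

Definition canon_pred (gT : finGroupType) (S K : {set gT}) (rho : gT -> int)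
  (C : elt gT -> mvec gT) : Prop :=
  exists B, is_bar S K rho B /\
    forall tau, inKK S K tau ->
      [/\ Mel S K (C tau), B (C tau) =2 C tau,
          (forall k, C tau tau k = (k == 0)%:R) &
          (forall u k, u != tau -> C tau u k != 0 -> prec S K u tau && (k < 0))].

Definition canon (gT : finGroupType) (S K : {set gT}) (rho : gT -> int) : elt gT -> mvec gT :=
  epsilon (inhabits (fun _ _ _ => 0)) (canon_pred S K rho).

Definition mu (gT : finGroupType) (S K : {set gT}) (rho : gT -> int) (u tau : elt gT) : int :=
  canon S K rho tau u (-1).

Definition omega_m (gT : finGroupType) (S K : {set gT}) (rho : gT -> int)
  (tau u : elt gT) : int :=
  if ~~ (asc_m S K rho tau \subset asc_m S K rho u)
  then mu S K rho u tau + mu S K rho tau u else 0.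

Definition omega_n (gT : finGroupType) (S K : {set gT}) (rho : gT -> int) :=
  omega_m S K (sgnrho S rho).

(* duality of S-labeled graphs via f (the bar on the integer-valued
   edge weights is the identity) *)
Definition dual_graphs (gT : finGroupType) (S : {set gT}) (V V' : {set elt gT})
  (f : elt gT -> elt gT) (om om' : elt gT -> elt gT -> int)
  (I I' : elt gT -> {set gT}) : Prop :=
  [/\ {in V, forall v, f v \in V'}, {in V &, injective f},
      (forall v', v' \in V' -> exists2 v, v \in V & f v = v'),
      {in V &, forall u v, om' (f u) (f v) = om v u} &
      {in V, forall v, I' (f v) = S :\: I v}].

Local Close Scope ring_scope.

(* Ad(v) : x |-> v x v^-1 *)
Definition Ad (gT : finGroupType) (v : gT) : {perm gT} := perm (@conjg_inj gT (v^-1)%g).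

Definition Jv (gT : finGroupType) (S J : {set gT}) : {set gT} :=
  [set (longest S S * s * longest S S)%g | s in J].

Definition sigv (gT : finGroupType) (S : {set gT}) (sigma : gT -> int) : gT -> int :=
  fun v => sigma (Ad (longest S S) v).

(* z^vee = (w0 wJ y w0, Ad(w0) o Ad(wJ) o th o Ad(w0)), the latter seen as an
   automorphism of W_{J^vee} (identity outside W_{J^vee}) *)
Definition dualz (gT : finGroupType) (S J : {set gT}) (z : gT * {perm gT})
  : gT * {perm gT} :=
  let w0 := longest S S in let wJ := longest S J in
  ((w0 * wJ * z.1 * w0)%g,
   restr_perm <<Jv S J>>%g (Ad w0 * z.2 * Ad wJ * Ad w0)%g).

Definition dualtau (gT : finGroupType) (S J : {set gT}) (tau : elt gT) : elt gT :=
  ((tau.1 * longest S J * longest S S)%g, dualz S J tau.2).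

(* Main.v *)
(** The function [F r w] telling whether a reflection [r] is a left inversion of [w] is a
    cocycle; this gives the strong exchange condition and, applied to twisted conjugation,
    the fact that every class of perfect involutions has a unique minimal element and that
    [sact] moves the height by one or not at all.

    The operators [H_s] satisfy the braid relations: it is enough to test them on basis
    vectors that are minimal for the dihedral parabolic subgroup, and there each case
    reduces to a comparison of two alternating words.  Up to a monomial constant on each
    orbit, the bar operator sends [M_(w,z)], [z = (y,th)], to the bar of [H_(wy)] applied to
    [M_(1,z')], where [z' = (y^-1,th)] (a formula going back to Lusztig); the canonical basis
    then exists and is unique by the usual triangularity argument.

    For characters with [rho' (gam t) = - rho t] the pairing [Phi] which makes [M_tau] and
    [M_(tau^vee)] dual up to the sign [(-1)^ht] satisfies
    [Phi (H_s m) n = - Phi m (H_s^-1 n)], hence commutes with the bar operators.  The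
    [x^-1]-coefficient of the pairing of two canonical basis elements therefore vanishes,
    which identifies the [mu]-coefficients of both sides up to a sign; the sign is fixed by
    the fact that [C_tau] is homogeneous for a parity. *)
Require Import Defs.
From mathcomp Require Import all_boot all_order all_algebra all_fingroup.
From mathcomp Require Import zify cyclic.
From Stdlib Require Import FunctionalExtensionality ClassicalEpsilon.
Set Implicit Arguments. Unset Strict Implicit. Unset Printing Implicit Defensive.
Local Open Scope group_scope.

(** Nothing is known about [canon] in advance: [epsilon] picks it from a predicate that merely asks
    for some bar operator, so existence and uniqueness of that operator and of the basis have to be
    established before any [mu] can be computed. Perfectness is used through one remark.
    [(zt)^4 = 1] says that [t] commutes with [z t z], and of two distinct commuting reflections
    neither is an inversion of the other; so conjugation by [t] fixes [z] or changes the length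
    twice in the same direction. The same commutation pins down the dihedral order in the
    exceptional braid relations. The bar formula propagates because an ascending conjugation turns
    [y] into [t y th(t)]: the left letter yields [H_s^-1] and the right one is absorbed by the
    change of [z']. The dual map reverses heights, hence swaps arrows up and down; a fixed point
    must then swap its eigenvalues [-x^-1] and [x], which is the condition on the characters. As
    [sgn] is -1 on simple reflections, twisting one side by it provides the sign, and so [m] is
    matched with [n]. *)

Module Coxeter.

(* [lia] does not identify lengths of group products that differ by canonical instances. *)
Ltac llia := repeat match goal with H : context [len _ _] |- _ => revert H end;
  repeat match goal with |- context [len ?A ?x] =>
    let n := fresh "n" in move: (len A x) => n end; clear; intros; lia.

(** * Words and the length function *)

Section Words.
Variable gT : finGroupType.
Implicit Types (A K : {set gT}) (ws : seq gT) (w : gT).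

Lemma wprod_cat ws1 ws2 : wprod (ws1 ++ ws2) = wprod ws1 * wprod ws2.
Proof. by elim: ws1 => [|a ws IH] /=; rewrite ?mul1g // IH mulgA. Qed.

Lemma wprod_rcons ws s : wprod (rcons ws s) = wprod ws * s.
Proof. by rewrite -cats1 wprod_cat /= mulg1. Qed.

Lemma wprod_gen K ws : all (mem K) ws -> wprod ws \in <<K>>.
Proof.
elim: ws => [|a ws IH] /=; first by rewrite group1.
by case/andP=> aK /IH h; rewrite groupM // mem_gen.
Qed.

Lemma gen_word K w : w \in <<K>> -> exists2 ws, all (mem K) ws & wprod ws = w.
Proof.
case/gen_prodgP=> n [c cK ->]; elim: n c cK => [|n IH] c cK.
  by exists [::]; rewrite ?big_ord0.
have [|ws h e] := IH (fun i => c (lift ord0 i)); first by move=> i; exact: cK.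
by exists (c ord0 :: ws); rewrite /= ?cK // big_ord_recl e.
Qed.

Lemma ballP K n w :
  reflect (exists ws, [/\ all (mem K) ws, size ws <= n & wprod ws = w]) (w \in ball K n).
Proof.
elim: n w => [|n IH] w.
  rewrite inE; apply: (iffP eqP) => [->|[ws [_]]]; first by exists [::].
  by rewrite leqn0 => /nilP -> <-.
rewrite inE; apply: (iffP orP) => [[/IH [ws [h1 h2 h3]]|/mulsgP [a b]]|[ws [h1 h2 h3]]].
- by exists ws; rewrite h1 h3 leqW.
- move=> /IH [ws [h1 h2 <-]] bK ->; exists (rcons ws b).
  by rewrite all_rcons wprod_rcons size_rcons h1 /= bK.
case/lastP: ws h1 h2 h3 => [|ws a].
  by move=> _ _ <-; left; apply/IH; exists [::].
rewrite all_rcons size_rcons wprod_rcons => /andP [/= aK h1] h2 <-.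
by right; apply: mem_mulg => //; apply/IH; exists ws.
Qed.

Lemma len_min K ws : all (mem K) ws -> len K (wprod ws) <= size ws.
Proof.
move=> h; rewrite /len leqNgt; apply/negP => lt.
have lt2 : size ws < #|gT|.
  by apply: leq_trans lt _; rewrite -{2}(size_iota 0 #|gT|) find_size.
have := before_find 0 lt; rewrite nth_iota // add0n => /ballP; apply.
by exists ws.
Qed.

Lemma len_word K w : w \in <<K>> ->
  exists ws, [/\ all (mem K) ws, size ws = len K w & wprod ws = w].
Proof.
move=> wK.
have ex0 : exists n, w \in ball K n.
  by have [ws h1 h2] := gen_word wK; exists (size ws); apply/ballP; exists ws.
case: (ex_minnP ex0) => n /ballP [ws [h1 h2 h3]] nmin.
have hmin vs : all (mem K) vs -> wprod vs = w -> n <= size vs.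
  by move=> a b; apply: nmin; apply/ballP; exists vs.
have en : size ws = n by apply/eqP; rewrite eqn_leq h2 hmin.
(* The search defining [len] stops at [#|gT|]. It does reach the minimal length, because the
   prefixes of a shortest word are pairwise distinct: between two equal ones the word could be
   cut. *)
have inj : injective (fun i : 'I_n.+1 => wprod (take i ws)).
  have cut i j : i < j -> j <= n -> wprod (take i ws) = wprod (take j ws) -> False.
    move=> lij ljn e; have := hmin (take i ws ++ drop j ws).
    rewrite all_cat wprod_cat e -wprod_cat cat_take_drop h3 size_cat size_take size_drop en.
    rewrite (leq_trans lij ljn) => /(_ _ erefl).
    have -> : all (mem K) (take i ws) && all (mem K) (drop j ws).
      by apply/andP; split; apply/allP => x;
         [move/mem_take|move/mem_drop]; move: x; apply/allP.
    move=> /(_ isT); lia.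
  move=> i j e; apply/val_inj; case: (ltngtP i j) => //= h.
    by case: (cut i j h _ e); rewrite -ltnS.
  by case: (cut j i h _ (esym e)); rewrite -ltnS.
have nlt : n < #|gT| by have := leq_card _ inj; rewrite card_ord.
have hs : has (fun k => w \in ball K k) (iota 0 #|gT|).
  apply/hasP; exists n; first by rewrite mem_iota.
  by apply/ballP; exists ws.
have := nth_find 0 hs; rewrite has_find size_iota in hs; rewrite nth_iota // add0n => hb.
have := nmin _ hb => hn; have := len_min h1; rewrite h3 /len => h4.
exists ws; split => //; apply/eqP; rewrite eqn_leq h4 andbT; lia.
Qed.

End Words.

(** * The lifting property for an abstract relation *)

Section Chain.
Variables (A : finType) (P : pred A) (e : rel A) (f : A -> A).
Hypothesis Pe : forall a b, P a -> e a b -> P b.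
Hypothesis fe : forall a b, P a -> e a b -> e (f a) (f b) || (f a == b).

Lemma chain_closed a b : P a -> connect e a b -> P b.
Proof.
move=> Pa /connectP [p]; elim: p a Pa => [|c p IH] a Pa /=; first by move=> _ ->.
by case/andP=> /(Pe Pa) Pc; exact: IH.
Qed.

(** A step that [f] does not transport is harmless: there [f] of the lower end is the upper end, so
    the rest of the original chain, followed by the passage from [b] to [f b], does the job. It
    serves with [f] a multiplication (Bruhat order) and a twisted conjugation (quasiparabolic
    order). *)
Lemma chain_up a b : P a -> connect e a b -> connect e b (f b) -> connect e (f a) (f b).
Proof.
move=> Pa /connectP [p]; elim: p a Pa => [|c p IH] a Pa /=; first by move=> _ ->.
case/andP=> ac h eb cb; have Pc := Pe Pa ac; case/orP: (fe Pa ac) => [h1|/eqP ->].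
  exact: connect_trans (connect1 h1) (IH _ Pc h eb cb).
by apply: connect_trans cb; apply/connectP; exists p.
Qed.

Hypothesis ff : forall a, P a -> f (f a) = a.

(** Induction from the top of the chain: at a step that [f] does not transport, involutivity makes
    [f] of the upper end equal to the lower end, which the chain has already reached. *)
Lemma chain_dn a b : P a -> connect e a b -> connect e a (f a) -> connect e a (f b).
Proof.
move=> Pa /connectP [p hp ->] ca; elim/last_ind: p hp => [|p c IH] //.
rewrite rcons_path last_rcons => /andP [hp ec].
have cl : connect e a (last a p) by apply/connectP; exists p.
have Pl := chain_closed Pa cl.
case/orP: (fe Pl ec) => [h1|/eqP h]; first exact: connect_trans (IH hp) (connect1 h1).
by rewrite -h ff.
Qed.

End Chain.

(** * Inversions, the strong exchange condition, parabolic subgroups, Bruhat order *)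

Section Coxeter.
Variables (gT : finGroupType) (S : {set gT}).
Hypothesis HC : coxeter_system S.
Implicit Types (w u v s r t : gT) (ws : seq gT).

Notation l := (len S).
Notation W := (<<S>>).
Notation T := (refls S).

Definition F r w := l (r * w) < l w.

Lemma SW s : s \in S -> s \in W. Proof. exact: mem_gen. Qed.
Lemma Sss s : s \in S -> s * s = 1. Proof. by case/HC.1. Qed.
Lemma S_neq1 s : s \in S -> s != 1. Proof. by case/HC.1. Qed.
Lemma Sinv s : s \in S -> s^-1 = s.
Proof. by move/Sss=> h; rewrite -[LHS]mulg1 -h mulKg. Qed.
Lemma SK s w : s \in S -> s * (s * w) = w. Proof. by move=> sS; rewrite mulgA Sss // mul1g. Qed.
Lemma SKr s w : s \in S -> w * s * s = w. Proof. by move=> sS; rewrite -mulgA Sss // mulg1. Qed.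

Lemma len1 : l 1 = 0.
Proof. by apply/eqP; rewrite -leqn0; exact: (@len_min gT S [::]). Qed.

Lemma len0 w : w \in W -> l w = 0 -> w = 1.
Proof. by move=> wW h; have [ws [_ e <-]] := len_word wW; rewrite h in e; rewrite (size0nil e). Qed.

Lemma wprod_rev ws : all (mem S) ws -> wprod (rev ws) = (wprod ws)^-1.
Proof.
elim: ws => [|a ws IH] /=; first by rewrite invg1.
by case/andP=> aS h; rewrite rev_cons wprod_rcons IH // invMg (Sinv aS).
Qed.

Lemma lenV w : w \in W -> l w^-1 = l w.
Proof.
have aux u : u \in W -> l u^-1 <= l u.
  case/len_word=> ws [h1 h2 h3]; rewrite -h2 -h3 -wprod_rev // -(size_rev ws).
  by apply: len_min; rewrite all_rev.
move=> wW; apply/eqP; rewrite eqn_leq aux //=.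
by have := aux w^-1; rewrite invgK groupV => ->.
Qed.

Lemma len_exch s w : s \in S -> w \in W -> l (s * w) <= l w -> (l (s * w)).+1 = l w.
Proof.
move=> sS wW le; have [ws [h1 h2 h3]] := len_word wW.
have le2 : l w <= (l (s * w)).+1.
  have [vs [g1 g2 g3]] := len_word (groupM (SW sS) wW).
  have := @len_min gT S (s :: vs); rewrite /= sS g1 g3 SK // g2; exact.
have [] := HC.2 s ws sS h1; rewrite ?h3 ?h2 // => i hi e.
have : l (s * w) <= (l w).-1.
  rewrite e; apply: leq_trans (len_min _) _.
    by rewrite all_cat; apply/andP; split; apply/allP => x;
       [move/mem_take|move/mem_drop]; move: x; apply/allP.
  rewrite size_cat size_take size_drop h2 hi; lia.
lia.
Qed.

Lemma len_s s w : s \in S -> w \in W -> l (s * w) = if F s w then (l w).-1 else (l w).+1.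
Proof.
move=> sS wW; rewrite /F; case: ltnP => h.
  by rewrite -(len_exch sS wW) // ltnW.
have h2 := len_exch sS (groupM (SW sS) wW); rewrite SK // in h2.
apply/eqP; rewrite eqn_leq; apply/andP; split.
  have [ws [g1 g2 g3]] := len_word wW.
  rewrite -g2 -[X in s * X]g3; apply: (@len_min gT S (s :: ws)); rewrite /= sS. exact: g1.
by rewrite ltn_neqAle h andbT; apply/eqP => e; have := h2; rewrite e leqnn => /(_ isT); lia.
Qed.

Lemma len_sT s w : s \in S -> w \in W -> F s w -> l w = (l (s * w)).+1.
Proof. by move=> sS wW f; rewrite (len_s sS wW) f; move: f; rewrite /F; lia. Qed.

Lemma len_sF s w : s \in S -> w \in W -> ~~ F s w -> l (s * w) = (l w).+1.
Proof. by move=> sS wW /negbTE f; rewrite (len_s sS wW) f. Qed.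

Lemma F_ss s w : s \in S -> w \in W -> F s (s * w) = ~~ F s w.
Proof.
move=> sS wW; rewrite {1}/F SK //; case f: (F s w) => /=.
  by rewrite (len_sT sS wW f) ltnNge leqnSn.
by rewrite (len_sF sS wW (negbT f)) ltnSn.
Qed.

(** The exchange condition for a reduced word of [w] followed by [s'] deletes a letter. Deleting the
    last one is the claim; deleting an earlier one would write [s w] with fewer than [l w]
    letters. *)
Lemma F_fold s s' w : s \in S -> s' \in S -> w \in W ->
  ~~ F s w -> F s (w * s') -> s * w = w * s'.
Proof.
move=> sS s'S wW f1 f2.
have ws'W : w * s' \in W by rewrite groupM // ?SW.
have sws'W : s * (w * s') \in W by rewrite groupM // ?SW.
have swW : s * w \in W by rewrite groupM // ?SW.
have lr u : u \in W -> l (u * s') <= (l u).+1.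
  case/len_word => ws [h1 h2 h3]; rewrite -h2 -h3 -wprod_rcons -(size_rcons ws s').
  by apply: len_min; rewrite all_rcons /= s'S.
have e1 := len_sF sS wW f1; have e2 := len_sT sS ws'W f2.
have h3 := lr _ sws'W; rewrite -!mulgA Sss // mulg1 in h3.
have h4 := lr _ wW.
have [ws [g1 g2 g3]] := len_word wW.
have rS : all (mem S) (rcons ws s') by rewrite all_rcons /= s'S.
have e4 : l (w * s') = (l w).+1 by apply/eqP; rewrite eqn_leq h4 -e1 e2 h3.
have [||i hi e] := HC.2 s (rcons ws s') sS rS.
- by rewrite wprod_rcons g3 size_rcons g2.
- by rewrite wprod_rcons g3 size_rcons g2 -e4; exact: ltnW.
rewrite size_rcons ltnS leq_eqVlt in hi; rewrite wprod_rcons g3 in e.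
case/orP: hi => [/eqP hi|hi].
  move: e; rewrite hi -{1}cats1 take_size_cat // drop_oversize ?size_rcons // cats0 g3 => e.
  by rewrite -{2}e !mulgA SKr.
have e5 : s * w = wprod (take i ws ++ drop i.+1 ws).
  apply: (mulIg s'); rewrite -mulgA e -wprod_rcons -!cats1 take_cat hi.
  by rewrite drop_cat; case: ltnP => h; [rewrite catA|
     have -> : i.+1 = size ws by lia]; rewrite ?drop_size ?subnn ?cats0 //= drop0.
have : l (s * w) <= (l w).-1.
  rewrite e5; apply: leq_trans (len_min _) _.
    by rewrite all_cat; apply/andP; split; apply/allP => x;
       [move/mem_take|move/mem_drop]; move: x; apply/allP.
  rewrite size_cat size_take size_drop -g2 hi; lia.
lia.
Qed.

Lemma F_step_s s s' w : s \in S -> s' \in S -> w \in W ->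
  F s (w * s') = F s w (+) (s == w * s' * w^-1).
Proof.
move=> sS s'S wW; have ws'W : w * s' \in W by rewrite groupM // ?SW.
have E : (s == w * s' * w^-1) = (s * w == w * s').
  by rewrite -(inj_eq (mulIg w)) mulgKV.
rewrite E; case: eqP => [e|ne]; rewrite ?addbT ?addbF.
  by rewrite -e F_ss.
case f1: (F s w); case f2: (F s (w * s')) => //.
  case: ne; have := @F_fold s s' (w * s') sS s'S ws'W; rewrite f2 -mulgA Sss // mulg1 f1.
  by move=> /(_ isT isT) e; rewrite -{1}e SK.
by case: ne; apply: F_fold; rewrite ?f1.
Qed.

Lemma reflP r : reflect (exists v s, [/\ v \in W, s \in S & r = v * s * v^-1]) (r \in T).
Proof.
apply: (iffP imset2P) => [[v s vW sS ->]|[v [s [vW sS ->]]]]; first by exists v, s.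
by exists v s.
Qed.

Lemma TW r : r \in T -> r \in W.
Proof. by case/reflP=> v [s [vW sS ->]]; rewrite !groupM ?groupV // ?SW. Qed.
Lemma ST s : s \in S -> s \in T.
Proof. by move=> sS; apply/reflP; exists 1, s; rewrite group1 sS mul1g invg1 mulg1. Qed.
Lemma TJ r w : r \in T -> w \in W -> w^-1 * r * w \in T.
Proof.
case/reflP=> v [s [vW sS ->]] wW; apply/reflP; exists (w^-1 * v), s.
by rewrite groupM ?groupV // sS invMg invgK !mulgA.
Qed.
Lemma TJV r w : r \in T -> w \in W -> w * r * w^-1 \in T.
Proof. by move=> rT wW; rewrite -{1}(invgK w) TJ // groupV. Qed.
Lemma Tss r : r \in T -> r * r = 1.
Proof. by case/reflP=> v [s [vW sS ->]]; rewrite !mulgA mulgKV SKr // mulgV. Qed.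
Lemma T_neq1 r : r \in T -> r != 1.
Proof.
case/reflP=> v [s [vW sS ->]]; apply: contra (S_neq1 sS) => /eqP e.
by apply/eqP/(mulgI v)/(mulIg v^-1); rewrite e mulg1 mulgV.
Qed.
Lemma Tinv r : r \in T -> r^-1 = r.
Proof. by move/Tss=> h; rewrite -[LHS]mulg1 -h mulKg. Qed.
Lemma TK r w : r \in T -> r * (r * w) = w. Proof. by move=> sS; rewrite mulgA Tss // mul1g. Qed.

(* The right-hand side does not mention [l]: a function of [w] vanishing at [1] and with
   these increments is unique, which makes it independent of how [r] is written. *)
Lemma F_spec r : r \in T -> exists g : gT -> bool,
  [/\ g 1 = false,
      forall w s, w \in W -> s \in S -> g (w * s) = g w (+) (r == w * s * w^-1)
    & forall w, w \in W -> g (r * w) = ~~ g w].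
Proof.
case/reflP=> v [s [vW sS ->]].
exists (fun w => F s (v^-1 * w) (+) F s v^-1); split.
- by rewrite mulg1 addbb.
- move=> w s' wW s'S; rewrite mulgA F_step_s ?groupM ?groupV //.
  rewrite -!addbA (addbC (_ == _)); congr (_ (+) (_ (+) _)).
  rewrite -(inj_eq (mulgI v)) -(inj_eq (mulIg v^-1)); congr (_ == _).
  by rewrite invMg invgK !mulgA mulgV mul1g mulgK.
move=> w wW; rewrite !mulgA mulVg mul1g -(mulgA s) F_ss ?groupM ?groupV //.
by rewrite addNb.
Qed.

Lemma del_wprod ws i : i < size ws ->
  wprod (take i ws) * nth 1 ws i * (wprod (take i ws))^-1 * wprod ws =
  wprod (take i ws) * nth 1 ws i * nth 1 ws i * wprod (drop i.+1 ws).
Proof.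
move=> hi; have e : wprod ws = wprod (take i ws) * (nth 1 ws i * wprod (drop i.+1 ws)).
  by rewrite -{1}(cat_take_drop i ws) (drop_nth 1 hi) wprod_cat.
by rewrite {1}e !mulgA mulgKV.
Qed.

(** [g] starts at false and changes only at letters whose reflection is [r], so a word on which it
    ends up true has passed one. *)
Lemma F_cross r (g : gT -> bool) : r \in T -> g 1 = false ->
  (forall w s, w \in W -> s \in S -> g (w * s) = g w (+) (r == w * s * w^-1)) ->
  forall ws, all (mem S) ws -> g (wprod ws) ->
  exists2 i, i < size ws & r = wprod (take i ws) * nth 1 ws i * (wprod (take i ws))^-1.
Proof.
move=> rT g1 gs; elim/last_ind => [|ws s IH]; first by rewrite /= g1.
rewrite all_rcons wprod_rcons => /andP [/= sS wsS].
rewrite gs ?wprod_gen //; case gw: (g (wprod ws)) => /=.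
  move=> _; have [//|i hi e] := IH wsS; exists i; first by rewrite size_rcons ltnS ltnW.
  by rewrite -cats1 take_cat hi nth_cat hi.
move=> /eqP e; exists (size ws); first by rewrite size_rcons.
by rewrite nth_rcons ltnn eqxx -cats1 take_size_cat.
Qed.

Lemma all_del (A : {set gT}) ws i : all (mem A) ws -> all (mem A) (take i ws ++ drop i.+1 ws).
Proof.
move=> h; rewrite all_cat; apply/andP; split; apply/allP => x;
  [move/mem_take|move/mem_drop]; move: x; exact/allP.
Qed.

(** If [g w], multiplying by [r] deletes a letter of a reduced word of [w] and shortens it; if not,
    the same applies to [r w]. *)
Lemma F_g r (g : gT -> bool) : r \in T -> g 1 = false ->
  (forall w s, w \in W -> s \in S -> g (w * s) = g w (+) (r == w * s * w^-1)) ->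
  (forall w, w \in W -> g (r * w) = ~~ g w) ->
  forall w, w \in W -> F r w = g w.
Proof.
move=> rT g1 gs gr.
have lt w : w \in W -> g w -> F r w.
  case/len_word=> ws [h1 h2 h3]; rewrite -h3 in h2 *.
  move=> /(F_cross rT g1 gs h1) [i hi ->]; rewrite /F del_wprod //.
  have nS : nth 1 ws i \in S by have /allP := h1; apply; rewrite mem_nth.
  rewrite SKr // -wprod_cat; apply: leq_ltn_trans (len_min (all_del _ h1)) _.
  by rewrite -h2 size_cat size_take size_drop hi; lia.
move=> w wW; case gw: (g w); first exact: lt.
have := lt (r * w); rewrite gr // gw groupM // ?TW // => /(_ isT isT).
by rewrite /F TK // => h; apply/negbTE; rewrite -leqNgt ltnW.
Qed.

Lemma F_step r w s : r \in T -> w \in W -> s \in S -> F r (w * s) = F r w (+) (r == w * s * w^-1).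
Proof.
move=> rT wW sS; have [g [g1 g2 g3]] := F_spec rT.
by rewrite !(F_g rT g1 g2 g3) ?groupM // ?SW // g2.
Qed.

Lemma F1 r : r \in T -> F r 1 = false.
Proof. by rewrite /F len1. Qed.

Lemma F_r r w : r \in T -> w \in W -> F r (r * w) = ~~ F r w.
Proof.
move=> rT wW; have [g [g1 g2 g3]] := F_spec rT.
by rewrite !(F_g rT g1 g2 g3) ?groupM // ?TW // g3.
Qed.

Lemma F_word r ws : r \in T -> all (mem S) ws -> F r (wprod ws) ->
  exists2 i, i < size ws & r = wprod (take i ws) * nth 1 ws i * (wprod (take i ws))^-1.
Proof.
move=> rT h; apply: (F_cross rT (F1 rT)) => // w s wW sS; exact: F_step.
Qed.

(** For inversion sets this reads N(uw) = N(u) + u N(w) u^-1 with symmetric difference as sum. Most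
    later length comparisons are instances of it. *)
Lemma F_coc r u w : r \in T -> u \in W -> w \in W ->
  F r (u * w) = F r u (+) F (u^-1 * r * u) w.
Proof.
move=> rT uW /gen_word [ws h <-]; elim/last_ind: ws h => [|ws s IH].
  by rewrite /= mulg1 F1 ?addbF // TJ.
rewrite all_rcons wprod_rcons => /andP [/= sS h].
have wW := wprod_gen h.
rewrite mulgA (F_step rT _ sS) ?groupM // (F_step _ _ sS) ?TJ // IH // addbA.
congr (_ (+) _).
rewrite -(inj_eq (mulgI u^-1)) -(inj_eq (mulIg u)); congr (_ == _).
by rewrite invMg !mulgA mulVg mul1g mulgKV.
Qed.

Lemma F_s r s : r \in T -> s \in S -> F r s = (r == s).
Proof. by move=> rT sS; rewrite -{1}(mul1g s) F_step // F1 // addFb mul1g invg1 mulg1. Qed.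

Lemma lenT r w : r \in T -> w \in W -> (l w < l (r * w)) = ~~ F r w.
Proof. by move=> rT wW; rewrite -F_r // /F TK. Qed.

Lemma lenT_neq r w : r \in T -> w \in W -> l (r * w) <> l w.
Proof.
move=> rT wW e; have := lenT rT wW; rewrite /F e ltnn. by [].
Qed.

Lemma lenTr r w : r \in T -> w \in W -> l (w * r) = l (r * w^-1).
Proof. by move=> rT wW; rewrite -[in RHS](Tinv rT) -invMg lenV // groupM // ?TW. Qed.

(** With [r = v s v^-1] the cocycle splits [F r' r] into three terms. The middle one asks whether
    [v^-1 r' v] is [s], which fails; by commutation the outer two are the terms of [F r' (v * v^-1)]
    and cancel. *)
Lemma F_comm r r' : r \in T -> r' \in T -> r * r' = r' * r -> r' != r -> F r' r = false.
Proof.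
move=> rT r'T; case/reflP: (rT) => v [s [vW sS e]] c ne.
have svW : s * v^-1 \in W by rewrite groupM ?groupV // ?SW.
have F0 : F r' (v * v^-1) = false by rewrite mulgV F1.
rewrite F_coc ?groupV // in F0.
rewrite e -mulgA F_coc //; rewrite F_coc ?TJ ?groupV // ?SW // (F_s _ sS) ?TJ //.
have -> : (v^-1 * r' * v == s) = false.
  apply/negbTE; apply: contra ne => /eqP h; apply/eqP; rewrite e -h.
  by rewrite !mulgA mulgV mul1g mulgK.
have -> : s^-1 * (v^-1 * r' * v) * s = v^-1 * r' * v.
  have sE : s = v^-1 * r * v by rewrite e !mulgA mulVg mul1g mulgKV.
  rewrite Sinv // sE !mulgA mulgK mulgK -!(mulgA v^-1); congr (_ * (_ * _)).
  by rewrite c -mulgA Tss ?mulg1.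
by rewrite addFb.
Qed.

(** Exchange applied to a word in [K] only deletes letters and so stays in [K]. Hence length on W_K
    is the restriction of [len S], and no separate length for [K] is ever used. *)
Lemma parabolic_word (K : {set gT}) w : K \subset S -> w \in <<K>> -> exists ws,
  [/\ all (mem K) ws, size ws = l w & wprod ws = w].
Proof.
move=> KS /gen_word [ws]; elim: ws w => [|s ws IH] w /=.
  by move=> _ <-; exists [::]; rewrite len1.
case/andP=> sK h <-; have sS := subsetP KS _ sK.
have [vs [g1 g2 g3]] := IH _ h erefl.
have vsS : all (mem S) vs by apply/allP=> x /(allP g1) /= /(subsetP KS).
rewrite -g3; have vW := wprod_gen vsS; case f: (F s (wprod vs)); last first.
  by exists (s :: vs); rewrite /= sK g1 len_sF ?f // g2 g3.
have [||i hi e] := HC.2 s vs sS vsS; rewrite ?g2 ?g3 //.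
  by move: f; rewrite g3 => /ltnW.
rewrite g2 g3 in hi e; rewrite e; exists (take i vs ++ drop i.+1 vs); split => //.
  exact: all_del.
rewrite -e; rewrite g3 in f vW; rewrite (len_s sS vW) f size_cat size_take size_drop g2 hi; lia.
Qed.

Section Parabolic.
Variable K : {set gT}.
Hypothesis KS : K \subset S.
Notation TK := (refls K).

Lemma KSe s : s \in K -> s \in S. Proof. exact: (subsetP KS). Qed.
Lemma WKW w : w \in <<K>> -> w \in W. Proof. exact/subsetP/genS. Qed.
Lemma KWK s : s \in K -> s \in <<K>>. Proof. exact: mem_gen. Qed.

Lemma TKP r : reflect (exists v s, [/\ v \in <<K>>, s \in K & r = v * s * v^-1]) (r \in TK).
Proof.
apply: (iffP imset2P) => [[v s vW sS ->]|[v [s [vW sS ->]]]]; first by exists v, s.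
by exists v s.
Qed.

Lemma TKT r : r \in TK -> r \in T.
Proof.
by case/TKP=> v [s [vK sK ->]]; apply/reflP; exists v, s; rewrite WKW // KSe.
Qed.

Lemma TKWK r : r \in TK -> r \in <<K>>.
Proof. by case/TKP=> v [s [vK sK ->]]; rewrite !groupM ?groupV // KWK. Qed.

Lemma KTK s : s \in K -> s \in TK.
Proof. by move=> sK; apply/TKP; exists 1, s; rewrite group1 sK mul1g invg1 mulg1. Qed.

Lemma TKJ r w : r \in TK -> w \in <<K>> -> w * r * w^-1 \in TK.
Proof.
case/TKP=> v [s [vW sS ->]] wW; apply/TKP; exists (w * v), s.
by rewrite groupM // sS invMg !mulgA.
Qed.

Lemma F_TK r u : r \in T -> u \in <<K>> -> F r u -> r \in TK.
Proof.
move=> rT /(parabolic_word KS) [ws [h1 h2 <-]].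
have wsS : all (mem S) ws by apply/allP=> x /(allP h1) /KSe.
move/(F_word rT wsS) => [i hi ->]; apply/TKP; exists (wprod (take i ws)), (nth 1 ws i).
split=> //; last by have /allP := h1; apply; rewrite mem_nth.
by apply: wprod_gen; apply/allP=> x /mem_take; move: x; exact/allP.
Qed.

Lemma lenS1 s : s \in S -> l s = 1%N.
Proof. by move=> sS; rewrite -(mulg1 s) len_sF ?group1 ?F1 ?ST // len1. Qed.

Lemma lenK1 w : w \in <<K>> -> l w = 1%N -> w \in K.
Proof.
move=> wK h; have [[|a [|b ws]] [h1 h2 <-]] := parabolic_word KS wK; rewrite h // in h2.
by move: h1; rewrite /= mulg1 => /andP [].
Qed.

Lemma ldescK w : w \in <<K>> -> w != 1 -> exists2 s, s \in K & F s w.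
Proof.
move=> /(parabolic_word KS) [[|a ws] [h1 h2 h3]]; first by rewrite -h3 eqxx.
move: h1 => /= /andP [aK h] _; exists a => //.
rewrite /F -h2 -h3 /= SK ?KSe // ltnS; apply: len_min.
by apply/allP=> x /(allP h) /KSe.
Qed.

Lemma lmin_add x v : x \in W -> (forall r, r \in TK -> ~~ F r x) -> v \in <<K>> ->
  l (v * x) = l v + l x.
Proof.
move=> xW xmin /gen_word [ws h <-]; elim: ws h => [|s ws IH] /=.
  by rewrite mul1g len1.
case/andP=> sK h; have vK := wprod_gen h; have sS := KSe sK.
have vW := WKW vK.
rewrite -mulgA len_s ?groupM // F_coc ?ST //.
rewrite (negbTE (xmin _ _)) ?addbF ?IH //; last first.
  by rewrite -{2}(invgK (wprod ws)) TKJ ?KTK ?groupV.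
rewrite (len_s sS vW); case f: (F s (wprod ws)) => //.
by have := len_sT sS vW f; case: (l (wprod ws)).
Qed.

Lemma lmin_dec w : w \in W -> exists u x,
  [/\ u \in <<K>>, x \in W, forall r, r \in TK -> ~~ F r x & w = u * x].
Proof.
move=> wW; pose P (v : gT) := v \in <<K>>.
have [v vK vmin] : {v : gT | P v & forall u : gT, P u -> l (v * w) <= l (u * w)}.
  by case: (@arg_minnP gT 1 P (fun v : gT => l (v * w))) => [|v]; [exact: group1|exists v].
exists v^-1, (v * w); split.
- by rewrite groupV.
- by rewrite groupM // WKW.
- by move=> r rT; rewrite /F -leqNgt mulgA; apply: vmin; rewrite /P groupM // TKWK.
by rewrite mulKg.
Qed.

Lemma lmin_refl x : x \in W -> (forall s, s \in K -> ~~ F s x) ->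
  forall r, r \in TK -> ~~ F r x.
Proof.
move=> xW xmin; have [u [x0 [uK x0W x0min e]]] := lmin_dec xW.
case: (eqVneq u 1) => [u1|une]; first by rewrite e u1 mul1g.
have [s sK fs] := ldescK uK une; case/negP: (xmin s sK).
rewrite e F_coc ?ST ?KSe // ?WKW // fs (negbTE (x0min _ _)) //.
by rewrite -{2}(invgK u) TKJ ?KTK ?groupV.
Qed.

Lemma F_lmin r v x : r \in TK -> v \in <<K>> -> x \in W -> (forall r, r \in TK -> ~~ F r x) ->
  F r (v * x) = F r v.
Proof.
move=> rK vK xW xm; rewrite F_coc ?TKT // ?WKW // (negbTE (xm _ _)) ?addbF //.
by rewrite -{2}(invgK v) TKJ ?groupV.
Qed.

Lemma minrepW w : minrep S K w -> w \in W. Proof. by case/andP. Qed.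

Lemma minrep_lmin w : minrep S K w -> forall r, r \in TK -> ~~ F r w^-1.
Proof.
case/andP=> wW /forall_inP h; apply: lmin_refl; rewrite ?groupV // => s sK.
have sS := KSe sK.
by rewrite /F -lenTr ?ST // lenV // -leqNgt ltnW // h.
Qed.

Lemma minrep_add w v : minrep S K w -> v \in <<K>> -> l (w * v) = l w + l v.
Proof.
move=> wm vK; have wW := minrepW wm.
rewrite -lenV ?groupM // ?WKW // invMg (lmin_add _ (minrep_lmin wm)) ?groupV //.
by rewrite addnC !lenV // ?WKW.
Qed.

(** Deodhar's lemma. As [w] has no right descent in [K], a right descent [t] of [s w] is an
    inversion of [w^-1 s] created by its last letter, so it equals [w^-1 s w]. *)
Lemma minrep_act s w : s \in S -> minrep S K w -> ~~ minrep S K (s * w) ->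
  (w^-1 * s * w \in K) && ~~ F s w.
Proof.
move=> sS wm; have wW := minrepW wm; have swW : s * w \in W by rewrite groupM // SW.
rewrite /minrep swW /= => /forall_inPn [t tK]; have tS := KSe tK; rewrite -leqNgt => le.
have f : F t (w^-1 * s).
  move: le; rewrite leq_eqVlt => /orP [/eqP e|].
    have := @lenT_neq t (s * w)^-1 (ST tS); rewrite groupV swW => /(_ isT).
    by rewrite -lenTr ?ST // lenV.
  by rewrite lenTr ?ST // -(lenV swW) invMg (Sinv sS).
move: f; rewrite F_step ?ST ?groupV // (negbTE (minrep_lmin wm _)) ?KTK //= => /eqP e.
rewrite invgK in e; rewrite -e tK /=.
have -> : F s w = (l (w * t) < l w).
  by rewrite /F e !mulgA mulgV mul1g.
by rewrite minrep_add ?KWK // -leqNgt leq_addr.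
Qed.

Lemma minrep_desc s w : s \in S -> minrep S K w -> F s w -> minrep S K (s * w).
Proof. by move=> sS wm f; apply: contraT => /(minrep_act sS wm); rewrite f andbF. Qed.

Lemma minrep1 : minrep S K 1.
Proof. by rewrite /minrep group1 len1; apply/forall_inP => s /KSe /lenS1; rewrite mul1g => ->. Qed.

Lemma minrep_eq1 w : minrep S K w -> w \in <<K>> -> w = 1.
Proof.
move=> wm wK; have := minrep_add wm (groupVr wK); rewrite mulgV len1 => e.
by apply: len0; [exact: WKW|llia].
Qed.

Lemma minrep_inj w w' v v' : minrep S K w -> minrep S K w' -> v \in <<K>> -> v' \in <<K>> ->
  w * v = w' * v' -> w = w' /\ v = v'.
Proof.
move=> wm wm' vK vK' e.
have e1 : w = w' * (v' * v^-1) by rewrite mulgA -e mulgK.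
have e2 : w' = w * (v' * v^-1)^-1 by rewrite {1}e1 mulgK.
have uK : v' * v^-1 \in <<K>> by rewrite groupM ?groupV.
have := minrep_add wm' uK; have := minrep_add wm (groupVr uK).
rewrite -e1 -e2 lenV // ?WKW // => h1 h2.
have u1 : v' * v^-1 = 1 by apply: len0; [exact: WKW|llia].
move: e1; rewrite u1 mulg1 => ->; split => //.
by rewrite -(mul1g v) -u1 mulgKV.
Qed.

Lemma longest_in : longest S K \in <<K>>.
Proof. by rewrite /longest; case: arg_maxnP => //; exact: group1. Qed.

Lemma F_longest r : r \in TK -> F r (longest S K).
Proof.
rewrite /longest => rK; case: arg_maxnP => [|w wK wmax]; first exact: group1.
have le : l (r * w) <= l w by apply: wmax; rewrite groupM // TKWK.
rewrite /F ltn_neqAle le andbT; apply/eqP/lenT_neq; [exact: TKT|exact: WKW].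
Qed.

Lemma len_longest v : v \in <<K>> -> l (v * longest S K) + l v = l (longest S K).
Proof.
move=> /(parabolic_word KS) [ws [h1 h2 h3]]; rewrite -{v}h3 in h2 *.
elim: ws h1 h2 => [|s ws IH] /=; first by rewrite mul1g len1 addn0.
case/andP=> sK h h2; have vK := wprod_gen h; have sS := KSe sK; have vW := WKW vK.
have xW := WKW longest_in.
have h4 : ~~ F s (wprod ws).
  rewrite /F -h2 -leqNgt; apply: leq_trans (leqnSn _); apply: len_min.
  by apply/allP=> x /(allP h) /KSe.
have h3 := len_sF sS vW h4.
have {}IH := IH h; rewrite h3 in h2 *; case: h2 => /IH <-.
rewrite -mulgA (@len_sT s (wprod ws * _)) ?groupM //; first by rewrite addnS addSn.
rewrite F_coc ?ST // (negbTE h4) F_longest //.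
by rewrite -{2}(invgK (wprod ws)) TKJ ?KTK ?groupV.
Qed.

Lemma longest2 : longest S K * longest S K = 1.
Proof.
have xW := WKW longest_in.
by apply: len0; rewrite ?groupM //; have := len_longest longest_in; llia.
Qed.

Lemma longestV : (longest S K)^-1 = longest S K.
Proof. by rewrite -[LHS]mulg1 -longest2 mulKg. Qed.

Lemma len_longestl v : v \in <<K>> -> l (longest S K * v) + l v = l (longest S K).
Proof.
move=> vK; rewrite -(lenV (WKW vK)) -(len_longest (groupVr vK)); congr (_ + _).
by rewrite -lenV ?groupM // ?WKW ?longest_in // invMg longestV.
Qed.

Lemma len_longestJ v : v \in <<K>> -> l (longest S K * v * longest S K) = l v.
Proof.
move=> vK; have xK := longest_in.
have := len_longestl vK; have := len_longest (groupM xK vK); llia.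
Qed.

Lemma longestJ s : s \in K -> longest S K * s * longest S K \in K.
Proof.
move=> sK; apply: lenK1; rewrite ?groupM ?longest_in ?KWK //.
by rewrite len_longestJ ?KWK // lenS1 // KSe.
Qed.

(** Write [x = y w_K]. A left descent of a nontrivial [y] would fail to be one of [x], since every
    reflection of W_K is an inversion of [w_K]. *)
Lemma longest_uniq x : x \in <<K>> -> (forall s, s \in K -> F s x) -> x = longest S K.
Proof.
move=> xK xd; have := len_longest xK; have wK := longest_in.
set y := x * longest S K; have yK : y \in <<K>> by rewrite groupM.
have ex : x = y * longest S K by rewrite /y -mulgA longest2 mulg1.
case: (eqVneq y 1) => [y1 _|yn]; first by rewrite ex y1 mul1g.
have [s sK fs] := ldescK yK yn; have := xd s sK.
rewrite ex F_coc ?ST ?KSe // ?WKW // fs F_longest //.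
by rewrite -{2}(invgK y) TKJ ?KTK ?groupV.
Qed.

End Parabolic.

Lemma bruhat_stepP v w : v \in W ->
  reflect (exists2 t, t \in T & w = v * t /\ ~~ F t v^-1) (bruhat_step S v w).
Proof.
move=> vW; apply: (iffP exists_inP) => [[t tT /andP [/eqP -> h]]|[t tT [-> h]]];
  exists t => //.
  by split=> //; rewrite -lenT ?groupV // -lenTr // lenV.
by rewrite eqxx lenTr //= -(lenV vW) lenT ?groupV.
Qed.

Lemma bruhat_step_W v w : v \in W -> bruhat_step S v w -> w \in W.
Proof. by move=> vW /bruhat_stepP - /(_ vW) [t tT [-> _]]; rewrite groupM // ?TW. Qed.

(** Steps multiply on the right, so [t] itself is kept. It can become an inversion of [(s v)^-1]
    only if it equals [v^-1 s v], and this is the exceptional case. *)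
Lemma bruhat_step_left s v w : s \in S -> v \in W -> bruhat_step S v w ->
  bruhat_step S (s * v) (s * w) || (s * v == w).
Proof.
move=> sS vW /bruhat_stepP - /(_ vW) [t tT [-> h]].
have svW : s * v \in W by rewrite groupM // SW.
case f: (F t (s * v)^-1); last first.
  by apply/orP; left; apply/bruhat_stepP => //; exists t; rewrite ?mulgA ?f.
apply/orP; right; move: f; rewrite invMg (Sinv sS) // F_step ?groupV // (negbTE h) /=.
by move/eqP=> ->; rewrite !mulgA mulgV mul1g invgK.
Qed.

Lemma bruhat_step_right s v w : s \in S -> v \in W -> bruhat_step S v w ->
  bruhat_step S (v * s) (w * s) || (v * s == w).
Proof.
move=> sS vW /bruhat_stepP - /(_ vW) [t tT [-> h]].
case: (eqVneq t s) => [->|ne]; rewrite ?eqxx ?orbT //.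
have vsW : v * s \in W by rewrite groupM // SW.
apply/orP; left; apply/bruhat_stepP => //; exists (s^-1 * t * s).
  by rewrite TJ // SW.
split; first by rewrite !mulgA mulgK.
have stT : s^-1 * t * s \in T by rewrite TJ // SW.
have fs : F (s^-1 * t * s) s = false.
  rewrite F_s //; apply/negbTE; apply: contra ne => /eqP e; apply/eqP.
  by apply: (mulgI s^-1); apply: (mulIg s); rewrite e mulVg mul1g.
rewrite [(v * s)^-1]invMg [s^-1 in X in F _ X](Sinv sS) F_coc ?groupV // ?SW // fs /=.
by rewrite (Sinv sS) !mulgA Sss // mul1g SKr.
Qed.

Lemma bruhat_up s w : s \in S -> w \in W -> ~~ F s w -> connect (bruhat_step S) w (s * w).
Proof.
move=> sS wW f.
apply: connect1; apply/bruhat_stepP => //; exists (w^-1 * s * w); first by rewrite TJ ?ST.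
split; first by rewrite !mulgA mulgV mul1g.
by have := F_coc (ST sS) wW (groupVr wW); rewrite mulgV F1 ?ST // (negbTE f) /= => <-.
Qed.

Lemma bruhat_lift_left s v w : s \in S -> v \in W -> connect (bruhat_step S) v w ->
  ~~ F s w -> connect (bruhat_step S) (s * v) (s * w).
Proof.
move=> sS vW c f; apply: (chain_up (P := [in W]) (e := bruhat_step S) (f := mulg s)) => //.
- by move=> a b; exact: bruhat_step_W.
- by move=> a b aW; exact: bruhat_step_left.
have wW : w \in W by apply: (chain_closed (P := [in W])) c => // a b; exact: bruhat_step_W.
exact: bruhat_up.
Qed.

Lemma bruhat_lift_right s v w : s \in S -> v \in W -> connect (bruhat_step S) v w ->
  l v < l (v * s) -> connect (bruhat_step S) v (w * s).
Proof.
move=> sS vW c f.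
apply: (chain_dn (P := [in W]) (e := bruhat_step S) (f := mulg^~ s)) => //=.
- by move=> a b; exact: bruhat_step_W.
- by move=> a b aW; exact: bruhat_step_right.
- by move=> a aW; rewrite SKr.
apply: connect1; apply/bruhat_stepP => //; exists s; first exact: ST.
by split=> //; rewrite -lenT ?groupV ?ST // -lenTr ?ST // lenV.
Qed.

Lemma bruhat_len v w : v \in W -> connect (bruhat_step S) v w -> v = w \/ l v < l w.
Proof.
move=> vW /connectP [p]; elim: p v vW => [|a p IH] v vW /=; first by move=> _ ->; left.
case/andP=> st h e; have aW := bruhat_step_W vW st; right.
have : l v < l a by case/exists_inP: st => t tT /andP [].
by case: (IH a aW h e) => [<-|h2 h3] //; apply: ltn_trans h2.
Qed.

End Coxeter.

End Coxeter.
Import Coxeter.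

(** * Twisted conjugation and perfect involutions *)

Module PerfectInvolutions.

Lemma cnjE (gT : finGroupType) t (z : gT * {perm gT}) : cnj t z = (t * z.1 * z.2 t, z.2).
Proof. by rewrite /cnj /sdmul /emb /= perm1 mulg1 mul1g. Qed.

Opaque cnj.

Section Perfect.
Variables (gT : finGroupType) (S : {set gT}).
Hypothesis HC : coxeter_system S.
Variable K : {set gT}.
Hypothesis KS : K \subset S.
Implicit Types (w u v s r t a b : gT) (z : gT * {perm gT}) (th : {perm gT}).

Notation l := (len S).
Notation W := (<<S>>).
Notation T := (refls S).
Notation WK := (<<K>>).
Notation TK := (refls K).
Notation F := (F S).

(** Conjugation by [z = (y, th)] in the semidirect product, restricted to W_K. For an involution it
    is [a -> z a z], so [(z t)^4 = 1] means that [psi z t] and [t] commute. *)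
Definition psi z a := z.1 * z.2 a * z.1^-1.

Section Aut.
Variable th : {perm gT}.
Hypothesis thA : th \in autKK K.

Lemma thAut : th \in Aut WK. Proof. by move: thA; rewrite inE => /andP []. Qed.
Lemma thM a b : a \in WK -> b \in WK -> th (a * b) = th a * th b.
Proof. by have /morphicP h := Aut_morphic thAut; exact: h. Qed.
Lemma thW a : a \in WK -> th a \in WK.
Proof. by move=> h; rewrite (Aut_closed thAut). Qed.
Lemma th1 : th 1 = 1.
Proof. by apply: (mulgI (th 1)); rewrite -thM ?group1 // !mulg1. Qed.
Lemma thV a : a \in WK -> th a^-1 = (th a)^-1.
Proof.
by move=> h; apply: (mulgI (th a)); rewrite mulgV -thM ?groupV // mulgV th1.
Qed.
Lemma thK s : s \in K -> th s \in K.
Proof.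
move: thA; rewrite inE => /andP [_ /eqP e] sK; rewrite -e; exact: imset_f.
Qed.
Lemma thT r : r \in TK -> th r \in TK.
Proof.
case/TKP=> v [s [vK sK ->]]; have sW := KWK sK.
rewrite !thM ?groupM ?groupV // thV //; apply/TKP; exists (th v), (th s).
by rewrite thW // thK.
Qed.
Lemma th_len_le a : a \in WK -> l (th a) <= l a.
Proof.
case/(parabolic_word HC KS)=> ws [h <- <-]; elim: ws h => [|s ws IH] /=.
  by rewrite th1 (len1 S).
case/andP=> sK h; rewrite thM ?(wprod_gen h) ?KWK //.
have sS := KSe KS (thK sK); have vW := WKW KS (thW (wprod_gen h)).
rewrite (len_s HC sS vW); case: ifP => _; have := IH h; llia.
Qed.
End Aut.

(** Perfectness without the commutation condition. Some auxiliary elements, such as [(t1 y, th)] in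
    the braid relations, are only shown to satisfy this much. *)
Definition tinv z := [/\ z.1 \in WK, z.2 \in autKK K, z.1 * z.2 z.1 = 1
  & forall a, z.2 (z.2 a) = a].

Section Tinv.
Variable z : gT * {perm gT}.
Hypothesis zt : tinv z.
Let y := z.1.
Let th := z.2.

Lemma yK : y \in WK. Proof. by case: zt. Qed.
Lemma yW : y \in W. Proof. exact (WKW KS yK). Qed.
Lemma thA : th \in autKK K. Proof. by case: zt. Qed.
Lemma thth a : th (th a) = a. Proof. by case: zt. Qed.
Lemma thy : th y = y^-1.
Proof. by case: zt => _ _ e _; apply: (mulgI y); rewrite mulgV. Qed.

Lemma th_len a : a \in WK -> l (th a) = l a.
Proof.
move=> aK; apply/eqP; rewrite eqn_leq (th_len_le thA) //=.
by rewrite -{1}(thth a) (th_len_le thA) // (thW thA).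
Qed.

Lemma F_th r a : r \in WK -> a \in WK -> F (th r) (th a) = F r a.
Proof. by move=> rK aK; rewrite /Coxeter.F -(thM thA) // !th_len // groupM. Qed.

Lemma psiM a b : a \in WK -> b \in WK -> psi z (a * b) = psi z a * psi z b.
Proof. by move=> aK bK; rewrite /psi (thM thA) // !mulgA mulgKV. Qed.
Lemma psiW a : a \in WK -> psi z a \in WK.
Proof. by move=> aK; rewrite /psi !groupM ?groupV ?yK // (thW thA). Qed.
Lemma psiK a : a \in WK -> psi z (psi z a) = a.
Proof.
move=> aK; rewrite /psi -/th -/y !(thM thA) ?groupM ?groupV ?yK ?(thW thA) //.
by rewrite (thV thA) ?yK // thy invgK thth !mulgA mulgV mul1g mulgK.
Qed.
Lemma psiT r : r \in TK -> psi z r \in TK.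
Proof. by move=> rK; apply: (TKJ _ yK); exact: thT thA _ rK. Qed.
Lemma psi_y a : psi z a * y = y * th a. Proof. by rewrite /psi mulgKV. Qed.
Lemma th_psi a : a \in WK -> th (psi z a) = y^-1 * a * y.
Proof.
move=> aK; rewrite /psi -/th -/y !(thM thA) ?groupM ?groupV ?yK ?(thW thA) //.
by rewrite (thV thA) ?yK // thy invgK thth.
Qed.

Lemma F_psi_th q u : q \in TK -> u \in WK -> F (y^-1 * q * y) (th u) = F (psi z q) u.
Proof. by move=> qK uK; rewrite -th_psi ?TKWK // F_th // psiW // TKWK. Qed.

(** [psi z r * y = y * th r] is the inverse of [th (r * y)], and both inversion and [th] preserve
    length. *)
Lemma len_psi r : r \in TK -> l (psi z r * y) = l (r * y).
Proof.
move=> rK; have rW := TKWK rK; have ryW : r * y \in WK by rewrite groupM ?yK.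
rewrite psi_y -(lenV HC) ?groupM ?yW ?(WKW KS) ?(thW thA) // invMg -(thV thA) //.
by rewrite (Tinv HC (TKT KS rK)) -thy -(thM thA) ?yK // th_len.
Qed.

Lemma F_psi r : r \in TK -> F (psi z r) y = F r y.
Proof. by move=> rK; rewrite /Coxeter.F len_psi. Qed.

End Tinv.

Lemma twactM u v z : tinv z -> u \in WK -> v \in WK -> twact (u * v) z = twact u (twact v z).
Proof.
move=> zt uK vK; rewrite /twact; congr (_, _).
by rewrite (thM (thA zt)) // invMg !mulgA.
Qed.

Lemma twact1 z : tinv z -> twact 1 z = z.
Proof. by move=> zt; rewrite /twact (th1 (thA zt)) invg1 mulg1 mul1g; case: (z). Qed.

Lemma cnj_tw r z : tinv z -> r \in TK -> cnj r z = twact r z.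
Proof.
move=> zt rK; rewrite cnjE /twact.
by rewrite -[X in _ = (_ * X, _)](thV (thA zt)) ?TKWK // (Tinv HC (TKT KS rK)).
Qed.

Lemma tinv_tw u z : tinv z -> u \in WK -> tinv (twact u z).
Proof.
move=> zt uK; have thA := thA zt; have yK := yK zt; have yiK := groupVr yK.
have tuK := thW thA uK; have tuiK := groupVr tuK; have tyK := thW thA yK.
split=> /=; rewrite ?groupM //; last by case: zt.
rewrite !(thM thA) ?groupM // (thV thA) // (thth zt) (thy zt).
by rewrite !mulgA mulgKV mulgK mulgV.
Qed.

Lemma psi_tw u z a : tinv z -> u \in WK -> a \in WK ->
  psi (twact u z) a = u * psi z (u^-1 * a * u) * u^-1.
Proof.
move=> zt uK aK; rewrite /psi /twact /= !(thM (thA zt)) ?groupM ?groupV //.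
by rewrite (thV (thA zt)) // !invMg invgK !mulgA.
Qed.

Lemma tinv_cnj r z : tinv z -> r \in TK -> tinv (cnj r z).
Proof. by move=> zt rK; rewrite cnj_tw //; apply: tinv_tw; rewrite ?TKWK. Qed.

Lemma cnj_inv r z : tinv z -> r \in TK -> cnj r (cnj r z) = z.
Proof.
move=> zt rK; rewrite (cnj_tw (tinv_cnj zt rK) rK) (cnj_tw zt rK) -twactM ?TKWK //.
by rewrite (Tss HC (TKT KS rK)) twact1.
Qed.

Lemma cnj_psi r z : (cnj r z).1 = r * psi z r * z.1.
Proof. by rewrite cnjE /= /psi !mulgA mulgKV. Qed.

Lemma cnj_loop r z : tinv z -> r \in TK -> (cnj r z == z) = (psi z r == r).
Proof.
move=> zt rK; have rr := Tss HC (TKT KS rK).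
have -> : (cnj r z == z) = ((cnj r z).1 == z.1).
  by rewrite cnjE; case: (z) => a b; rewrite xpair_eqE eqxx andbT.
rewrite cnj_psi -{2}(mul1g z.1) (inj_eq (mulIg _)) -rr (inj_eq (mulgI _)).
by [].
Qed.

Definition comm2 z := forall r, r \in TK -> psi z r * r = r * psi z r.

Lemma perfectP z : perfect K z <-> tinv z /\ comm2 z.
Proof.
have aux t : z.1 \in WK -> z.2 \in autKK K -> z.1 * z.2 z.1 = 1 ->
  (forall a, z.2 (z.2 a) = a) -> t \in TK ->
  (let u := sdmul z (emb t) in sdmul (sdmul u u) (sdmul u u) == sdone gT) =
  (psi z t * t == t * psi z t).
  move=> h1 h2 h3 h4 tK; have zt : tinv z by split.
  have tW := TKWK tK; have tt := Tss HC (TKT KS tK).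
  have e : sdmul (sdmul z (emb t)) (sdmul z (emb t)) = (psi z t * t, 1).
    rewrite /sdmul /emb /= mul1g; congr (_, _); last by apply/permP => a; rewrite permM perm1 h4.
    by rewrite (thM h2) ?(thW h2) // (thth zt) (thy zt) mulgA.
  rewrite /= e /sdmul /sdone xpair_eqE /= mulg1 eqxx andbT perm1.
  have pT := psiT zt tK; have pp := Tss HC (TKT KS pT).
  by rewrite -[RHS](inj_eq (mulIg (psi z t * t))) -(mulgA t) (mulgA (psi z t) _ t) pp mul1g tt.
split.
  case/and4P=> h1 h2 /eqP [h3 h4] /forall_inP h5.
  have h4' a : z.2 (z.2 a) = a by rewrite -permM h4 perm1.
  split; first by split.
  by move=> r rK; apply/eqP; rewrite -aux // h5.
case=> [[h1 h2 h3 h4] h5]; apply/and4P; split=> //.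
  by rewrite /sdmul h3; apply/eqP; congr (_, _); apply/permP => a; rewrite permM perm1 h4.
by apply/forall_inP => t tK; rewrite aux //; apply/eqP/h5.
Qed.

Lemma perfect_tinv z : perfect K z -> tinv z. Proof. by case/perfectP. Qed.

Lemma perfect_tw u z : u \in WK -> perfect K z -> perfect K (twact u z).
Proof.
move=> uK /perfectP [zt zc]; apply/perfectP; split; first exact: tinv_tw.
move=> r rK; have rW := TKWK rK; rewrite psi_tw //.
set q := u^-1 * r * u; have qK : q \in TK by rewrite /q -{2}(invgK u) TKJ ?groupV.
have e : r = u * q * u^-1 by rewrite /q !mulgA mulgV mul1g mulgK.
have E := zc q qK; move: e qK E; move: (q) => p; move: (psi z p) => x e _ E.
by rewrite e !mulgA !mulgKV -(mulgA u x) E mulgA.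
Qed.

Lemma perfect_cnj r z : r \in TK -> perfect K z -> perfect K (cnj r z).
Proof.
by move=> rK pz; rewrite (cnj_tw (perfect_tinv pz)) //; apply: perfect_tw; rewrite ?TKWK.
Qed.

Section Len.
Variable z : gT * {perm gT}.
Hypothesis pz : perfect K z.
Let zt := perfect_tinv pz.

(** By perfectness [psi z r] commutes with [r]: it neither has [r] as an inversion nor moves [r]
    under conjugation. Thus the two multiplications in [r psi(r) y] go in the same direction. *)
Lemma F_cnj r : r \in TK -> psi z r != r -> F r (psi z r * z.1) = F r z.1.
Proof.
move=> rK ne; have rT := TKT KS rK; have pK := psiT zt rK; have pT := TKT KS pK.
have c := (perfectP z).1 pz; have {}c := c.2 _ rK.
rewrite (F_coc HC) ?(TW pT) ?(yW zt) // (F_comm HC) // 1?eq_sym //=.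
by rewrite (Tinv HC pT) c -mulgA (Tss HC pT) mulg1.
Qed.

Lemma cnj_up r : r \in TK -> psi z r != r -> ~~ F r z.1 -> l z.1 < l (cnj r z).1.
Proof.
move=> rK ne f; have rT := TKT KS rK; have pK := psiT zt rK; have pT := TKT KS pK.
have yW := yW zt; rewrite cnj_psi -mulgA.
have h1 : l z.1 < l (psi z r * z.1) by rewrite (lenT HC) // (F_psi zt).
have pyW := groupM (TW pT) yW.
by apply: ltn_trans h1 _; rewrite (lenT HC) // F_cnj.
Qed.

Lemma cnj_dn r : r \in TK -> psi z r != r -> F r z.1 -> l (cnj r z).1 < l z.1.
Proof.
move=> rK ne f; have rT := TKT KS rK; have pK := psiT zt rK; have pT := TKT KS pK.
have yW := yW zt; rewrite cnj_psi -mulgA.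
have h1 : l (psi z r * z.1) < l z.1 by have := F_psi zt rK; rewrite f.
apply: ltn_trans h1; have := F_cnj rK ne; by rewrite f.
Qed.

Lemma cnj_ltE r : r \in TK -> (l z.1 < l (cnj r z).1) = (psi z r != r) && ~~ F r z.1.
Proof.
move=> rK; case: eqVneq => [e|ne] /=.
  by move/eqP: e; rewrite -cnj_loop // => /eqP ->; rewrite ltnn.
case f: (F r z.1); last by rewrite cnj_up ?f.
by have := cnj_dn rK ne f; apply: contraTF; rewrite -leqNgt; exact: ltnW.
Qed.

Lemma cnj_gtE r : r \in TK -> (l (cnj r z).1 < l z.1) = (psi z r != r) && F r z.1.
Proof.
move=> rK; case: eqVneq => [e|ne] /=.
  by move/eqP: e; rewrite -cnj_loop // => /eqP ->; rewrite ltnn.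
case f: (F r z.1); first by rewrite cnj_dn ?f.
have := cnj_up rK ne (negbT f); apply: contraTF; rewrite -leqNgt; exact: ltnW.
Qed.

(** [psi z s] is a reflection that may not be simple, but [len_psi] gives [psi z s * y] the length
    of [s * y]; so each of the two multiplications counts for exactly one. *)
Lemma len_cnj s : s \in K -> psi z s != s ->
  if F s z.1 then l z.1 = (l (cnj s z).1).+2 else l (cnj s z).1 = (l z.1).+2.
Proof.
move=> sK ne; have sS := KSe KS sK; have rK := KTK sK; have pK := psiT zt rK.
have pT := TKT KS pK; have yW := yW zt.
have pyW := groupM (TW pT) yW.
have e1 := len_psi zt rK; rewrite cnj_psi -mulgA.
case: ifP => f.
  have f2 := F_cnj rK ne; rewrite f in f2.
  by rewrite (len_sT HC sS yW f) -e1 (len_sT HC sS pyW f2).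
by rewrite (len_sF HC sS pyW) ?(F_cnj rK ne) ?f // e1 (len_sF HC sS yW) ?f.
Qed.

End Len.

(* The strong exchange condition forces [r = s] or [psi z r = s], and [s] commutes with [psi z s]. *)
Lemma qp_exchange z r s : perfect K z -> r \in TK -> s \in K -> l z.1 < l (cnj r z).1 ->
  qp_step S K (cnj s z) (cnj s (cnj r z)) || (cnj s z == cnj r z).
Proof.
move=> pz rK sK; rewrite cnj_ltE // => /andP [ne f]; have zt := perfect_tinv pz.
have sS := KSe KS sK; have sT := KTK sK; have sW := KWK sK.
have rT := TKT KS rK; have rW := TKWK rK; have yW := yW zt.
case: (eqVneq r s) => [->|nrs]; first by rewrite eqxx orbT.
case: (eqVneq r (psi z s)) => [rs|nrps].
  apply/orP; right; rewrite [cnj s z]cnjE [cnj r z]cnjE xpair_eqE eqxx andbT.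
  have := cnj_psi s z; have := cnj_psi r z; rewrite !cnjE /= => -> ->.
  by rewrite {2}rs psiK // rs ((perfectP z).1 pz).2.
apply/orP; left; apply/exists_inP; exists (s * r * s^-1); first exact: TKJ.
have srsK : s * r * s^-1 \in TK by rewrite TKJ.
have pz' := perfect_cnj sT pz; have zt' := perfect_tinv pz'.
have e : cnj s (cnj r z) = cnj (s * r * s^-1) (cnj s z).
  rewrite (cnj_tw zt' srsK) (cnj_tw (tinv_cnj zt rK) sT) !(cnj_tw zt) //.
  by rewrite -!twactM ?groupM ?groupV // mulgKV.
rewrite {1}e eqxx e /=.
have sWS := SW sS; have tsK := thK (thA zt) sK; have tsS := KSe KS tsK; have tsW := SW tsS.
have srsT := TKT KS srsK.
have h1 : (s * r * s^-1 == s) = false.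
  apply/negbTE; apply: contra nrs => /eqP h; apply/eqP.
  by apply: (mulgI s); apply: (mulIg s^-1); rewrite h mulgK.
have h2 : (z.1^-1 * r * z.1 == z.2 s) = false.
  apply/negbTE; apply: contra nrps => /eqP h; apply/eqP.
  by rewrite /psi -h !mulgA mulgV mul1g mulgK.
have f2 : ~~ F (s * r * s^-1) (cnj s z).1.
  rewrite cnjE /= -(mulgA s z.1) (F_coc HC srsT sWS) ?groupM // (F_s HC srsT sS) h1.
  have -> : s^-1 * (s * r * s^-1) * s = r by rewrite !mulgA mulVg mul1g mulgKV.
  by rewrite (F_coc HC) // (negbTE f) addFb (F_s HC) ?TJ // h2.
rewrite (cnj_ltE pz' srsK) f2 andbT (cnj_tw zt sT) psi_tw // ?TKWK //.
have -> : s^-1 * (s * r * s^-1) * s = r by rewrite !mulgA mulVg mul1g mulgKV.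
by rewrite (inj_eq (mulIg _)) (inj_eq (mulgI _)).
Qed.

Lemma qp_step_exchange s z z' : perfect K z -> s \in K -> qp_step S K z z' ->
  qp_step S K (cnj s z) (cnj s z') || (cnj s z == z').
Proof.
by move=> pz sK /exists_inP [r rK /andP [/eqP -> h]]; exact: qp_exchange.
Qed.

Lemma qp_step_perfect z z' : perfect K z -> qp_step S K z z' -> perfect K z'.
Proof. by move=> pz /exists_inP [r rK /andP [/eqP -> h]]; exact: perfect_cnj. Qed.

Lemma qp_up s z : perfect K z -> s \in K -> l z.1 <= l (cnj s z).1 ->
  connect (qp_step S K) z (cnj s z).
Proof.
move=> pz sK; rewrite leq_eqVlt => /orP [/eqP e|h]; last first.
  by apply: connect1; apply/exists_inP; exists s; rewrite ?KTK // eqxx.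
suff -> : cnj s z = z by [].
have sT := KTK sK; apply/eqP; rewrite (cnj_loop (perfect_tinv pz)) //.
apply: contraT => ne; have := cnj_ltE pz sT; have := cnj_gtE pz sT.
by rewrite e ltnn ne /= => <-.
Qed.

Lemma qp_lift s z z' : perfect K z -> s \in K -> connect (qp_step S K) z z' ->
  l z'.1 <= l (cnj s z').1 -> connect (qp_step S K) (cnj s z) (cnj s z').
Proof.
move=> pz sK c h.
apply: (chain_up (P := perfect K) (e := qp_step S K) (f := cnj s)) => //.
- by move=> a b; exact: qp_step_perfect.
- by move=> a b pa; exact: qp_step_exchange.
apply: qp_up => //; apply: (chain_closed (P := perfect K)) c => // a b.
exact: qp_step_perfect.
Qed.

(** Minimality puts [z] below each [cnj s z], and then [chain_dn] carries the bound across one more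
    letter of [u]. *)
Lemma qp_min_le z u : perfect K z -> Kminimal S K z -> u \in WK ->
  connect (qp_step S K) z (twact u z).
Proof.
move=> pz /forall_inP zm /gen_word [ws h <-]; have zt := perfect_tinv pz.
elim: ws h => [|s ws IH] /=; first by rewrite twact1.
case/andP=> sK h; have uK := wprod_gen h.
rewrite (twactM zt (KWK sK) uK) -(cnj_tw (tinv_tw zt uK) (KTK sK)).
apply: (chain_dn (P := perfect K) (e := qp_step S K) (f := cnj s)) => //.
- by move=> a b; exact: qp_step_perfect.
- by move=> a b pa; exact: qp_step_exchange.
- by move=> a pa; rewrite cnj_inv ?KTK //; exact: perfect_tinv pa.
- exact: IH.
by apply: qp_up => //; exact: zm.
Qed.

Lemma qp_len z z' : connect (qp_step S K) z z' -> z = z' \/ l z.1 < l z'.1.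
Proof.
move=> /connectP [p]; elim: p z => [|a p IH] z /=; first by move=> _ ->; left.
case/andP=> st h e; right.
have : l z.1 < l a.1 by case/exists_inP: st => t tT /andP [].
by case: (IH a h e) => [<-|h2 h3] //; apply: ltn_trans h2.
Qed.

(** Two minimal elements of a class lie below each other, while every step of the order raises the
    length. *)
Lemma Kmin_uniq z u : perfect K z -> u \in WK -> Kminimal S K z ->
  Kminimal S K (twact u z) -> twact u z = z.
Proof.
move=> pz uK m1 m2; have zt := perfect_tinv pz.
have pz2 := perfect_tw uK pz.
have c1 := qp_len (qp_min_le pz m1 uK).
have := qp_len (qp_min_le pz2 m2 (groupVr uK)); rewrite -twactM ?groupV // mulVg twact1 //.
case: c1 => [<- //|h1]; case=> [//|h2]; by have := ltn_trans h1 h2; rewrite ltnn.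
Qed.

(* A class-minimal element is [(w_D, th)] with [D] its descent set, and it is fixed by [D]. *)
Lemma Kmin_struct z : perfect K z -> Kminimal S K z ->
  exists D : {set gT}, [/\ D \subset K, z.1 = longest S D & forall s, s \in D -> psi z s = s].
Proof.
move=> pz /forall_inP zm; have zt := perfect_tinv pz.
pose D := [set s in K | F s z.1]; have DK : D \subset K by apply/subsetP=> s; rewrite inE => /andP [].
have DS := subset_trans DK KS; have yW := yW zt; have yK := yK zt.
have Dfix s : s \in D -> psi z s = s.
  rewrite inE => /andP [sK f]; apply/eqP; apply: contraT => ne.
  have := zm s sK; rewrite leqNgt (cnj_gtE pz) ?KTK // ne f.
  by [].
exists D; split=> //.
have [u [x [uD xW xm e]]] := lmin_dec DS yW.
have Du s : s \in D -> F s u.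
  move=> sD; have : F s z.1 by move: sD; rewrite inE => /andP [].
  by rewrite e (F_lmin HC DS) // KTK.
have uL := longest_uniq HC DS uD Du.
(* Let [x] have a right descent [s]. Then [s] is a right descent of [y], so [th s] is a left one and
   lies in [D]; fixed by [psi z], it satisfies [th(s) y = y s]. Conjugating by [u = w_D] puts
   [x s x^-1], an inversion of [x], into [D], against the minimality of [x]. *)
case: (eqVneq x 1) => [x1|xn]; first by rewrite e x1 mulg1.
have xK : x \in WK.
  have -> : x = u^-1 * z.1 by rewrite e mulKg.
  by rewrite groupM // groupV; exact: (subsetP (genS DK)).
have xiK := groupVr xK; have uW := WKW DS uD.
have xin : x^-1 != 1 by rewrite -invg1 (inj_eq invg_inj).
have [s sK fs] := ldescK HC KS xiK xin.
have sS := KSe KS sK; have sT := KTK sK.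
have xs : F (x * s * x^-1) x.
  by rewrite /Coxeter.F mulgKV lenTr ?ST // -(lenV HC xW).
have xsT : x * s * x^-1 \in T by rewrite TJV ?ST.
have fy : F s z.1^-1.
  rewrite e invMg (F_coc HC) ?groupV ?ST // fs invgK.
  case f: (F _ u^-1) => //; have := xm _ (F_TK HC DS xsT (groupVr uD) f).
  by rewrite xs.
have fty : F (z.2 s) z.1.
  have := F_th zt (KWK sK) (groupVr yK); by rewrite fy (thV (thA zt)) // (thy zt) invgK.
have dD : z.2 s \in D by rewrite inE fty (thK (thA zt)).
have pd := Dfix _ dD; have := psi_y z (z.2 s); rewrite pd (thth zt) e => h.
have d'D : u^-1 * z.2 s * u \in D.
  by rewrite uL (longestV HC DS) (longestJ HC DS).
have := xm _ (KTK d'D).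
have -> : u^-1 * z.2 s * u = x * s * x^-1.
  have h' : z.2 s * u = u * x * s * x^-1 by apply: (mulIg x); rewrite mulgKV -h mulgA.
  by rewrite -mulgA h' !mulgA mulVg mul1g.
by rewrite xs.
Qed.

End Perfect.

End PerfectInvolutions.
Import PerfectInvolutions.

(** * The action on the model set, heights and the order [prec] *)

Module ModelSet.

Section KK.
Variables (gT : finGroupType) (S : {set gT}).
Hypothesis HC : coxeter_system S.
Variable K : {set gT}.
Hypothesis KS : K \subset S.
Implicit Types (w u v s r t a b : gT) (z : gT * {perm gT}) (tau ups : elt gT).

Notation l := (len S).
Notation W := (<<S>>).
Notation T := (refls S).
Notation WK := (<<K>>).
Notation TK := (refls K).
Notation F := (F S).
Notation inKK := (inKK S K).
Notation sact := (sact S K).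

(** Twice the height without the orbit constant [l(z_min)], which keeps heights in [nat]. An action
    step changes it by two or fixes [tau], so equal height means a fixed point. *)
Definition hn tau := 2 * l tau.1 + l tau.2.1.

Variant sact_spec s tau : elt gT -> Type :=
| SactMove : minrep S K (s * tau.1) -> sact_spec s tau (s * tau.1, tau.2)
| SactCnj t : t = tau.1^-1 * s * tau.1 -> t \in K -> ~~ minrep S K (s * tau.1) ->
    ~~ F s tau.1 -> sact_spec s tau (tau.1, cnj t tau.2).

Lemma sactP s tau : s \in S -> inKK tau -> sact_spec s tau (sact s tau).
Proof.
move=> sS /andP [wm pz]; rewrite /Defs.sact; case: ifP => h; first by constructor.
by have /andP [h1 h2] := minrep_act HC KS sS wm (negbT h); apply: SactCnj => //; rewrite h.
Qed.

Lemma inKK_W tau : inKK tau -> tau.1 \in W. Proof. by case/andP => /minrepW. Qed.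
Lemma inKK_perfect tau : inKK tau -> perfect K tau.2. Proof. by case/andP. Qed.
Lemma inKK_tinv tau : inKK tau -> tinv K tau.2.
Proof. by case/andP => _ /(perfect_tinv HC KS). Qed.

Lemma inKK_sact s tau : s \in S -> inKK tau -> inKK (sact s tau).
Proof.
move=> sS tK; have [wm pz] := andP tK; case: (sactP sS tK) => [h|t e tK' h1 h2].
  by apply/andP.
by apply/andP; split=> //=; exact (perfect_cnj HC KS (KTK tK') pz).
Qed.

Lemma sactK s tau : s \in S -> inKK tau -> sact s (sact s tau) = tau.
Proof.
move=> sS tK; have [wm pz] := andP tK; case: (sactP sS tK) => [h|t e tK' h1 h2].
  by rewrite /Defs.sact /= (SK HC _ sS) wm; case: (tau).
rewrite /Defs.sact /= (negbTE h1) -e (cnj_inv HC KS (perfect_tinv HC KS pz) (KTK tK')).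
by case: (tau).
Qed.

Lemma hn_up_move s w z : s \in S -> w \in W -> hn (w, z) < hn (s * w, z) -> ~~ F s w.
Proof.
move=> sS wW h; apply/negP => f; have := len_sT HC sS wW f; move: h; rewrite /hn /=; llia.
Qed.

Lemma hn_up_cnj w z z' : hn (w, z) < hn (w, z') -> l z.1 <= l z'.1.
Proof. by rewrite /hn /= ltn_add2l => /ltnW. Qed.

Lemma hn_sact s tau : s \in S -> inKK tau ->
  [\/ sact s tau = tau, hn (sact s tau) = (hn tau).+2 | hn tau = (hn (sact s tau)).+2].
Proof.
move=> sS tK; have [wm pz] := andP tK; case: (sactP sS tK) => [h|t e tK' h1 h2].
  have wW := minrepW wm; have := len_s HC sS wW; rewrite /hn /=.
  case: ifP => f; last by move=> e; apply: Or32; rewrite e; llia.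
  by move=> e; apply: Or33; have := len_sT HC sS wW f; llia.
have zt := perfect_tinv HC KS pz.
case: (eqVneq (psi tau.2 t) t) => [pt|ne].
  apply: Or31; move/eqP: pt; rewrite -(cnj_loop HC KS zt) ?KTK // => /eqP ->.
  by case: (tau).
have := len_cnj HC KS pz tK' ne; rewrite /hn /=; case: ifP => f e2.
  by apply: Or33; llia.
by apply: Or32; llia.
Qed.

Lemma sact_loopP s tau : s \in S -> inKK tau -> sact s tau = tau ->
  [/\ tau.1^-1 * s * tau.1 \in K, ~~ F s tau.1 &
      psi tau.2 (tau.1^-1 * s * tau.1) = tau.1^-1 * s * tau.1].
Proof.
move=> sS tK; have [wm pz] := andP tK; case: (sactP sS tK) => [h|t e tK' h1 h2].
  move/(congr1 fst) => /= /eqP; rewrite -{2}(mul1g tau.1) (inj_eq (mulIg _)).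
  by rewrite (negbTE (S_neq1 HC sS)).
move/(congr1 snd) => /= /eqP; rewrite -e; rewrite (cnj_loop HC KS (perfect_tinv HC KS pz)) ?KTK //.
by move/eqP.
Qed.

Lemma Korbit_cnj t z : t \in K -> tinv K z -> Korbit K (cnj t z) = Korbit K z.
Proof.
move=> tK zt; have tW := KWK tK; rewrite (cnj_tw HC KS zt (KTK tK)).
apply/setP=> z'; apply/imsetP/imsetP => [[v vK ->]|[v vK ->]].
  by exists (v * t); rewrite ?groupM // (twactM zt).
exists (v * t^-1); first by rewrite groupM ?groupV.
by rewrite -(twactM zt) ?groupM ?groupV // mulgKV.
Qed.

Lemma lenzmin_sact s tau : s \in S -> inKK tau ->
  lenzmin S K (sact s tau).2 = lenzmin S K tau.2.
Proof.
move=> sS tK; have [wm pz] := andP tK; case: (sactP sS tK) => [h|t e tK' h1 h2] //=.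
by rewrite /lenzmin (Korbit_cnj tK' (perfect_tinv HC KS pz)).
Qed.

Lemma ht2_hn tau : ht2 S K tau = ((hn tau)%:Z - (lenzmin S K tau.2)%:Z)%R.
Proof. by []. Qed.

Lemma ascLE s tau : s \in S -> inKK tau -> (s \in ascL S K tau) = (hn tau < hn (sact s tau)).
Proof. by move=> sS tK; rewrite inE sS !ht2_hn lenzmin_sact //=; lia. Qed.
Lemma desLE s tau : s \in S -> inKK tau -> (s \in desL S K tau) = (hn (sact s tau) < hn tau).
Proof. by move=> sS tK; rewrite inE sS !ht2_hn lenzmin_sact //=; lia. Qed.
Lemma eqLE s tau : s \in S -> inKK tau ->
  (ht2 S K (sact s tau) == ht2 S K tau) = (sact s tau == tau).
Proof.
move=> sS tK; apply/eqP/eqP => [|-> //]; rewrite !ht2_hn lenzmin_sact // => e.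
by case: (hn_sact sS tK) => // h; lia.
Qed.

Notation orb := (fun x y => [exists s in S, y == sact s x]).

Lemma orb_closed tau ups : inKK tau -> sameorbit S K tau ups -> inKK ups.
Proof.
apply: chain_closed => a b aK /exists_inP [s sS /eqP ->]; exact: inKK_sact.
Qed.

Lemma orb1 s tau : s \in S -> sameorbit S K tau (sact s tau).
Proof. by move=> sS; apply: connect1; apply/exists_inP; exists s. Qed.

Lemma orb_sact s tau : s \in S -> inKK tau -> sameorbit S K (sact s tau) tau.
Proof.
by move=> sS tK; apply: connect1; apply/exists_inP; exists s => //; rewrite sactK.
Qed.

Lemma orb_trans (a b c : elt gT) : sameorbit S K a b -> sameorbit S K b c -> sameorbit S K a c.
Proof. exact: connect_trans. Qed.

Lemma orb_sym tau ups : inKK tau -> sameorbit S K tau ups -> sameorbit S K ups tau.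
Proof.
move=> tK /connectP [p hp ->]; elim: p tau tK hp => [|b p IH] tau tK /=.
  by move=> _; exact: connect0.
case/andP=> /exists_inP [s sS /eqP ->] hp.
by apply: orb_trans (orb_sact sS tK); apply: IH => //; exact: inKK_sact.
Qed.

Lemma orb_lenzmin tau ups : inKK tau -> sameorbit S K tau ups ->
  lenzmin S K ups.2 = lenzmin S K tau.2.
Proof.
move=> tK /connectP [p hp ->]; elim: p tau tK hp => [|b p IH] tau tK //=.
case/andP=> /exists_inP [s sS /eqP ->] hp; rewrite IH ?inKK_sact //.
exact: lenzmin_sact.
Qed.

Lemma orb_tw tau ups : inKK tau -> sameorbit S K tau ups ->
  exists2 u, u \in WK & ups.2 = twact u tau.2.
Proof.
move=> tK /connectP [p hp ->]; elim: p tau tK hp => [|b p IH] tau tK /=.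
  by move=> _; exists 1; rewrite ?group1 // (twact1 (inKK_tinv tK)).
case/andP=> /exists_inP [s sS /eqP ->] hp; have zt := inKK_tinv tK.
have [u uK ->] := IH _ (inKK_sact sS tK) hp.
case: (sactP sS tK) => [_|t _ tK' _ _] /=; first by exists u.
exists (u * t); first by rewrite groupM // KWK.
by rewrite (twactM zt uK (KWK tK')) (cnj_tw HC KS zt (KTK tK')).
Qed.

Lemma desL0P tau : inKK tau -> desL S K tau == set0 -> tau.1 = 1 /\ Kminimal S K tau.2.
Proof.
move=> tK /eqP d0; have [wm pz] := andP tK; have wW := minrepW wm.
have nd s : s \in S -> hn tau <= hn (sact s tau).
  by move=> sS; rewrite leqNgt -desLE // d0 inE.
have w1 : tau.1 = 1.
  apply/eqP; apply: contraT => wn; have [s sS f] := ldescK HC (subxx S) wW wn.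
  have := nd s sS; rewrite /Defs.sact (minrep_desc HC KS sS wm f) /hn /=.
  by have := len_sT HC sS wW f; llia.
split=> //; apply/forall_inP=> s sK; have sS := KSe KS sK; have := nd s sS.
case: (sactP sS tK) => [h|t e tK' h1 h2].
  have : minrep S K (s * tau.1) by []; rewrite w1 mulg1 => h3.
  by have := minrep_eq1 HC KS h3 (KWK sK) => s1; have := S_neq1 HC sS; rewrite s1 eqxx.
have -> : t = s by rewrite e w1 invg1 mul1g mulg1.
by rewrite /hn /= leq_add2l.
Qed.

(** Elements without strict descents sit over [w = 1] with a class-minimal second component, and a
    class has only one of these. They are the base points from which bar operators are
    determined. *)
Lemma desL0_uniq tau ups : inKK tau -> sameorbit S K tau ups ->
  desL S K tau == set0 -> desL S K ups == set0 -> ups = tau.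
Proof.
move=> tK o d1 d2; have uK := orb_closed tK o.
have [e1 m1] := desL0P tK d1; have [e2 m2] := desL0P uK d2.
have [u uW e] := orb_tw tK o; rewrite e in m2.
have := Kmin_uniq HC KS (inKK_perfect tK) uW m1 m2; rewrite -e.
by case: (tau) (ups) e1 e2 => [a b] [c d] /= -> -> ->.
Qed.

Lemma desLn0 tau : inKK tau -> desL S K tau != set0 -> exists2 s, s \in S & hn (sact s tau) < hn tau.
Proof.
move=> tK /set0Pn [s sd]; have sS : s \in S by move: sd; rewrite inE => /andP [].
by exists s; rewrite -?desLE.
Qed.

Lemma desc_to_min tau : inKK tau -> exists ups, [/\ sameorbit S K tau ups, inKK ups,
  desL S K ups == set0 & hn ups <= hn tau].
Proof.
have [n] := ubnP (hn tau); elim: n tau => // n IH tau lt tK.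
case: (boolP (desL S K tau == set0)) => [d|/(desLn0 tK) [s sS h]].
  by exists tau; split=> //; exact: connect0.
have [|ups [o uK d h2]] := IH (sact s tau) _ (inKK_sact sS tK); first by lia.
exists ups; split=> //; first exact: orb_trans (orb1 tau sS) o.
by lia.
Qed.

(** The lexicographic order behind [prec], made reflexive in the fibre; strictness is left to [hn],
    which simplifies transitivity and lifting. *)
Definition ordle (a b : elt gT) :=
  bruhat_lt S a.1 b.1 || (a.1 == b.1) && connect (qp_step S K) a.2 b.2.

Lemma precE (a b : elt gT) : inKK a -> prec S K a b = [&& sameorbit S K a b, hn a < hn b & ordle a b].
Proof.
move=> aK; rewrite /prec; case o: (sameorbit S K a b) => //=.
rewrite !ht2_hn (orb_lenzmin aK o).
have -> : ((hn a)%:Z - (lenzmin S K a.2)%:Z < (hn b)%:Z - (lenzmin S K a.2)%:Z)%R = (hn a < hn b).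
  lia.
case h: (hn a < hn b) => //=; rewrite /ordle /qp_lt.
case: (bruhat_lt S a.1 b.1) => //=; case e: (a.1 == b.1) => //=.
case: eqVneq => // e2; move: h; rewrite /hn e2 (eqP e) ltnn. by [].
Qed.

Lemma bruhat_lt_trans a b c : a \in W -> connect (bruhat_step S) a b -> bruhat_lt S b c ->
  bruhat_lt S a c.
Proof.
move=> aW h /andP [n h2]; rewrite /bruhat_lt (connect_trans h h2) andbT.
have bW : b \in W by apply: (chain_closed (P := [in W])) h => // x y; exact: bruhat_step_W.
apply/eqP => e; rewrite -e in h2 n; case: (bruhat_len HC bW h2) => [e2|l2].
  by rewrite e2 eqxx in n.
case: (bruhat_len HC aW h) => [e2|l1]; first by rewrite e2 eqxx in n.
by have := ltn_trans l1 l2; rewrite ltnn.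
Qed.

Lemma ordle_trans (a b c : elt gT) : a.1 \in W -> ordle a b -> ordle b c -> ordle a c.
Proof.
move=> aW /orP [h1|/andP [/eqP e1 h1]] /orP [h2|/andP [/eqP e2 h2]]; apply/orP.
- by left; apply: bruhat_lt_trans h2 => //; case/andP: h1.
- by left; rewrite -e2.
- by left; rewrite e1.
by right; rewrite e1 e2 eqxx /=; exact: connect_trans h1 h2.
Qed.

Lemma prec_trans (a b c : elt gT) : inKK a -> prec S K a b -> prec S K b c -> prec S K a c.
Proof.
move=> aK; rewrite precE // => /and3P [o1 h1 r1].
rewrite precE ?(orb_closed aK o1) // => /and3P [o2 h2 r2].
rewrite precE // (orb_trans o1 o2) (ltn_trans h1 h2) /=.
by apply: ordle_trans r1 r2; exact: inKK_W.
Qed.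

Lemma prec_up s tau : s \in S -> inKK tau -> hn tau < hn (sact s tau) ->
  prec S K tau (sact s tau).
Proof.
move=> sS tK h; rewrite precE // orb1 // h /=; move: h.
have [wm pz] := andP tK; have wW := minrepW wm.
case: (sactP sS tK) => [h|t e tK' h1 h2] hh; rewrite /ordle /=.
  have f : ~~ F s tau.1 by apply: (@hn_up_move s tau.1 tau.2) => //; case: (tau) hh.
  rewrite /bruhat_lt bruhat_up // andbT -{1}(mul1g tau.1) (inj_eq (mulIg _)) eq_sym.
  by rewrite (S_neq1 HC sS).
by rewrite eqxx qp_up ?orbT //; apply: (@hn_up_cnj tau.1); case: (tau) hh.
Qed.

(** At each of [ups] and [tau] the letter may move the coset or act in the fibre, which gives four
    cases. This property is what makes the bar operator triangular. *)
Lemma prec_lift s ups tau : s \in S -> inKK ups -> inKK tau -> prec S K ups tau ->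
  hn tau < hn (sact s tau) -> prec S K (sact s ups) (sact s tau).
Proof.
move=> sS uK tK; rewrite precE // => /and3P [o h r] hs.
rewrite precE ?inKK_sact //; apply/and3P; split.
- exact: orb_trans (orb_sact sS uK) (orb_trans o (orb1 tau sS)).
- by case: (hn_sact sS uK) (hn_sact sS tK) hs => [->|->|h2] [->|->|->]; rewrite ?ltnn; lia.
move: hs r; have [wm pz] := andP tK; have wW := minrepW wm.
have [wm' pz'] := andP uK; have wW' := minrepW wm'.
case: (sactP sS tK) => [h0|t e tK' h1 h2] hh.
  have f : ~~ F s tau.1 by apply: (@hn_up_move s tau.1 tau.2) => //; case: (tau) hh.
  have up : bruhat_lt S tau.1 (s * tau.1).
    rewrite /bruhat_lt bruhat_up // andbT -{1}(mul1g tau.1) (inj_eq (mulIg _)) eq_sym.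
    by rewrite (S_neq1 HC sS).
  case: (sactP sS uK) => [g0|t' e' tK2 g1 g2] /orP [r|/andP [/eqP er r]]; apply/orP.
  - left => /=; case/andP: r => r1 r2; rewrite /bruhat_lt (inj_eq (mulgI s)) r1 /=.
    exact: bruhat_lift_left.
  - by right; rewrite /= er eqxx.
  - by left=> /=; apply: bruhat_lt_trans up => //; case/andP: r.
  by left; rewrite /= er.
have wt : s * tau.1 = tau.1 * t by rewrite e !mulgA mulgV mul1g.
case/orP=> [r|/andP [/eqP er r]].
  apply/orP; left; case: (sactP sS uK) => [g0|t' e' tK2 g1 g2] //=.
  case/andP: r => r1 r2; apply/andP; split.
    apply/eqP => e2; move: h1; rewrite -e2 (SK HC _ sS) wm'. by [].
  have tS := KSe KS tK'.
  (* Here [s] acts in the fibre over [tau.1] and moves [ups.1]. Lifting on the left gives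
     [s ups.1 <= s tau.1 = tau.1 t]; as [t] is not a right descent of [s ups.1], lifting on the
     right removes the [t] again. *)
  have -> : tau.1 = s * tau.1 * t by rewrite wt (SKr HC _ tS).
  apply: bruhat_lift_right => //; first by rewrite groupM // SW.
    exact: bruhat_lift_left.
  by case/andP: g0 => _ /forall_inP; exact.
apply/orP; right; rewrite /Defs.sact er (negbTE h1) /= -e eqxx /=.
by apply: qp_lift => //; apply: (@hn_up_cnj tau.1); case: (tau) hh.
Qed.

End KK.

End ModelSet.
Import ModelSet.

Import GRing.Theory Num.Theory.

(** * Alternating words and the operators of the generators *)

Module HeckeOperators.

Section AlternatingWords.
Variable gT : finGroupType.
Implicit Types c d : gT.

(** Grown at the front, so that the last letter is always [c] and the next operator to apply on the
    left depends on the parity of [n]. *)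
Fixpoint awl c d n : seq gT := if n is k.+1 then (if odd k then d else c) :: awl c d k else [::].

Lemma awl_rcons c d n : awl c d n.+1 = rcons (awl d c n) c.
Proof.
elim: n => [|n IH] //; rewrite [LHS]/= -/(awl c d n.+1) IH /=.
by case: (odd n).
Qed.

Lemma awl_all (I : {set gT}) c d n : c \in I -> d \in I -> all (mem I) (awl c d n).
Proof. by move=> cI dI; elim: n => //= n ->; case: ifP => _; rewrite /= ?cI ?dI. Qed.

Lemma mul_expg_swap c d n : c * (d * c) ^+ n = (c * d) ^+ n * c.
Proof. by elim: n => [|n IH]; rewrite ?expg0 ?mulg1 ?mul1g // !expgS -!mulgA IH !mulgA. Qed.

Lemma awl_quot c d n : c * c = 1 -> d * d = 1 ->
  (wprod (awl c d n))^-1 * wprod (awl d c n) = (c * d) ^+ n.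
Proof.
move=> cc dd.
have ci : c^-1 = c by rewrite -[LHS]mulg1 -cc mulKg.
have di : d^-1 = d by rewrite -[LHS]mulg1 -dd mulKg.
elim: n => [|n IH]; first by rewrite /= mulg1 invg1.
rewrite !awl_rcons !wprod_rcons invMg mulgA -(mulgA c^-1) ci.
have -> : (wprod (awl d c n))^-1 * wprod (awl c d n) = ((c * d) ^+ n)^-1.
  by rewrite -IH invMg invgK.
by rewrite -expgVn invMg ci di mul_expg_swap -mulgA expgSr.
Qed.

Lemma awl_eq c d n : c * c = 1 -> d * d = 1 ->
  (wprod (awl c d n) = wprod (awl d c n)) <-> (c * d) ^+ n = 1.
Proof.
move=> cc dd; rewrite -(awl_quot n cc dd); split=> [->|e]; first by rewrite mulVg.
by rewrite -[LHS]mulg1 -e mulKVg.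
Qed.

Lemma order_swap c d : c * c = 1 -> d * d = 1 -> #[d * c] = #[c * d].
Proof.
move=> cc dd; have <- : (c * d)^-1 = d * c.
  by rewrite invMg -[d^-1]mulg1 -dd mulKg -[c^-1]mulg1 -cc mulKg.
exact: orderV.
Qed.

(** The reflection at position [j] of an alternating word starting with [a] is [(a b)^j a]. If it
    were the next letter, the order of [c d] would divide [i + 1]; so alternating words up to that
    order are reduced. *)
Lemma awl_nth c d n i : c * c = 1 -> d * d = 1 -> i < n ->
  (if odd n then d else c) =
    wprod (take i (awl c d n)) * nth 1 (awl c d n) i * (wprod (take i (awl c d n)))^-1 ->
  (c * d) ^+ i.+1 = 1.
Proof.
move=> cc dd; have inv x : x * x = 1 -> x^-1 = x :> gT by move=> xx; rewrite -[LHS]mulg1 -xx mulKg.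
pose alt := fix alt (a b : gT) k := if k is k'.+1 then a :: alt b a k' else [::].
have altE k : awl c d k = if odd k then alt c d k else alt d c k.
  by elim: k => [|k IH] //=; rewrite IH; case: (odd k).
have pal a b k j : a * a = 1 -> b * b = 1 -> j < k ->
  wprod (take j (alt a b k)) * nth 1 (alt a b k) j * (wprod (take j (alt a b k)))^-1 =
  (a * b) ^+ j * a.
  elim: j a b k => [|j IH] a b [|k] // aa bb; first by rewrite /= invg1 !mulg1 mul1g.
  rewrite ltnS => /(IH b a k bb aa) /=; set P := wprod _; set x := nth _ _ _ => e.
  have -> : a * P * x * (a * P)^-1 = a * (P * x * P^-1) * a.
    by rewrite invMg (inv a aa) !mulgA.
  by rewrite e mulgA mul_expg_swap -!mulgA (mulgA a b) mulgA -expgSr.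
move=> hi; rewrite altE; case: ifP => _; rewrite pal // => e.
  by rewrite expgSr mulgA -e dd.
have : (d * c) ^+ i.+1 = 1 by rewrite expgSr mulgA -e cc.
move=> e2; apply: (mulgI d); rewrite mul_expg_swap e2 mul1g mulg1. by [].
Qed.

End AlternatingWords.

Section Dihedral.
Variables (gT : finGroupType) (S : {set gT}).
Hypothesis HC : coxeter_system S.
Variables c d : gT.
Hypotheses (cS : c \in S) (dS : d \in S) (ncd : c != d).
Notation m := #[c * d].
Notation I := [set c; d].
Notation F := (F S).

Lemma I_sub : I \subset S.
Proof. by apply/subsetP=> x; rewrite !inE => /orP [] /eqP ->. Qed.
Lemma cI : c \in I. Proof. by rewrite !inE eqxx. Qed.
Lemma dI : d \in I. Proof. by rewrite !inE eqxx orbT. Qed.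

Lemma awl_gen n : wprod (awl c d n) \in <<I>>.
Proof. by apply: wprod_gen; apply: awl_all; [exact: cI|exact: dI]. Qed.

Lemma size_awl n : size (awl c d n) = n.
Proof. by elim: n => //= n ->. Qed.

Lemma order_mul_gt1 : 1 < m.
Proof.
rewrite ltn_neqAle order_gt0 andbT eq_sym order_eq1; apply: contra ncd => /eqP e.
by apply/eqP; apply: (mulIg d); rewrite e (Sss HC dS).
Qed.

Lemma awl_red n : n < m -> ~~ F (if odd n then d else c) (wprod (awl c d n)).
Proof.
move=> lt; apply/negP => f; have cc := Sss HC cS; have dd := Sss HC dS.
have pT : (if odd n then d else c) \in refls S by case: ifP => _; exact: ST.
have [i hi e] := F_word HC pT (awl_all n cS dS) f; rewrite size_awl in hi.
have /eqP := awl_nth cc dd hi e; rewrite -order_dvdn => /dvdn_leq; lia.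
Qed.

Lemma awl_neq n : 0 < n < m -> wprod (awl c d n) <> wprod (awl d c n).
Proof.
case/andP=> n0 lt /(awl_eq n (Sss HC cS) (Sss HC dS)) /eqP.
by rewrite -order_dvdn => /dvdn_leq; lia.
Qed.

Lemma awl_top : wprod (awl c d m) = wprod (awl d c m).
Proof. by apply/(awl_eq m (Sss HC cS) (Sss HC dS)); exact: expg_order. Qed.

End Dihedral.

Lemma mvext (gT : finGroupType) (m1 m2 : mvec gT) : m1 =2 m2 -> m1 = m2.
Proof.
by move=> e; apply: functional_extensionality => u; apply: functional_extensionality => k.
Qed.

Section Hecke.
Variables (gT : finGroupType) (S K : {set gT}) (rho : gT -> int).
Implicit Types (s t c d : gT) (tau ups u : elt gT) (m : mvec gT) (ws : seq gT) (b : bool).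

Notation inKK := (inKK S K).
Notation sact := (sact S K).
Notation hn := (hn S).
Notation F := (F S).
Notation M := (@basisv gT).

Local Open Scope ring_scope.

(** Multiplication by [x^j]; likewise [mq] is multiplication by [x - x^-1], and [eig] by one of the
    eigenvalues [-x^-1], [x] of a fixed point. *)
Definition sh (j : int) m : mvec gT := fun u k => m u (k - j).
Definition mopp m : mvec gT := fun u k => - m u k.
Definition mzero : mvec gT := fun _ _ => 0.
Definition mq m : mvec gT := fun u k => m u (k - 1) - m u (k + 1).
Definition eig b m : mvec gT := fun u k => if b then - m u (k + 1) else m u (k - 1).
Definition lsign s u := rho (u.1^-1 * s * u.1)%g == -1.

(* Off [KKset] this is multiplication by [x], so that the quadratic relation holds on all of [mvec]. *)
Definition h s m : mvec gT := fun u k =>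
  if inKK u && (sact s u != u) then
    m (sact s u) k + (if (hn (sact s u) < hn u)%N then mq m u k else 0)
  else eig (inKK u && lsign s u) m u k.

Lemma h_add s m1 m2 : h s (madd m1 m2) = madd (h s m1) (h s m2).
Proof.
apply: mvext => u k; rewrite /h /madd /eig /mq.
by case: ifP => _; [case: ifP => _|case: ifP => _]; lia.
Qed.

Lemma h_opp s m : h s (mopp m) = mopp (h s m).
Proof.
apply: mvext => u k; rewrite /h /mopp /eig /mq.
by case: ifP => _; [case: ifP => _|case: ifP => _]; lia.
Qed.

Lemma h_sh s j m : h s (sh j m) = sh j (h s m).
Proof.
apply: mvext => u k; rewrite /h /sh /eig /mq.
have -> : k - 1 - j = k - j - 1 by lia.
by have -> : k + 1 - j = k - j + 1 by lia.
Qed.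

Lemma mqE m : mq m = madd (sh 1 m) (mopp (sh (-1) m)).
Proof. by apply: mvext => u k; rewrite /mq /madd /mopp /sh opprK. Qed.
Lemma eigE b m : eig b m = if b then mopp (sh (-1) m) else sh 1 m.
Proof. by apply: mvext => u k; rewrite /eig; case: b; rewrite /mopp /sh ?opprK. Qed.

Lemma h_q s m : h s (mq m) = mq (h s m).
Proof. by rewrite !mqE h_add h_opp !h_sh. Qed.
Lemma h_eig b s m : h s (eig b m) = eig b (h s m).
Proof. by rewrite !eigE; case: b; rewrite ?h_opp h_sh. Qed.
Lemma mq_add m1 m2 : mq (madd m1 m2) = madd (mq m1) (mq m2).
Proof. by apply: mvext => u k; rewrite /mq /madd; lia. Qed.
Lemma eig_add b m1 m2 : eig b (madd m1 m2) = madd (eig b m1) (eig b m2).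
Proof. by apply: mvext => u k; rewrite /eig /madd; case: b; lia. Qed.
Lemma eig_q b m : eig b (mq m) = mq (eig b m).
Proof.
apply: mvext => u k; rewrite /eig /mq.
have e1 : k - 1 + 1 = k by lia.
have e2 : k + 1 - 1 = k by lia.
by case: b; rewrite e1 e2 //; lia.
Qed.

Lemma eig_comm b b' m : eig b (eig b' m) = eig b' (eig b m).
Proof.
apply: mvext => u k; rewrite /eig.
have e1 : k - 1 + 1 = k by lia.
have e2 : k + 1 - 1 = k by lia.
by case: b; case: b'; rewrite ?e1 ?e2.
Qed.

Definition op ws m := foldr h m ws.

Lemma op_cat ws1 ws2 m : op (ws1 ++ ws2) m = op ws1 (op ws2 m).
Proof. exact: foldr_cat. Qed.
Lemma op_rcons ws s m : op (rcons ws s) m = op ws (h s m).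
Proof. by rewrite -cats1 op_cat. Qed.
Lemma op_add ws m1 m2 : op ws (madd m1 m2) = madd (op ws m1) (op ws m2).
Proof. by elim: ws => //= s ws ->; rewrite h_add. Qed.
Lemma op_opp ws m : op ws (mopp m) = mopp (op ws m).
Proof. by elim: ws => //= s ws ->; rewrite h_opp. Qed.
Lemma op_sh ws j m : op ws (sh j m) = sh j (op ws m).
Proof. by elim: ws => //= s ws ->; rewrite h_sh. Qed.
Lemma op_q ws m : op ws (mq m) = mq (op ws m).
Proof. by elim: ws => //= s ws ->; rewrite h_q. Qed.
Lemma op_eig b ws m : op ws (eig b m) = eig b (op ws m).
Proof. by elim: ws => //= s ws ->; rewrite h_eig. Qed.

Definition good s t n m := op (awl s t n) m = op (awl t s n) m.

(** For even [n] both sides use each letter equally often; an odd [n] leaves one letter over, hence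
    the condition. *)
Lemma good_eig2 s t b b' n m : h s m = eig b m -> h t m = eig b' m -> (odd n -> b = b') -> good s t n m.
Proof.
move=> es et; rewrite /good.
have st c d bc bd k : h c m = eig bc m -> h d m = eig bd m ->
  op (awl c d k.+2) m = eig bc (eig bd (op (awl c d k) m)).
  by move=> ec ed; rewrite awl_rcons op_rcons ec op_eig awl_rcons op_rcons ed op_eig.
have [k] := ubnP n; elim: k n => // k IH [|[|n]] lt hb //.
  by rewrite /= es et hb.
rewrite (st s t b b') // (st t s b' b) // IH; first exact: eig_comm.
  by lia.
by move=> o; apply: hb; rewrite /= negbK.
Qed.

Hypothesis HC : coxeter_system S.
Hypothesis KS : K \subset S.

Lemma h_quad s m : s \in S -> h s (h s m) = madd m (mq (h s m)).
Proof.
move=> sS; apply: mvext => u k; rewrite {1}/h /madd.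
have e1 : k - 1 + 1 = k by lia.
have e2 : k + 1 - 1 = k by lia.
case uK: (inKK u); rewrite /=; last first.
  by rewrite /eig /mq /h uK /= /eig e2; lia.
case: eqVneq => [lp|mv] /=.
  rewrite /mq /eig /h uK lp eqxx /= /eig; case: (lsign s u); rewrite ?e1 ?e2; lia.
have sK := sactK HC KS sS uK; have vK := inKK_sact HC KS sS uK.
have vn : u != sact s u by rewrite eq_sym.
rewrite {1}/h vK sK vn /=; case: (hn_sact HC KS sS uK) => [e|e|e].
- by rewrite e eqxx in mv.
- have -> : (hn (sact s u) < hn u)%N = false by lia.
  have -> : (hn u < hn (sact s u))%N by lia.
  rewrite /mq /h uK mv /=.
  have -> : (hn (sact s u) < hn u)%N = false by lia.
  by lia.
have -> : (hn (sact s u) < hn u)%N by lia.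
have -> : (hn u < hn (sact s u))%N = false by lia.
by rewrite addr0.
Qed.

Lemma h_up s tau : s \in S -> inKK tau -> (hn tau < hn (sact s tau))%N -> h s (M tau) = M (sact s tau).
Proof.
move=> sS tK up; apply: mvext => u k; rewrite /h /basisv.
have tv := inKK_sact HC KS sS tK; have tss := sactK HC KS sS tK.
have nt : sact s tau != tau by apply: contraTneq up => ->; rewrite ltnn.
case uK: (inKK u); rewrite /=; last first.
  have n1 : (u == tau) = false by apply: contraFF uK => /eqP ->.
  have n2 : (u == sact s tau) = false by apply: contraFF uK => /eqP ->.
  by rewrite /eig n1 n2.
have su := sactK HC KS sS uK.
have E : (sact s u == tau) = (u == sact s tau).
  by apply/eqP/eqP => [<-|->].
case: (eqVneq (sact s u) u) => [lp|mv] /=.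
  rewrite /eig -E lp.
  have -> : (u == tau) = false by apply: contra_neqF nt => /eqP e; rewrite -e.
  by rewrite /= oppr0; case: ifP.
rewrite E /mq; case: (eqVneq u tau) => [eu|nu].
  have -> : (hn (sact s u) < hn u)%N = false by rewrite eu; lia.
  by rewrite addr0.
by rewrite /= subrr; case: ifP; rewrite addr0.
Qed.

Lemma h_loop s tau : s \in S -> inKK tau -> sact s tau = tau -> h s (M tau) = eig (lsign s tau) (M tau).
Proof.
move=> sS tK lp; apply: mvext => u k; rewrite /h /basisv.
case: (eqVneq u tau) => [->|nu]; first by rewrite tK lp eqxx /= /eig eqxx.
case uK: (inKK u); rewrite /= /eig /mq; last by rewrite (negbTE nu) /= oppr0; case: ifP.
rewrite (negbTE nu) /=; case: (eqVneq (sact s u) u) => [_|mv] /=.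
  by rewrite oppr0; case: ifP; case: ifP.
have -> : (sact s u == tau) = false.
  by apply: contra_neqF nu => /eqP e; rewrite -(sactK HC KS sS uK) e.
by rewrite /= subrr oppr0; case: ifP; rewrite addr0; case: ifP.
Qed.

(** On [h s m] one word applies [h s] twice at its right end; the other grows by a letter and, by
    the relation for [m], begins with a repeated letter. The quadratic relation turns both into the
    same sum. Thus only vectors minimal for both letters remain to be tested. *)
Lemma good_h s t n m : s \in S -> t \in S -> (0 < n)%N -> good s t n m -> good s t n (h s m).
Proof.
move=> sS tS; case: n => // n _ g; rewrite /good.
have e1 : op (awl t s n.+1) (h s m) = madd (op (awl t s n) m) (mq (op (awl t s n.+1) m)).
  rewrite -op_rcons -awl_rcons [LHS]/= -/(op _ m).
  have -> : h (if ~~ odd n then t else s) (h (if odd n then t else s) (op (awl s t n) m)) =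
            h (if ~~ odd n then t else s) (op (awl s t n.+1) m) by [].
  rewrite g /=; case: (odd n) => /=; exact: h_quad.
rewrite e1 awl_rcons op_rcons h_quad // op_add op_q; congr madd; congr mq.
by rewrite -op_rcons -awl_rcons.
Qed.

Lemma path_up (x : nat -> elt gT) c d n : c \in S -> d \in S ->
  (forall k, (k < n)%N -> [/\ inKK (x k), sact (if odd k then d else c) (x k) = x k.+1
     & (hn (x k) < hn (x k.+1))%N]) ->
  op (awl c d n) (M (x 0%N)) = M (x n).
Proof.
move=> cS dS; elim: n => //= n IH hx.
rewrite -/(op _ _) IH; last by move=> k kn; apply: hx; lia.
have [xK e up] := hx n (ltnSn n).
rewrite h_up //; first by rewrite e.
  by case: ifP.
by rewrite e.
Qed.

End Hecke.

End HeckeOperators.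
Import HeckeOperators.

(** * Dihedral relations when both letters act in the fibre *)

Module DihedralFibres.

Section Braid.
Variables (gT : finGroupType) (S : {set gT}).
Hypothesis HC : coxeter_system S.
Variable K : {set gT}.
Hypothesis KS : K \subset S.
Variable rho : gT -> int.
Hypothesis rhoH : sign_hom K rho.
Implicit Types (s t c d p q u w : gT) (tau ups : elt gT) (m : mvec gT) (ws : seq gT) (b : bool).
Implicit Types (z : gT * {perm gT}).

Notation inKK := (inKK S K).
Notation sact := (sact S K).
Notation hn := (hn S).
Notation F := (F S).
Notation l := (len S).
Notation W := (<<S>>).
Notation WK := (<<K>>).
Notation M := (@basisv gT).
Notation h := (h S K rho).
Notation op := (op S K rho).
Notation good := (good S K rho).
Notation lsign := (lsign rho).

Lemma rho1 : rho 1 = 1%R.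
Proof.
have [hM hS] := rhoH; have := hM 1 1 (group1 _) (group1 _); rewrite mulg1.
by case: (hS 1 (group1 _)) => -> //; rewrite mulrNN mulr1.
Qed.

Lemma rhoJ u a : u \in WK -> a \in WK -> rho (u * a * u^-1) = rho a.
Proof.
move=> uK aK; have [hM hS] := rhoH; rewrite !hM ?groupM ?groupV //.
by rewrite mulrAC -hM ?groupV // mulgV rho1 mul1r.
Qed.

Section Key.
Variable I : {set gT}.
Hypothesis IK : I \subset K.
Let IS := subset_trans IK KS.

Lemma IWK u : u \in <<I>> -> u \in WK. Proof. exact/subsetP/genS. Qed.
Lemma IW u : u \in <<I>> -> u \in W. Proof. exact/subsetP/genS. Qed.
(** As [y] is minimal for W_I on the left, in [q y = y th(psi z q)] the inversion [a] of [q] must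
    come from [psi z q], which makes [psi z a] a reflection of W_I. It has length one because
    [psi z a * y] is as long as [a * y]. *)
Lemma psi_desc z q a : tinv K z -> (forall a, a \in I -> ~~ F a z.1) ->
  q \in <<I>> -> psi z q \in <<I>> -> a \in I -> F a q -> psi z a \in I.
Proof.
move=> zt ym qI pqI aI f; have qK := IWK qI; have qW := IW qI.
have aS := subsetP IS _ aI; have aT := ST aS; have aK := subsetP IK _ aI.
have aTK := KTK aK.
have ym2 := lmin_refl HC IS (yW KS zt) ym.
have yW := yW KS zt; have pqK := psiW zt qK.
have e : q * z.1 = z.1 * z.2 (psi z q) by rewrite (th_psi zt) // !mulgA mulgV mul1g.
have f1 : F a (q * z.1) by rewrite (F_lmin HC IS) // KTK.
have tW : z.2 (psi z q) \in W by apply: (WKW KS); apply: (thW (thA zt)).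
rewrite e (F_coc HC) // (negbTE (ym a aI)) addFb (F_psi_th HC KS zt) // in f1.
have pT : psi z a \in refls S by apply: (TKT KS); exact: (psiT zt).
have paI := TKWK (F_TK HC IS pT pqI f1).
apply: (lenK1 HC IS) => //.
have := lmin_add HC IS yW ym2 paI; rewrite (len_psi HC KS zt aTK) (len_sF HC aS yW) ?ym //; llia.
Qed.

(** At [u y th(u)^-1] the cocycle splits [F p] into three terms. The last, if true, would make
    [psi z (u^-1 p u)] an inversion of [u^-1], hence an element of W_I. *)
Lemma cnj_path_up z u p : perfect K z -> u \in <<I>> -> p \in I -> ~~ F p u ->
  ~~ F (u^-1 * p * u) z.1 -> psi z (u^-1 * p * u) \notin <<I>> ->
  l (twact u z).1 < l (cnj p (twact u z)).1.
Proof.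
move=> pz uI pI f1 f2 npq; have zt := perfect_tinv HC KS pz.
have uK := IWK uI; have pK := subsetP IK _ pI; have pS := subsetP IS _ pI.
have pT := ST pS; have uW := IW uI; have yW := yW KS zt.
have qI : u^-1 * p * u \in <<I>> by rewrite !groupM ?groupV // mem_gen.
have qTK : u^-1 * p * u \in refls K.
  by rewrite -{2}(invgK u) TKJ ?groupV // KTK.
rewrite (cnj_ltE HC KS (perfect_tw HC KS uK pz)) ?KTK //; apply/andP; split.
  rewrite (psi_tw zt uK (KWK pK)); apply: contra npq => /eqP e.
  suff -> : psi z (u^-1 * p * u) = u^-1 * p * u by [].
  by move: (psi _ _) e => x e; rewrite -e !mulgA mulVg mul1g mulgKV.
have tuK : (z.2 u)^-1 \in WK by rewrite groupV (thW (thA zt)).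
rewrite /twact /= -mulgA (F_coc HC) // ?groupM //; last exact: (WKW KS).
rewrite (negbTE f1) addFb (F_coc HC) ?(WKW KS tuK) // ?TJ // (negbTE f2) addFb.
rewrite -(thV (thA zt)) // (F_psi_th HC KS zt) // ?groupV //.
apply: contra npq => f3; apply: TKWK; apply: (F_TK HC IS) f3; rewrite ?groupV //.
by apply: (TKT KS); exact: (psiT zt).
Qed.

End Key.

Lemma minrepN w t : minrep S K w -> t \in K -> ~~ minrep S K (w * t).
Proof.
move=> wm tK; apply/negP => /andP [_ /forall_inP /(_ t tK)].
rewrite (SKr HC) ?(KSe KS) // (minrep_add HC KS wm (KWK tK)); llia.
Qed.

Lemma sact_fib s t w z : minrep S K w -> s * w = w * t -> t \in K -> sact s (w, z) = (w, cnj t z).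
Proof.
move=> wm e tK; rewrite /Defs.sact /= e (negbTE (minrepN wm tK)).
by rewrite -mulgA e mulgA mulVg mul1g.
Qed.

(** Both words climb the chain and pick up one eigenvalue, the first at its top and the second at
    its bottom. *)
Lemma chain_good (x : nat -> elt gT) s t b n : s \in S -> t \in S ->
  (forall k, (k < n)%N -> [/\ inKK (x k), sact (if odd k then t else s) (x k) = x k.+1
     & (hn (x k) < hn (x k.+1))%N]) ->
  h t (M (x 0)) = eig b (M (x 0)) ->
  h (if odd n then t else s) (M (x n)) = eig b (M (x n)) -> good s t n.+1 (M (x 0)).
Proof.
move=> sS tS hx e1 e2; rewrite /HeckeOperators.good [in RHS]awl_rcons op_rcons e1 op_eig //.
by rewrite [LHS]/= -/(op _ _) !(path_up rho HC KS sS tS hx).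
Qed.

Section Fib.
Variables (w s t s1 t1 : gT) (z : gT * {perm gT}).
Hypotheses (wm : minrep S K w) (pz : perfect K z).
Hypotheses (sS : s \in S) (tS : t \in S) (nst : s1 != t1).
Hypotheses (es : s * w = w * s1) (et : t * w = w * t1) (s1K : s1 \in K) (t1K : t1 \in K).
Notation n := #[s1 * t1].
Notation I := [set s1; t1].
Let zt := perfect_tinv HC KS pz.
Let s1S := KSe KS s1K.
Let t1S := KSe KS t1K.

Lemma I_K : I \subset K.
Proof. by apply/subsetP => x; rewrite !inE => /orP [] /eqP ->. Qed.

Lemma letterE k : (if odd k then t else s) * w = w * (if odd k then t1 else s1).
Proof. by case: ifP. Qed.
Lemma letterK k : (if odd k then t1 else s1) \in K. Proof. by case: ifP. Qed.
Lemma letterI k : (if odd k then t1 else s1) \in I.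
Proof. by case: ifP; rewrite !inE eqxx ?orbT. Qed.

Let uk k := wprod (awl s1 t1 k).
Let x k : elt gT := (w, twact (uk k) z).

Lemma x0 : x 0 = (w, z). Proof. by rewrite /x /uk /= (twact1 zt). Qed.

Lemma ukI k : uk k \in <<I>>. Proof. by apply: awl_gen. Qed.
Lemma ukK k : uk k \in WK. Proof. by apply: (IWK I_K); exact: ukI. Qed.

Lemma xK k : inKK (x k).
Proof. by rewrite /Defs.inKK wm (perfect_tw HC KS (ukK k) pz). Qed.

Lemma x_sact k : sact (if odd k then t else s) (x k) = x k.+1.
Proof.
rewrite (sact_fib _ wm (letterE k) (letterK k)) (cnj_tw HC KS) ?KTK ?letterK //.
  by rewrite -(twactM zt) ?ukK // KWK ?letterK.
by apply: tinv_tw => //; exact: ukK.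
Qed.

Lemma x_up k : l (twact (uk k) z).1 < l (cnj (if odd k then t1 else s1) (twact (uk k) z)).1 ->
  [/\ inKK (x k), sact (if odd k then t else s) (x k) = x k.+1 & (hn (x k) < hn (x k.+1))%N].
Proof.
move=> lt; split; [exact: xK|exact: x_sact|].
by rewrite -x_sact (sact_fib _ wm (letterE k) (letterK k)) /ModelSet.hn /= ltn_add2l.
Qed.

(** The two long words agree: one is [uk n.-1] preceded by this letter, the other is [uk n.-1]
    followed by [t1]. So the letter fixing the top of a chain is conjugate to [t1] and has the same
    eigenvalue. *)
Lemma uk_top : (if odd n.-1 then t1 else s1) = uk n.-1 * t1 * (uk n.-1)^-1.
Proof.
have := awl_top HC s1S t1S; have n0 : 0 < n := order_gt0 _.
rewrite -(prednK n0) [in RHS]awl_rcons wprod_rcons /= => e.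
by rewrite -e mulgK.
Qed.

Lemma uk_ne k : k < n.-1 -> (uk k)^-1 * (if odd k then t1 else s1) * uk k != t1.
Proof.
move=> lt; apply/eqP => e; have := @awl_neq _ _ HC s1 t1 s1S t1S nst k.+1; case; first by move: lt; clear; move: #[_] => j; lia.
by rewrite [in RHS]awl_rcons wprod_rcons /= -/(uk k) -{2}e !mulgA mulgV mul1g.
Qed.

Lemma rho_top : rho (if odd n.-1 then t1 else s1) = rho t1.
Proof. by rewrite uk_top rhoJ ?ukK ?KWK. Qed.

Lemma lsign_x p p1 k : p * w = w * p1 -> lsign p (x k) = (rho p1 == -1)%R.
Proof. by move=> e; rewrite /HeckeOperators.lsign /= -mulgA e mulgA mulVg mul1g. Qed.

(* [t] fixes [(w, z)], and [psi z] maps no other reflection of the dihedral group into it. *)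
Lemma fib_chain : psi z t1 = t1 ->
  (forall q, q \in refls I -> q != t1 -> ~~ F q z.1 && (psi z q \notin <<I>>)) ->
  good s t n (M (w, z)).
Proof.
move=> pt hq; have n0 : 0 < n := order_gt0 _; rewrite -(prednK n0) -x0.
have pk k : k < n.-1 ->
  [/\ inKK (x k), sact (if odd k then t else s) (x k) = x k.+1 & (hn (x k) < hn (x k.+1))%N].
  move=> lt; apply: x_up; have ukI := ukI k.
  have qI : (uk k)^-1 * (if odd k then t1 else s1) * uk k \in refls I.
    by rewrite -{2}(invgK (uk k)) TKJ ?groupV // KTK // letterI.
  have /andP [f1 f2] := hq _ qI (uk_ne lt).
  apply: (@cnj_path_up I I_K z (uk k)) => //; first exact: letterI.
  by apply: (awl_red HC s1S t1S) => //; apply: leq_trans lt (leq_pred _).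
apply: (@chain_good x s t (rho t1 == -1)%R n.-1) => //.
  rewrite (h_loop _ HC KS) ?xK //; first by rewrite (lsign_x _ et).
  rewrite x0 (sact_fib _ wm et t1K); congr (_, _); apply/eqP.
  by rewrite (cnj_loop HC KS zt) ?KTK // pt.
rewrite (h_loop _ HC KS) ?xK //; first by rewrite (lsign_x _ (letterE _)) rho_top.
  by case: ifP.
rewrite (sact_fib _ wm (letterE _) (letterK _)) /x; congr (_, _); apply/eqP.
have zt2 := tinv_tw zt (ukK n.-1).
rewrite (cnj_loop HC KS zt2) ?KTK ?letterK // (psi_tw zt) ?ukK ?KWK ?letterK //.
have -> : (uk n.-1)^-1 * (if odd n.-1 then t1 else s1) * uk n.-1 = t1.
  by rewrite uk_top !mulgA mulVg mul1g mulgKV.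
by rewrite pt -uk_top.
Qed.

(** When [psi z] sends no reflection of the dihedral group back into it, the word climbs all [n]
    steps; its end depends only on the group element, which both long words share. *)
Lemma fib_cycle_path :
  (forall q, q \in refls I -> ~~ F q z.1 && (psi z q \notin <<I>>)) ->
  op (awl s t n) (M (w, z)) = M (w, twact (uk n) z).
Proof.
move=> hq; rewrite -x0; apply: (path_up rho HC KS sS tS (x := x)) => k lt.
apply: x_up; have ukI := ukI k.
have qI : (uk k)^-1 * (if odd k then t1 else s1) * uk k \in refls I.
  by rewrite -{2}(invgK (uk k)) TKJ ?groupV // KTK // letterI.
have /andP [f1 f2] := hq _ qI.
apply: (@cnj_path_up I I_K z (uk k)) => //; first exact: letterI.
by apply: (awl_red HC s1S t1S).
Qed.

Lemma fib_fixed : psi z s1 = s1 -> psi z t1 = t1 -> good s t n (M (w, z)).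
Proof.
move=> ps pt; have zK := xK 0; rewrite x0 in zK.
have lp p p1 : p * w = w * p1 -> p1 \in K -> psi z p1 = p1 -> sact p (w, z) = (w, z).
  move=> e pK pp; rewrite (sact_fib _ wm e pK); congr (_, _); apply/eqP.
  by rewrite (cnj_loop HC KS zt) ?KTK // pp.
have lsE p p1 : p * w = w * p1 -> lsign p (w, z) = (rho p1 == -1)%R.
  by move=> e; have := lsign_x 0 e; rewrite x0.
apply: (@good_eig2 _ _ _ _ _ _ (rho s1 == -1)%R (rho t1 == -1)%R).
- by rewrite (h_loop _ HC KS) ?(lp s s1) // (lsE _ _ es).
- by rewrite (h_loop _ HC KS) ?(lp t t1) // (lsE _ _ et).
move=> o; have := rho_top; have n0 : 0 < n := order_gt0 _.
by move: o; rewrite -{1}(prednK n0) /= => /negbTE -> ->.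
Qed.

Lemma sz_up p p1 : p \in S -> p * w = w * p1 -> p1 \in K -> psi z p1 != p1 -> ~~ F p1 z.1 ->
  h p (M (w, z)) = M (w, cnj p1 z).
Proof.
move=> pS e pK ne f; have zK := xK 0; rewrite x0 in zK.
rewrite (h_up _ HC KS) // (sact_fib _ wm e pK) // /ModelSet.hn /= ltn_add2l.
by rewrite (cnj_ltE HC KS pz) ?KTK // ne f.
Qed.

(** By perfectness the swapped letters commute, so [n] is 2, and both move [z] to the same
    element. *)
Lemma fib_swap : psi z s1 = t1 -> ~~ F s1 z.1 -> ~~ F t1 z.1 -> good s t n (M (w, z)).
Proof.
move=> ps fs ft; have pt : psi z t1 = s1 by rewrite -ps (psiK zt) // KWK.
have c : t1 * s1 = s1 * t1 by have := ((perfectP HC KS z).1 pz).2 _ (KTK s1K); rewrite ps.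
have n2 : n = 2.
  apply/eqP; rewrite eqn_leq (order_mul_gt1 HC t1S nst) andbT; apply: dvdn_leq => //.
  by rewrite order_dvdn expgS expg1 -mulgA (mulgA t1) c -mulgA (Sss HC t1S) mulg1 (Sss HC s1S).
have e1 : h s (M (w, z)) = h t (M (w, z)).
  rewrite (sz_up sS es) ?ps 1?eq_sym // (sz_up tS et) ?pt //; congr (M (_, _)).
  rewrite !cnjE; congr (_, _); have := cnj_psi s1 z; have := cnj_psi t1 z.
  by rewrite !cnjE /= => -> ->; rewrite ps pt c.
by rewrite n2 /HeckeOperators.good /= e1 (h_quad _ HC KS) // -e1 (h_quad _ HC KS) // e1.
Qed.

(** Perfectness makes [s1] commute with [t1 s1 t1], so [n] divides 4, and it is 4 because [s1] and
    [t1] do not commute. Before and after the step by [s1] the letter [t] has the same eigenvalue,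
    so it acts as a scalar throughout. *)
Lemma fib_square : psi z t1 = t1 -> psi z s1 = t1 * s1 * t1 -> psi z s1 != s1 -> ~~ F s1 z.1 ->
  good s t n (M (w, z)).
Proof.
move=> pt ps ne fs; have tt := Sss HC t1S; have ss := Sss HC s1S.
have c : t1 * s1 * t1 * s1 = s1 * t1 * s1 * t1.
  by have := ((perfectP HC KS z).1 pz).2 _ (KTK s1K); rewrite ps !mulgA.
have n4 : n = 4.
  have e4 : (s1 * t1) ^+ 4 = 1 by apply/(awl_eq 4 ss tt); rewrite /= !mulg1 !mulgA.
  have : n %| 4 by rewrite order_dvdn e4.
  have nn2 : n != 2.
    apply: contra ne => /eqP n2; rewrite ps; have := expg_order (s1 * t1).
    rewrite n2 expgS expg1 => e2; apply/eqP/(mulgI s1); rewrite ss -e2 !mulgA. by [].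
  have := order_mul_gt1 HC t1S nst; move: nn2; move: #[_] => j; clear.
  by case: j => [|[|[|[|[|j]]]]] //= _ _ /dvdn_leq; lia.
have zK := xK 0; rewrite x0 in zK.
have e1 := sz_up sS es s1K ne fs.
have pz1 := perfect_cnj HC KS (KTK s1K) pz; have zt1 := perfect_tinv HC KS pz1.
have z1K : inKK (w, cnj s1 z) by apply/andP.
have lp : sact t (w, z) = (w, z).
  rewrite (sact_fib _ wm et t1K); congr (_, _); apply/eqP.
  by rewrite (cnj_loop HC KS zt) ?KTK // pt.
have lp1 : sact t (w, cnj s1 z) = (w, cnj s1 z).
  rewrite (sact_fib _ wm et t1K); congr (_, _); apply/eqP.
  rewrite (cnj_loop HC KS zt1) ?KTK // (cnj_tw HC KS zt (KTK s1K)) (psi_tw zt) ?KWK //.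
  have -> : psi z (s1^-1 * t1 * s1) = s1 * t1 * s1.
    rewrite (Sinv HC s1S) !(psiM zt) ?groupM ?KWK // ps pt !mulgA (SKr HC _ t1S) c.
    exact: (SKr HC _ t1S).
  by rewrite (Sinv HC s1S) !mulgA ss mul1g (SKr HC _ s1S).
have et1 : h t (M (w, z)) = eig (rho t1 == -1)%R (M (w, z)).
  by rewrite (h_loop _ HC KS) //; have := lsign_x 0 et; rewrite x0 => ->.
have et2 : h t (M (w, cnj s1 z)) = eig (rho t1 == -1)%R (M (w, cnj s1 z)).
  rewrite (h_loop _ HC KS) //; congr eig.
  by rewrite /HeckeOperators.lsign /= -mulgA et mulgA mulVg mul1g.
rewrite n4 /HeckeOperators.good /= e1 et2 et1 !h_eig e1 et2 h_eig -e1 (h_quad _ HC KS) //.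
by rewrite h_add h_q et1 e1 et2 -!eig_q -!eig_add.
Qed.

End Fib.
End Braid.

End DihedralFibres.
Import DihedralFibres.

(** * The braid relations on all basis vectors *)

Module BraidRelations.

Section BraidAll.
Variables (gT : finGroupType) (S : {set gT}).
Hypothesis HC : coxeter_system S.
Variable K : {set gT}.
Hypothesis KS : K \subset S.
Variable rho : gT -> int.
Hypothesis rhoH : sign_hom K rho.
Implicit Types (s t c d p q u w : gT) (tau ups : elt gT) (m : mvec gT) (ws : seq gT) (b : bool).
Implicit Types (z : gT * {perm gT}).

Notation inKK := (inKK S K).
Notation sact := (sact S K).
Notation hn := (hn S).
Notation F := (F S).
Notation l := (len S).
Notation W := (<<S>>).
Notation WK := (<<K>>).
Notation M := (@basisv gT).
Notation h := (h S K rho).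
Notation op := (op S K rho).
Notation good := (good S K rho).

(** By [psi_desc] a nontrivial such element has [t1] as its only left descent. Both [q] and [t1 q]
    are such elements, and [t1] cannot be a descent of both, so one of them is trivial. *)
Lemma psi_in_I z s1 t1 q : tinv K z -> s1 \in K -> t1 \in K ->
  (forall a, a \in [set s1; t1] -> ~~ F a z.1) -> psi z t1 = t1 ->
  psi z s1 \notin [set s1; t1] -> q \in <<[set s1; t1]>> -> psi z q \in <<[set s1; t1]>> ->
  q = 1 \/ q = t1.
Proof.
move=> zt s1K t1K ym pt ps qI pqI; have IK := I_K s1K t1K; have IS := subset_trans IK KS.
have t1S := KSe KS t1K; have t1I : t1 \in [set s1; t1] by rewrite !inE eqxx orbT.
have only q' : q' \in <<[set s1; t1]>> -> psi z q' \in <<[set s1; t1]>> -> q' != 1 -> F t1 q'.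
  move=> q'I pq' q'n; have [a aI f] := ldescK HC IS q'I q'n.
  have := psi_desc HC KS IK zt ym q'I pq' aI f.
  by case/set2P: aI f => -> // _; rewrite (negbTE ps).
case: (eqVneq q 1) => [->|qn]; first by left.
right; apply/eqP; rewrite -(inj_eq (mulgI t1)) (Sss HC t1S); apply: contraT => q1n.
have t1G := mem_gen t1I; have q1I := groupM t1G qI.
have pq1 : psi z (t1 * q) \in <<[set s1; t1]>>.
  by rewrite (psiM zt (KWK t1K) (IWK IK qI)) pt; exact: (groupM t1G pqI).
by have := only _ q1I pq1 q1n; rewrite (F_ss HC t1S (IW KS IK qI)) (only q).
Qed.

Lemma good_fib_t w s t s1 t1 z : minrep S K w -> perfect K z -> s \in S -> t \in S ->
  s1 != t1 -> s * w = w * s1 -> t * w = w * t1 -> s1 \in K -> t1 \in K ->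
  psi z t1 = t1 -> psi z s1 != s1 -> ~~ F s1 z.1 -> good s t #[s1 * t1] (M (w, z)).
Proof.
move=> wm pz sS tS nst es et s1K t1K pt ps fs; have zt := perfect_tinv HC KS pz.
have IK := I_K s1K t1K; have IS := subset_trans IK KS.
have t1S := KSe KS t1K; have t1I : t1 \in [set s1; t1] by rewrite !inE eqxx orbT.
have s1S := KSe KS s1K; have yW := yW KS zt; have t1T := KTK t1K.
have pst : psi z s1 != t1.
  by apply: contra nst => /eqP e; rewrite -(psiK zt (KWK s1K)) e pt.
have psI : psi z s1 \notin [set s1; t1] by rewrite !inE negb_or ps pst.
have refl_n1 q : q \in refls [set s1; t1] -> q != 1.
  by move=> qI; apply: (T_neq1 HC); exact: (TKT IS).
case f: (F t1 z.1); last first.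
  have ym a : a \in [set s1; t1] -> ~~ F a z.1.
    by rewrite !inE => /orP [] /eqP ->; rewrite ?fs ?f.
  apply: (fib_chain HC KS rhoH wm pz sS tS nst es et s1K t1K) => // q qI qn.
  rewrite (lmin_refl HC IS yW ym) //=; apply/negP => pq.
  case: (psi_in_I zt s1K t1K ym pt psI (TKWK qI) pq) => e.
    by have := refl_n1 q qI; rewrite e eqxx.
  by rewrite e eqxx in qn.
(* The descent [t1] of [y] is stripped off. Since [t1 y = y th(t1)], the result is a twisted
   involution whose [psi] is that of [z] conjugated by [t1], and neither letter is a descent of
   it. *)
pose z' : gT * {perm gT} := (t1 * z.1, z.2).
have tt := Sss HC t1S.
have ty : t1 * z.1 = z.1 * z.2 t1 by rewrite -{1}pt psi_y.
have pE a : psi z' a = t1 * psi z a * t1 by rewrite /psi /= invMg (Sinv HC t1S) !mulgA.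
have zt' : tinv K z'.
  case: (zt) => a1 a2 a3 a4; split => //=; first by rewrite groupM // KWK.
  rewrite (thM a2 (KWK t1K) a1) {1}ty mulgA -(mulgA z.1) -(thM a2 (KWK t1K) (KWK t1K)) tt.
  by rewrite (th1 a2) mulg1 a3.
have ym a : a \in [set s1; t1] -> ~~ F a z'.1.
  rewrite !inE => /orP [] /eqP -> /=; last by rewrite (F_ss HC) // f.
  rewrite ty (F_step HC) ?ST // ?(KSe KS (thK (thA zt) t1K)) // (negbTE fs) addFb.
  by rewrite -/(psi z t1) pt.
have pt' : psi z' t1 = t1 by rewrite pE pt tt mul1g.
have y'W : z'.1 \in W := PerfectInvolutions.yW KS zt'.
case: (eqVneq (psi z' s1) s1) => [ps'|ps'].
  apply: (fib_square HC KS rho wm pz sS tS nst es et s1K t1K) => //.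
  have := pE s1; rewrite ps'; move: (psi z s1) => x -> //.
  by rewrite !mulgA tt mul1g (SKr HC _ t1S).
have psI' : psi z' s1 \notin [set s1; t1].
  rewrite !inE negb_or ps' /= pE; apply: contra pst => /eqP e.
  apply/eqP/(mulgI t1)/(mulIg t1); move: (psi z s1) e => x ->.
  by rewrite (SKr HC _ t1S).
apply: (fib_chain HC KS rhoH wm pz sS tS nst es et s1K t1K) => // q qI qn.
have qT := TKT IS qI; have e0 : z.1 = t1 * z'.1 by rewrite /= mulgA tt mul1g.
apply/andP; split.
  rewrite e0 (F_coc HC qT (SW t1S) y'W) (F_s HC qT t1S) (negbTE qn) addFb.
  by apply: (lmin_refl HC IS y'W ym); rewrite -{2}(invgK t1) TKJ // groupV mem_gen.
apply/negP => pq; have t1G := mem_gen t1I.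
have pq' : psi z' q \in <<[set s1; t1]>> by rewrite pE; exact: (groupM (groupM t1G pq) t1G).
case: (psi_in_I zt' s1K t1K ym pt' psI' (TKWK qI) pq') => e.
  by have := refl_n1 q qI; rewrite e eqxx.
by rewrite e eqxx in qn.
Qed.

Lemma good_fib w s t s1 t1 z : minrep S K w -> perfect K z -> s \in S -> t \in S ->
  s1 != t1 -> s * w = w * s1 -> t * w = w * t1 -> s1 \in K -> t1 \in K ->
  (psi z s1 = s1 \/ ~~ F s1 z.1) -> (psi z t1 = t1 \/ ~~ F t1 z.1) ->
  good s t #[s1 * t1] (M (w, z)).
Proof.
move=> wm pz sS tS nst es et s1K t1K ms mt; have zt := perfect_tinv HC KS pz.
have IK := I_K s1K t1K; have IS := subset_trans IK KS.
have t1S := KSe KS t1K; have s1S := KSe KS s1K.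
have swap : #[t1 * s1] = #[s1 * t1] by rewrite order_swap ?(Sss HC).
case: (eqVneq (psi z s1) s1) ms => [ps _|ps [e|fs]]; last 2 first.
- by rewrite e eqxx in ps.
- case: (eqVneq (psi z t1) t1) mt => [pt _|pt [e|ft]]; first exact: good_fib_t.
    by rewrite e eqxx in pt.
  case: (eqVneq (psi z s1) t1) => [pst|pst].
    by apply: (fib_swap HC KS rho wm pz sS tS nst es et s1K t1K).
  have pts : psi z t1 != s1.
    by apply: contra pst => /eqP e; rewrite -{1}e (psiK zt) ?KWK.
  have ym a : a \in [set s1; t1] -> ~~ F a z.1 by rewrite !inE => /orP [] /eqP ->.
  have hq q : q \in refls [set s1; t1] -> ~~ F q z.1 && (psi z q \notin <<[set s1; t1]>>).
    move=> qI; rewrite (lmin_refl HC IS (yW KS zt) ym) //=; apply/negP => pq.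
    have qn : q != 1 by apply: (T_neq1 HC); exact: (TKT IS).
    have [a aI f] := ldescK HC IS (TKWK qI) qn.
    have := psi_desc HC KS IK zt ym (TKWK qI) pq aI f.
    by move: aI; rewrite !inE => /orP [] /eqP ->; rewrite ?(negbTE ps) ?(negbTE pst)
      ?(negbTE pt) ?(negbTE pts).
  rewrite /HeckeOperators.good (fib_cycle_path HC KS rho wm pz sS tS nst es et s1K t1K hq).
  rewrite -swap (fib_cycle_path HC KS rho wm pz tS sS _ et es t1K s1K); last 2 first.
  - by rewrite eq_sym.
  - by move=> q; rewrite setUC; exact: hq.
  by rewrite swap (awl_top HC s1S t1S).
case: (eqVneq (psi z t1) t1) mt => [pt _|pt [e|ft]].
- exact: (fib_fixed HC KS rhoH wm pz sS tS es et s1K t1K).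
- by rewrite e eqxx in pt.
apply/esym; rewrite -swap; apply: good_fib_t => //; by rewrite eq_sym.
Qed.

Section Move.
Variables (w s t : gT) (z : gT * {perm gT}).
Hypotheses (wm : minrep S K w) (pz : perfect K z).
Hypotheses (sS : s \in S) (tS : t \in S) (nst : s != t).
Hypotheses (fs : ~~ F s w) (ft : ~~ F t w).
Notation n := #[s * t].
Notation I := [set s; t].
Let uk k := wprod (awl s t k).
Let wW := minrepW wm.
Let IS : I \subset S := I_sub sS tS.

Let ym : forall r, r \in refls I -> ~~ F r w.
Proof. by apply: (lmin_refl HC IS wW) => a; rewrite !inE => /orP [] /eqP ->. Qed.

Lemma move_path N : N <= n ->
  (forall k, k < N -> (uk k)^-1 * (if odd k then t else s) * uk k \in I ->
     w^-1 * ((uk k)^-1 * (if odd k then t else s) * uk k) * w \notin K) ->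
  minrep S K (uk N * w) /\ (forall z', perfect K z' -> op (awl s t N) (M (w, z')) = M (uk N * w, z')).
Proof.
move=> Nn hN.
have ukI k : uk k \in <<I>> by apply: awl_gen.
have ukW k : uk k \in W by apply: (WKW IS).
have pS k : (if odd k then t else s) \in S by case: ifP.
have pI k : (if odd k then t else s) \in I by case: ifP; rewrite !inE eqxx ?orbT.
have mk k : k <= N -> minrep S K (uk k * w).
  elim: k => [|k IH] kN; first by rewrite /uk /= mul1g.
  have mw := IH (ltnW kN); have -> : uk k.+1 * w = (if odd k then t else s) * (uk k * w).
    by rewrite /uk /= mulgA.
  apply: contraT => /(minrep_act HC KS (pS k) mw) /andP [tK _].
  set q := (uk k)^-1 * (if odd k then t else s) * uk k.
  have qE : w^-1 * q * w \in K by move: tK; rewrite invMg /q !mulgA.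
  have qI : q \in <<I>> by exact: (groupM (groupM (groupVr (ukI k)) (mem_gen (pI k))) (ukI k)).
  have := hN k kN; rewrite -/q qE => h0.
  (* If the walk left W^K, then [q w] would be [w] times a letter of [K], of length [l w + 1].
     Lengths also add in [q w], so [q] would have length one and be a letter of [I], the case that
     [hN] excludes. *)
  suff : q \in I by move/h0.
  apply: (lenK1 HC IS qI); have := lmin_add HC IS wW ym qI.
  have -> : q * w = w * (w^-1 * q * w) by rewrite !mulgA mulgV mul1g.
  rewrite (minrep_add HC KS wm (KWK qE)) (lenS1 HC (KSe KS qE)); llia.
split; first exact: mk.
move=> z' pz'; have -> : (w, z') = (uk 0 * w, z') :> elt gT by rewrite /uk /= mul1g.
apply: (@path_up _ S K rho HC KS (fun k => (uk k * w, z'))) => // k kN.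
have m1 := mk k (ltnW kN); have m2 := mk k.+1 kN.
have e : uk k.+1 * w = (if odd k then t else s) * (uk k * w) by rewrite /uk /= mulgA.
split; first by apply/andP.
  by rewrite /Defs.sact /= -e m2.
have f : ~~ F (if odd k then t else s) (uk k * w).
  rewrite (F_lmin HC IS) ?KTK //; apply: (awl_red HC sS tS nst); exact: leq_trans kN Nn.
by rewrite /ModelSet.hn /= e (len_sF HC (pS k) (groupM (ukW k) wW) f) ltn_add2r ltn_pmul2l.
Qed.

Lemma moved_notK p : p \in S -> minrep S K (p * w) -> w^-1 * p * w \notin K.
Proof.
move=> pS mp; apply/negP => pK; have := minrepN HC KS wm pK.
by rewrite !mulgA mulgV mul1g mp.
Qed.

Lemma good_move2 : minrep S K (s * w) -> minrep S K (t * w) -> op (awl s t n) (M (w, z)) = M (uk n * w, z).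
Proof.
move=> ms mt; apply: (move_path (leqnn _) _).2 => // k kn.
by rewrite inE => /orP [] /set1P ->; exact: moved_notK.
Qed.

(** After [n - 1] moves of the coset the remaining letter acts in the fibre by the same [t1] as [t]
    does at the bottom, since the two long words agree. Both words apply this one fibre step, a loop
    or an ascent, at opposite ends. *)
Lemma good_move1 t1 : minrep S K (s * w) -> t * w = w * t1 -> t1 \in K ->
  hn (w, z) <= hn (sact t (w, z)) -> good s t n (M (w, z)).
Proof.
move=> ms et t1K; rewrite (sact_fib HC KS _ wm et t1K) => ht.
have n0 : 0 < n := order_gt0 _.
have path : minrep S K (uk n.-1 * w) /\
  (forall z', perfect K z' -> op (awl s t n.-1) (M (w, z')) = M (uk n.-1 * w, z')).
  apply: move_path (leq_pred _) _ => k kn.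
  rewrite inE => /orP [] /set1P e; first by rewrite e; exact: moved_notK.
  have := @awl_neq _ _ HC s t sS tS nst k.+1; case; first by move: kn; clear; move: #[_] => j; lia.
  by rewrite [in RHS]awl_rcons wprod_rcons /= -/(uk k) -{2}e !mulgA mulgV mul1g.
have [mk pk] := path.
have e2 : (if odd n.-1 then t else s) * (uk n.-1 * w) = uk n.-1 * w * t1.
  have : wprod (awl s t n.-1.+1) = wprod (awl t s n.-1.+1) by rewrite (prednK n0) (awl_top HC sS tS).
  rewrite [in RHS]awl_rcons wprod_rcons /= -/(uk _) mulgA => ->.
  by rewrite -!mulgA et.
have pS : (if odd n.-1 then t else s) \in S by case: ifP.
have wK : inKK (w, z) by apply/andP.
have uK : inKK (uk n.-1 * w, z) by apply/andP.
have zt := perfect_tinv HC KS pz.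
have pz1 := perfect_cnj HC KS (KTK t1K) pz.
rewrite -(prednK n0) /HeckeOperators.good [in RHS]awl_rcons op_rcons [LHS]/= -/(op _ _) pk //.
have sE := sact_fib HC KS z mk e2 t1K; have sE0 := sact_fib HC KS z wm et t1K.
case: (eqVneq (cnj t1 z) z) => [lp|nl].
  rewrite lp in sE sE0; rewrite !(h_loop _ HC KS) // op_eig pk //; congr eig.
  have E v p : p * v = v * t1 -> v^-1 * p * v = t1 by rewrite -mulgA => ->; rewrite mulKg.
  by rewrite /lsign /= (E _ _ e2) (E _ _ et).
have lt : l z.1 < l (cnj t1 z).1.
  move: ht; rewrite /ModelSet.hn /= leq_add2l leq_eqVlt => /orP [/eqP e|//].
  have := cnj_ltE HC KS pz (KTK t1K); have := cnj_gtE HC KS pz (KTK t1K).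
  by rewrite e ltnn -(cnj_loop HC KS zt) ?KTK // nl /= => <-.
have up v : hn (v, z) < hn (v, cnj t1 z) by rewrite /ModelSet.hn /= ltn_add2l.
by rewrite !(h_up _ HC KS) ?sE ?sE0 ?up // pk.
Qed.

End Move.

Lemma good_basis s t tau : s \in S -> t \in S -> s != t -> inKK tau -> good s t #[s * t] (M tau).
Proof.
move=> sS tS nst; have n0 : 0 < #[s * t] := order_gt0 _.
have [k] := ubnP (hn tau); elim: k tau => // k IH tau lt tK.
have red p : p \in S -> hn (sact p tau) < hn tau ->
    M tau = h p (M (sact p tau)) /\ good s t #[s * t] (M (sact p tau)).
  move=> pS d; have vK := inKK_sact HC KS pS tK; split.
    by rewrite (h_up _ HC KS) ?(sactK HC KS).
  by apply: IH => //; apply: leq_trans d _.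
case: (ltnP (hn (sact s tau)) (hn tau)) => [/(red s sS) [-> g]|ds]; first exact: good_h.
case: (ltnP (hn (sact t tau)) (hn tau)) => [/(red t tS) [-> g]|dt].
  by apply/esym; apply: good_h => //; apply/esym.
case: tau tK ds dt {lt red} => w z tK ds dt; have [wm pz] := andP tK.
have wW := minrepW wm; have zt := perfect_tinv HC KS pz.
have nf p : p \in S -> hn (w, z) <= hn (sact p (w, z)) -> ~~ F p w.
  move=> pS; apply: contraL => f; rewrite -ltnNge /Defs.sact /= (minrep_desc HC KS pS wm f).
  by rewrite /ModelSet.hn /= ltn_add2r ltn_pmul2l.
have fs := nf s sS ds; have ft := nf t tS dt.
have swap : #[t * s] = #[s * t] by rewrite order_swap ?(Sss HC).
have cv p : p \in S -> ~~ minrep S K (p * w) ->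
    [/\ p * w = w * (w^-1 * p * w) & w^-1 * p * w \in K].
  move=> pS nm; have /andP [pK _] := minrep_act HC KS pS wm nm.
  by split=> //; rewrite !mulgA mulgV mul1g.
case: (boolP (minrep S K (s * w))) => ms; case: (boolP (minrep S K (t * w))) => mt.
- rewrite /HeckeOperators.good (good_move2 wm pz) // -swap (good_move2 wm pz) 1?eq_sym //.
  by rewrite swap (awl_top HC sS tS).
- by have [e tK1] := cv t tS mt; exact: (good_move1 wm pz sS tS nst fs ft ms e tK1).
- have [e sK1] := cv s sS ms; apply/esym; rewrite -swap.
  by apply: (good_move1 wm pz tS sS _ ft fs mt e sK1) => //; rewrite eq_sym.
have [es s1K] := cv s sS ms; have [et t1K] := cv t tS mt.
have eo : #[s * t] = #[(w^-1 * s * w) * (w^-1 * t * w)].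
  by rewrite -(orderJ _ w); congr #[_]; rewrite conjgE !mulgA mulgK.
rewrite eo; apply: good_fib => //.
- by apply: contra nst => /eqP /(mulIg _)/(mulgI _) ->.
- move: ds; rewrite (sact_fib HC KS _ wm es s1K) /ModelSet.hn /= leq_add2l leqNgt.
  by rewrite (cnj_gtE HC KS pz) ?KTK // negb_and negbK => /orP [/eqP|]; [left|right].
move: dt; rewrite (sact_fib HC KS _ wm et t1K) /ModelSet.hn /= leq_add2l leqNgt.
by rewrite (cnj_gtE HC KS pz) ?KTK // negb_and negbK => /orP [/eqP|]; [left|right].
Qed.

End BraidAll.

End BraidRelations.
Import BraidRelations.

(** * Inverse operators and the action of Hecke algebra elements *)

Module HeckeAction.

Lemma awl_rev (gT : finGroupType) (c d : gT) n :
  rev (awl c d n) = if odd n then awl c d n else awl d c n.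
Proof.
elim: n c d => [|n IH] c d //; rewrite awl_rcons rev_rcons IH -awl_rcons /=.
by case: (odd n).
Qed.

Lemma gap2_lt a b : a = b.+2 -> (b < a) /\ (a < b) = false.
Proof. by move=> ->; lia. Qed.

Section MelSec.
Variables (gT : finGroupType) (S K : {set gT}) (rho : gT -> int).
Implicit Types (s t : gT) (tau u : elt gT) (m : mvec gT) (ws : seq gT) (b : bool).
Notation inKK := (inKK S K).
Notation Mel := (Mel S K).
Notation M := (@basisv gT).
Notation h := (h S K rho).
Local Open Scope ring_scope.

Lemma Mel_zero : Mel (@mzero gT). Proof. by split=> //; exists 0%N. Qed.

Lemma Mel_basis tau : inKK tau -> Mel (M tau).
Proof.
move=> tK; split=> [u k uK|].
  by rewrite /basisv; case: eqP => //= e; rewrite e tK in uK.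
exists 0%N => u k kn; rewrite /basisv; have -> : (k == 0) = false by lia.
by rewrite andbF.
Qed.

Lemma Mel_add m1 m2 : Mel m1 -> Mel m2 -> Mel (madd m1 m2).
Proof.
case=> [s1 [N1 b1]] [s2 [N2 b2]]; split=> [u k uK|]; first by rewrite /madd s1 ?s2.
by exists (maxn N1 N2) => u k kn; rewrite /madd b1 ?b2 //; lia.
Qed.

Lemma Mel_opp m : Mel m -> Mel (mopp m).
Proof.
case=> [s1 [N1 b1]]; split=> [u k uK|]; first by rewrite /mopp s1.
by exists N1 => u k kn; rewrite /mopp b1.
Qed.

Lemma Mel_sh j m : Mel m -> Mel (sh j m).
Proof.
case=> [s1 [N1 b1]]; split=> [u k uK|]; first by rewrite /sh s1.
by exists (N1 + absz j)%N => u k kn; rewrite /sh b1 //; lia.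
Qed.

Lemma Mel_q m : Mel m -> Mel (mq m).
Proof. by move=> mM; rewrite mqE; apply: Mel_add; [|apply: Mel_opp]; apply: Mel_sh. Qed.

Lemma Mel_h s m : Mel m -> Mel (h s m).
Proof.
case=> [s1 [N1 b1]]; split=> [u k /negbTE uK|].
  by rewrite /HeckeOperators.h uK /= /eig s1 // uK.
exists N1.+1 => u k kn; rewrite /HeckeOperators.h /eig /mq.
have b2 v : m v (k - 1) = 0 by apply: b1; lia.
have b3 v : m v (k + 1) = 0 by apply: b1; lia.
have b4 v : m v k = 0 by apply: b1; lia.
by rewrite !b2 !b3 !b4 oppr0; case: ifP => _; case: ifP.
Qed.

Definition win (N : nat) : seq int := [seq (i%:Z - N%:Z)%R | i <- iota 0 (N + N).+1].

Lemma win_uniq N : uniq (win N).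
Proof. by rewrite map_inj_uniq ?iota_uniq // => i j; lia. Qed.

Lemma mem_win N k : (k \in win N) = (absz k <= N)%N.
Proof.
apply/mapP/idP => [[i]|h]; first by rewrite mem_iota => /andP [_ h1] ->; lia.
by exists (absz (k + N%:Z)); rewrite ?mem_iota; lia.
Qed.

(** A vector in [Mel] is a finite sum of integer multiples of [x^j M_tau], and these multiples arise
    from repeated sums and negatives. *)
Lemma Mel_ind (P : mvec gT -> Prop) : P (@mzero gT) ->
  (forall a c, Mel a -> Mel c -> P a -> P c -> P (madd a c)) ->
  (forall a, Mel a -> P a -> P (mopp a)) ->
  (forall tau j, inKK tau -> P (sh j (M tau))) -> forall m, Mel m -> P m.
Proof.
move=> P0 Padd Popp Pb m [ms [N mb]].
pose f (L : seq (elt gT * int)) : mvec gT :=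
  fun u k => \sum_(p <- L) m p.1 p.2 * ((u == p.1) && (k == p.2))%:R.
pose one (tau : elt gT) (j c : int) : mvec gT := fun u k => c * ((u == tau) && (k == j))%:R.
have Pone tau j c : inKK tau -> Mel (one tau j c) /\ P (one tau j c).
  move=> tK.
  have nat (n : nat) : Mel (one tau j n) /\ P (one tau j n).
    elim: n => [|n [IH1 IH2]].
      have -> : one tau j 0%N = @mzero gT by apply: mvext => u k; rewrite /one mul0r.
      by split=> //; exact: Mel_zero.
    have -> : one tau j n.+1 = madd (sh j (M tau)) (one tau j n).
      apply: mvext => u k; rewrite /one /madd /sh /basisv subr_eq0.
      by case: (_ && _); rewrite ?mulr1 ?mulr0; lia.
    have M1 : Mel (sh j (M tau)) by apply: Mel_sh; exact: Mel_basis.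
    by split; [exact: Mel_add|apply: Padd => //; exact: Pb].
  case: c => n; first exact: nat.
  have [h1 h2] := nat n.+1.
  have -> : one tau j (Negz n) = mopp (one tau j n.+1).
    by apply: mvext => u k; rewrite /one /mopp NegzE mulNr.
  by split; [exact: Mel_opp|exact: Popp].
have Pf (L : seq (elt gT * int)) : all (fun p => inKK p.1) L -> Mel (f L) /\ P (f L).
  elim: L => [_|p L IH /= /andP [pK /IH [h1 h2]]].
    have -> : f [::] = @mzero gT by apply: mvext => u k; rewrite /f big_nil.
    by split=> //; exact: Mel_zero.
  have -> : f (p :: L) = madd (one p.1 p.2 (m p.1 p.2)) (f L).
    by apply: mvext => u k; rewrite /f /madd /one big_cons.
  have [g1 g2] := Pone p.1 p.2 (m p.1 p.2) pK.
  by split; [exact: Mel_add|exact: Padd].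
pose L := [seq (tau, k) | tau <- enum (KKset S K), k <- win N].
have LK : all (fun p => inKK p.1) L.
  by apply/allP => p /allpairsP [[a c] [/= + _ ->]] /=; rewrite mem_enum inE.
suff -> : m = f L by case: (Pf L LK).
have uL : uniq L by apply: allpairs_uniq; [exact: enum_uniq|exact: win_uniq|case=> a c [d e]].
apply: mvext => u k; rewrite /f; case: (boolP ((u, k) \in L)) => uk.
  rewrite (bigD1_seq (u, k)) //= !eqxx mulr1 big1 ?addr0 // => p pn.
  case: eqP => [e1|_]; rewrite ?mulr0 //=; case: eqP => [e2|_]; rewrite ?mulr0 //.
  by case/eqP: pn; rewrite e1 e2; case: (p).
rewrite big1_seq; last first.
  move=> p /andP [_ pL]; case: eqP => [e1|_]; rewrite ?mulr0 //=; case: eqP => [e2|_]; rewrite ?mulr0 //.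
  by case/negP: uk; rewrite e1 e2; case: (p) pL.
case: (boolP (inKK u)) => uK; last exact: ms.
apply: mb; rewrite ltnNge; apply: contra uk => kN.
by apply/allpairsP; exists (u, k); rewrite mem_enum inE uK mem_win.
Qed.

Definition hi s m := madd (h s m) (mopp (mq m)).

Lemma Mel_hi s m : Mel m -> Mel (hi s m).
Proof. by move=> mM; apply: Mel_add; [exact: Mel_h|apply: Mel_opp; exact: Mel_q]. Qed.

Lemma hi_add s m1 m2 : hi s (madd m1 m2) = madd (hi s m1) (hi s m2).
Proof. by rewrite /hi h_add mq_add; apply: mvext => u k; rewrite /madd /mopp; lia. Qed.
Lemma hi_opp s m : hi s (mopp m) = mopp (hi s m).
Proof. by rewrite /hi h_opp; apply: mvext => u k; rewrite /madd /mopp /mq; lia. Qed.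
Lemma mq_sh j m : mq (sh j m) = sh j (mq m).
Proof.
apply: mvext => u k; rewrite /sh /mq.
have -> : k - 1 - j = k - j - 1 by lia.
by have -> : k + 1 - j = k - j + 1 by lia.
Qed.
Lemma hi_sh s j m : hi s (sh j m) = sh j (hi s m).
Proof. by rewrite /hi h_sh mq_sh. Qed.

Definition opi ws m := foldr hi m ws.
Lemma opi_cat ws1 ws2 m : opi (ws1 ++ ws2) m = opi ws1 (opi ws2 m).
Proof. exact: foldr_cat. Qed.
Lemma opi_rcons ws s m : opi (rcons ws s) m = opi ws (hi s m).
Proof. by rewrite -cats1 opi_cat. Qed.
Lemma Mel_opi ws m : Mel m -> Mel (opi ws m).
Proof. by move=> mM; elim: ws => //= s ws; exact: Mel_hi. Qed.
Definition mon (p : bool * int) m : mvec gT := if p.1 then mopp (sh p.2 m) else sh p.2 m.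
Lemma hi_mon s p m : hi s (mon p m) = mon p (hi s m).
Proof. by rewrite /mon; case: p.1; rewrite ?hi_opp hi_sh. Qed.
Lemma opi_mon ws p m : opi ws (mon p m) = mon p (opi ws m).
Proof. by elim: ws => //= s ws ->; rewrite hi_mon. Qed.
Lemma Mel_mon p m : Mel m -> Mel (mon p m).
Proof. by move=> mM; rewrite /mon; case: p.1; [apply: Mel_opp|]; exact: Mel_sh. Qed.
Lemma mon_mon p p' m : mon p (mon p' m) = mon (p.1 (+) p'.1, p.2 + p'.2) m.
Proof.
apply: mvext => u k; rewrite /mon /mopp /sh.
by case: p => [[] j]; case: p' => [[] j'] /=; rewrite ?opprK opprD addrA.
Qed.

(** Sign and exponent of the inverse eigenvalues [-x] and [x^-1], in the format of [mon]. *)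
Definition eigi b : bool * int := if b then (true, 1) else (false, -1).

Lemma hi_of_eig s b m : h s m = eig b m -> hi s m = mon (eigi b) m.
Proof.
rewrite /hi => ->; apply: mvext => u k; rewrite /madd /mopp /eig /mq /mon /mopp /sh.
case: b.
  by change (- m u (k + 1) - (m u (k - 1) - m u (k + 1)) = - m u (k - 1)); lia.
change (m u (k - 1) - (m u (k - 1) - m u (k + 1)) = m u (k - - 1)).
by rewrite subKr opprK.
Qed.

Hypothesis HC : coxeter_system S.
Hypothesis KS : K \subset S.
Hypothesis rhoH : sign_hom K rho.

Lemma hi_h s m : s \in S -> hi s (h s m) = m.
Proof.
move=> sS; rewrite /hi (h_quad _ HC KS) //; apply: mvext => u k.
by rewrite /madd /mopp addrK.
Qed.
Lemma h_hi s m : s \in S -> h s (hi s m) = m.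
Proof.
move=> sS; rewrite /hi h_add h_opp h_q (h_quad _ HC KS) //; apply: mvext => u k.
by rewrite /madd /mopp addrK.
Qed.

(** [Hs] sums over the sources of arrows whereas [h] reads the coefficient at a target; a target
    only receives from itself and from its [s]-neighbour. *)
Lemma HsE s m : s \in S -> Mel m -> Hs S K rho s m = h s m.
Proof.
move=> sS [ms _]; apply: mvext => u k; rewrite /Hs.
case: (boolP (inKK u)) => uK; last first.
  have nu tau : inKK tau -> (u == tau) = false.
    by move=> tK; apply/negbTE; apply: contra uK => /eqP ->.
  rewrite /HeckeOperators.h (negbTE uK) /= /eig ms // big1 // => tau; rewrite inE => tK.
  have n1 := nu tau tK; have n2 := nu _ (inKK_sact HC KS sS tK).
  by rewrite n1 n2 !mul0r addr0; do ![case: ifP => _ //].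
have vK := inKK_sact HC KS sS uK; have su := sactK HC KS sS uK.
have E tau : inKK tau -> (u == sact S K s tau) = (tau == sact S K s u).
  by move=> tK; apply/eqP/eqP => ->; rewrite (sactK HC KS).
set term := BIG_F; rewrite /HeckeOperators.h uK /=; have uS : u \in KKset S K by rewrite inE.
case: (eqVneq (sact S K s u) u) => [lp|mv] /=.
  rewrite (bigD1 u) //= big1 ?addr0; last first.
    move=> tau /andP []; rewrite inE => tK /negbTE nt; rewrite /term E // lp nt.
    by rewrite [u == tau]eq_sym nt !mul0r addr0; do ![case: ifP => _ //].
  rewrite /term (ascLE HC KS) // (desLE HC KS) // lp ltnn !inE sS (eqLE HC KS) // lp !eqxx !mul1r /=.
  rewrite /eig /lsign; case: ifP => // /negbT r1.
  have [tK _ _] := sact_loopP HC KS sS uK lp.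
  have [_ /(_ _ (KWK tK)) [->|e]] := rhoH; first by rewrite eqxx.
  by rewrite e in r1.
rewrite (bigD1 u) //= (bigD1 (sact S K s u)) /=; last by rewrite inE vK mv.
rewrite big1 ?addr0; last first.
  move=> tau /andP [/andP []]; rewrite inE => tK /negbTE n1 /negbTE n2; rewrite /term E // n2.
  by rewrite [u == tau]eq_sym n1 !mul0r addr0; do ![case: ifP => _ //].
have nv : (u == sact S K s u) = false by rewrite eq_sym (negbTE mv).
have tv : term (sact S K s u) = m (sact S K s u) k.
  rewrite /term (ascLE HC KS sS vK) (desLE HC KS sS vK) su nv eqxx mul1r mul0r addr0.
  case: (hn_sact HC KS sS uK) => [e|/gap2_lt [g1 g2]|/gap2_lt [g1 g2]]; rewrite ?g1 ?g2 //.
  by rewrite e eqxx in mv.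
rewrite tv addrC; congr (_ + _).
rewrite /term (ascLE HC KS sS uK) (desLE HC KS sS uK) nv eqxx mul1r mul0r add0r /mq.
case: (hn_sact HC KS sS uK) => [e|/gap2_lt [g1 g2]|/gap2_lt [g1 g2]]; rewrite ?g1 ?g2 //.
by rewrite e eqxx in mv.
Qed.

Lemma good_Mel s t m : s \in S -> t \in S -> s != t -> Mel m -> good S K rho s t #[s * t]%g m.
Proof.
move=> sS tS nst; apply: Mel_ind.
- have z0 ws : op S K rho ws (@mzero gT) = @mzero gT.
    elim: ws => //= c ws ->; apply: mvext => u k; rewrite /HeckeOperators.h /mq /eig /mzero subrr oppr0.
    by case: ifP => _; case: ifP => _; rewrite ?addr0.
  by rewrite /good !z0.
- by move=> a c _ _; rewrite /good !op_add => -> ->.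
- by move=> a _; rewrite /good !op_opp => ->.
by move=> tau j tK; rewrite /good !op_sh (good_basis HC KS rhoH).
Qed.

Lemma op_opi ws m : all (mem S) ws -> op S K rho (rev ws) (opi ws m) = m.
Proof.
elim: ws => //= s ws IH /andP [sS wsS].
by rewrite rev_cons op_rcons h_hi // IH.
Qed.
Lemma opi_op ws m : all (mem S) ws -> opi ws (op S K rho (rev ws) m) = m.
Proof.
elim/last_ind: ws => // ws s IH; rewrite all_rcons => /andP [sS wsS].
by rewrite rev_rcons opi_rcons /= hi_h // IH.
Qed.

(** Inversion reverses words, and reversal maps the pair of long alternating words to itself. *)
Lemma braid_i s t m : s \in S -> t \in S -> s != t -> Mel m ->
  opi (awl s t #[s * t]%g) m = opi (awl t s #[s * t]%g) m.
Proof.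
move=> sS tS nst mM; set n := #[_]%g.
have a1 : all (mem S) (awl s t n) by exact: awl_all.
have a2 : all (mem S) (awl t s n) by exact: awl_all.
have rv x : Mel x -> op S K rho (rev (awl s t n)) x = op S K rho (rev (awl t s n)) x.
  move=> xM; rewrite !awl_rev; have := good_Mel sS tS nst xM; rewrite /good -/n.
  by case: ifP.
rewrite -[LHS](opi_op _ a2) -rv ?op_opi //.
exact: Mel_opi.
Qed.

End MelSec.

(** * Independence of the reduced word *)

Section Matsumoto.
Variables (gT : finGroupType) (S : {set gT}).
Hypothesis HC : coxeter_system S.
Variable K : {set gT}.
Hypothesis KS : K \subset S.
Variable rho : gT -> int.
Hypothesis rhoH : sign_hom K rho.
Implicit Types (s t g : gT) (m : mvec gT) (ws : seq gT).
Notation Mel := (Mel S K).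
Notation l := (len S).
Notation W := (<<S>>).
Notation F := (F S).
Notation hi := (hi S K rho).
Notation opi := (opi S K rho).

Definition redw g ws := [/\ all (mem S) ws, size ws = l g & wprod ws = g].

Lemma redw_cons s ws g : redw g (s :: ws) -> [/\ s \in S, F s g & redw (s * g) ws].
Proof.
case=> /= /andP [sS h1] h2 h3; have vW := wprod_gen h1.
have e : s * g = wprod ws by rewrite -h3 (SK HC).
have le : l (s * g) <= size ws by rewrite e; exact: len_min.
have f : F s g by rewrite /Coxeter.F -h2 ltnS.
split=> //; split=> //; have gW : g \in W by rewrite -h3 groupM // SW.
by have := len_sT HC sS gW f; rewrite -h2 => - [].
Qed.

Lemma redw_consV s ws g : s \in S -> g \in W -> F s g -> redw (s * g) ws -> redw g (s :: ws).
Proof.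
move=> sS gW f [h1 h2 h3]; split; rewrite /= ?sS //; last by rewrite h3 (SK HC).
by rewrite h2 -(len_sT HC sS gW f).
Qed.

Lemma len_awl s t k : s \in S -> t \in S -> s != t -> k <= #[s * t] -> l (wprod (awl s t k)) = k.
Proof.
move=> sS tS nst; elim: k => [|k IH] kn /=; first exact: len1.
rewrite (len_sF HC) ?(awl_red HC sS tS nst) ?IH ?(ltnW kn) //; first by case: ifP.
by apply: wprod_gen; apply: awl_all.
Qed.

Lemma awl_redw s t : s \in S -> t \in S -> s != t ->
  redw (wprod (awl s t #[s * t])) (awl s t #[s * t]).
Proof.
by move=> sS tS nst; split=> //; [exact: awl_all|rewrite size_awl len_awl].
Qed.

Lemma awl_longest s t : s \in S -> t \in S -> s != t ->
  wprod (awl s t #[s * t]) = longest S [set s; t].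
Proof.
move=> sS tS nst; apply: (longest_uniq HC (I_sub sS tS)); first exact: awl_gen.
have n0 : 0 < #[s * t] := order_gt0 _.
have swap : #[t * s] = #[s * t] by rewrite order_swap ?(Sss HC).
have h1 := awl_redw sS tS nst.
have h2 : redw (wprod (awl t s #[s * t])) (awl t s #[s * t]).
  by rewrite -swap; apply: awl_redw => //; rewrite eq_sym.
rewrite -(awl_top HC sS tS) in h2.
have f1 : F (if odd #[s * t].-1 then t else s) (wprod (awl s t #[s * t])).
  by move: h1; rewrite -{2}(prednK n0) /= => /redw_cons [].
have f2 : F (if odd #[s * t].-1 then s else t) (wprod (awl s t #[s * t])).
  by move: h2; rewrite -{2}(prednK n0) /= => /redw_cons [].
by move=> a /set2P [] ->; move: f1 f2; case: ifP.
Qed.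

(** If the first letters [s] and [t] differ, both are descents of [g], so [g] is the longest element
    of their dihedral group times a minimal [x]. Each word shares its first letter with a reduced
    word starting with a long alternating word, and these two differ by one braid relation. *)
Lemma matsumoto g ws1 ws2 m : redw g ws1 -> redw g ws2 -> Mel m -> opi ws1 m = opi ws2 m.
Proof.
have [n] := ubnP (l g); elim: n g ws1 ws2 m => // n IH g ws1 ws2 m lt r1 r2 mM.
case: ws1 r1 => [|s v1] r1.
  by case: r1 => _ /esym e _; case: r2 => _; rewrite e => /size0nil ->.
case: ws2 r2 => [|t v2] r2.
  by case: r2 => _ /esym e _; case: r1 => _; rewrite e.
have [sS fs r1'] := redw_cons r1; have [tS ft r2'] := redw_cons r2.
have gW : g \in W by case: r1 => h1 _ <-; exact: wprod_gen.
have IH' p v v' : p \in S -> F p g -> redw (p * g) v -> redw (p * g) v' ->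
    opi (p :: v) m = opi (p :: v') m.
  move=> pS fp rv rv'; rewrite /=; congr hi; apply: (IH (p * g)) => //.
  by apply: leq_trans fp _.
case: (eqVneq s t) => [est|nst].
  by rewrite est in fs r1' *; exact: IH'.
have IS := I_sub sS tS; have [u [x [uI xW xm e]]] := lmin_dec IS gW.
have uL : u = longest S [set s; t].
  apply: (longest_uniq HC IS uI) => a aI; rewrite -(F_lmin HC IS _ uI xW xm) ?KTK // -e.
  by case/set2P: aI => ->.
have [vx [x1 x2 x3]] := len_word xW.
have n0 : 0 < #[s * t] := order_gt0 _.
have swap : #[t * s] = #[s * t] by rewrite order_swap ?(Sss HC).
have nts : t != s by rewrite eq_sym.
have rr c d : c \in S -> d \in S -> c != d -> #[c * d] = #[s * t] -> [set c; d] = [set s; t] ->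
    redw g (awl c d #[s * t] ++ vx).
  move=> cS dS ncd eo eset; have [y1 y2 y3] := awl_redw cS dS ncd; rewrite eo in y1 y2 y3 *.
  split; first by rewrite all_cat y1.
    rewrite size_cat y2 x2 e (lmin_add HC IS xW xm uI) uL -eset -(awl_longest cS dS ncd) eo.
    by [].
  by rewrite wprod_cat x3 e uL -eset -(awl_longest cS dS ncd) eo.
have q1 := rr s t sS tS nst erefl erefl.
have q2 := rr t s tS sS nts swap (setUC _ _).
have br : opi (awl s t #[s * t] ++ vx) m = opi (awl t s #[s * t] ++ vx) m.
  by rewrite !opi_cat (braid_i HC KS rhoH) //; exact: Mel_opi.
have go p v c d : redw g (p :: v) -> redw g (awl c d #[s * t] ++ vx) ->
    (if odd #[s * t].-1 then d else c) = p -> opi (p :: v) m = opi (awl c d #[s * t] ++ vx) m.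
  rewrite -(prednK n0) /= => rp rc ep; rewrite ep in rc *.
  by have [pS fp rp'] := redw_cons rp; have [_ _ rc'] := redw_cons rc; exact: IH'.
case o: (odd #[s * t].-1).
  rewrite (go s v1 t s r1 q2) ?o // (go t v2 s t r2 q1) ?o //.
by rewrite (go s v1 s t r1 q1) ?o // (go t v2 t s r2 q2) ?o.
Qed.

Fixpoint rwn n g : seq gT := if n is k.+1 then
  (if [pick s in S | F s g] is Some s then s :: rwn k (s * g) else [::]) else [::].
Definition rw g := rwn (l g) g.

Lemma rw_redw g : g \in W -> redw g (rw g).
Proof.
rewrite /rw; move: {2}(l g) (erefl (l g)) => n; elim: n g => [|n IH] g e gW; rewrite e /=.
  by rewrite (len0 gW e); split=> //; rewrite len1.
case: pickP => [s /andP [sS f]|h0].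
  apply: redw_consV => //; have := len_sT HC sS gW f; rewrite e => - [e2].
  by rewrite e2; apply: IH => //; rewrite groupM // SW.
have [|s sS f] := ldescK HC (subxx S) gW; first by apply/eqP => g1; rewrite g1 len1 in e.
by have := h0 s; rewrite /= sS f.
Qed.

(** The action of the bar of [H_g], that is, of the inverse of [H_(g^-1)]. *)
Definition U g m := opi (rw g) m.

Lemma U_left s g m : s \in S -> g \in W -> ~~ F s g -> Mel m -> U (s * g) m = hi s (U g m).
Proof.
move=> sS gW f mM; have sgW : s * g \in W by rewrite groupM // SW.
apply: (matsumoto (rw_redw sgW) (ws2 := s :: rw g)) => //.
by apply: redw_consV => //; rewrite ?(F_ss HC) // (SK HC _ sS); exact: rw_redw.
Qed.

Lemma U_right s g m : s \in S -> g \in W -> l (g * s) = (l g).+1 -> Mel m ->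
  U (g * s) m = U g (hi s m).
Proof.
move=> sS gW e mM; have gsW : g * s \in W by rewrite groupM // SW.
rewrite /U -opi_rcons; apply: (matsumoto (rw_redw gsW)) => //.
have [h1 h2 h3] := rw_redw gW.
by split; rewrite ?all_rcons /= ?sS // ?size_rcons ?h2 ?wprod_rcons ?h3.
Qed.

(** If [s] is an ascent of [g], both sides are [U (s * g) m]; otherwise both come from the two
    factorisations [g = s (s g) = (s g) t]. *)
Lemma U_comm s t g m : s \in S -> t \in S -> g \in W -> s * g = g * t -> Mel m ->
  hi s (U g m) = U g (hi t m).
Proof.
move=> sS tS gW e mM; have sgW : s * g \in W by rewrite groupM // SW.
case f: (F s g); last first.
  by rewrite -U_left ?f // e U_right // -e (len_sF HC sS gW) ?f.
have e1 : g = s * (s * g) by rewrite (SK HC).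
have e2 : g = s * g * t by rewrite e (SKr HC).
have h1 x : Mel x -> U g x = hi s (U (s * g) x).
  by move=> xM; rewrite {1}e1 U_left // (F_ss HC) // f.
have h2 x : Mel x -> U g x = U (s * g) (hi t x).
  by move=> xM; rewrite {1}e2 U_right // -e2 (len_sT HC sS gW f).
by rewrite (h2 m mM) -h1 //; exact: Mel_hi.
Qed.

Lemma Mel_U g m : Mel m -> Mel (U g m). Proof. exact: Mel_opi. Qed.

End Matsumoto.

End HeckeAction.
Import HeckeAction.

(** * The bar operator and the canonical basis *)

Module BarInvolution.

Opaque cnj.

Section Bar.
Variables (gT : finGroupType) (S : {set gT}).
Hypothesis HC : coxeter_system S.
Variable K : {set gT}.
Hypothesis KS : K \subset S.
Variable rho : gT -> int.
Hypothesis rhoH : sign_hom K rho.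
Implicit Types (s t g : gT) (m : mvec gT) (ws : seq gT) (tau u v : elt gT) (z : gT * {perm gT}).
Notation Mel := (Mel S K).
Notation l := (len S).
Notation W := (<<S>>).
Notation WK := (<<K>>).
Notation F := (F S).
Notation M := (@basisv gT).
Notation inKK := (inKK S K).
Notation sact := (sact S K).
Notation hn := (hn S).
Notation h := (h S K rho).
Notation hi := (hi S K rho).
Notation opi := (opi S K rho).
Notation U := (U S K rho).
Notation lsign := (lsign rho).

Definition flip z : gT * {perm gT} := (z.1^-1, z.2).

Lemma flip_tw z : tinv K z -> flip z = twact z.1^-1 z.
Proof.
by move=> zt; rewrite /flip /twact (thV (thA zt) (yK zt)) (thy zt) !invgK mulVg mul1g.
Qed.

Lemma flip_perfect z : perfect K z -> perfect K (flip z).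
Proof.
move=> pz; have zt := perfect_tinv HC KS pz; rewrite flip_tw //.
by apply: (perfect_tw HC KS _ pz); rewrite groupV; exact: yK zt.
Qed.

Lemma psi_flip z t : tinv K z -> t \in WK -> psi z t = t -> psi (flip z) (z.2 t) = z.2 t.
Proof.
move=> zt tK pt; have := th_psi zt tK; rewrite pt => e.
by rewrite {1}/psi /flip /= invgK (thth zt) e.
Qed.

Lemma flip_cnj z t : tinv K z -> t \in refls K -> flip (cnj t z) = cnj (z.2 t) (flip z).
Proof.
move=> zt tK; have tT := TKT KS tK; rewrite !cnjE /flip /= (thth zt) !invMg (Tinv HC tT) mulgA.
by rewrite -(thV (thA zt) (TKWK tK)) (Tinv HC tT).
Qed.

(* The bar operator on basis vectors, up to a monomial constant on each orbit (after Lusztig). *)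
Definition b0 tau := U (tau.1 * tau.2.1) (M (1, flip tau.2)).

Lemma flipK tau : inKK tau -> inKK (1, flip tau.2).
Proof. by case/andP=> _ pz; apply/andP; rewrite minrep1 //= flip_perfect. Qed.

Lemma b0_Mel tau : inKK tau -> Mel (b0 tau).
Proof. by move=> tK; apply: Mel_U; apply: Mel_basis; exact: flipK. Qed.

Lemma gW tau : inKK tau -> tau.1 * tau.2.1 \in W.
Proof. by move=> tK; rewrite groupM ?(inKK_W tK) // (yW KS (inKK_tinv HC KS tK)). Qed.

Lemma b0_up s tau : s \in S -> inKK tau -> hn tau < hn (sact s tau) -> b0 (sact s tau) = hi s (b0 tau).
Proof.
move=> sS tK; have [wm pz] := andP tK; have wW := minrepW wm.
have zt := perfect_tinv HC KS pz; have yK := yK zt; have yW := yW KS zt; have gW := gW tK.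
have mM : Mel (M (1, flip tau.2)) by apply: Mel_basis; exact: flipK.
case: (sactP HC KS sS tK) => [ms|t e t1K nm f] up; rewrite /b0 /=.
  have f : ~~ F s tau.1 by apply: (@hn_up_move _ _ HC s tau.1 tau.2) => //; case: (tau) up.
  rewrite -mulgA (U_left HC KS rhoH sS gW) //; rewrite (F_coc HC (ST sS)) // (negbTE f) addFb.
  (* If [s] were a descent of [w y] but not of [w], then [w^-1 s w] would lie in W_K, and [s w] and
     [w] would be two minimal representatives of one coset. *)
  apply/negP => f2; have vK := TKWK (F_TK HC KS (TJ (ST sS) wW) yK f2).
  have := @minrep_inj _ _ HC K KS (s * tau.1) tau.1 1 _ ms wm (group1 _) vK.
  rewrite mulg1 !mulgA mulgV mul1g => /(_ erefl) [e _]; have := S_neq1 HC sS.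
  by rewrite -(inj_eq (mulIg tau.1)) e mul1g eqxx.
have tS := KSe KS t1K; have ttK := thK (thA zt) t1K; have ttS := KSe KS ttK.
have lt : l tau.2.1 < l (cnj t tau.2).1 by move: up; rewrite /ModelSet.hn /= ltn_add2l.
have := lt; rewrite (cnj_ltE HC KS pz) ?KTK // => /andP [ne ft].
have := len_cnj HC KS pz t1K ne; rewrite (negbTE ft) => l2.
(* Conjugation adds a letter on each side, [s] on the left and [th(t)] on the right. The right one
   is cancelled by the ascent from [M_(1, flip z)] to [M_(1, flip (cnj t z))], and a single [hi s]
   remains. *)
have cE : tau.1 * (cnj t tau.2).1 = s * (tau.1 * tau.2.1 * tau.2.2 t).
  by rewrite cnjE /= e !mulgA mulgV mul1g.
have cK : (cnj t tau.2).1 \in WK := PerfectInvolutions.yK (tinv_cnj HC KS zt (KTK t1K)).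
have ytK : tau.2.1 * tau.2.2 t \in WK by rewrite groupM // KWK.
have lyt : l (tau.2.1 * tau.2.2 t) = (l tau.2.1).+1.
  by rewrite -psi_y (len_psi HC KS zt) ?KTK // (len_sF HC tS).
have lg : l (tau.1 * tau.2.1) = l tau.1 + l tau.2.1 by rewrite (minrep_add HC KS wm).
have lgt : l (tau.1 * tau.2.1 * tau.2.2 t) = (l (tau.1 * tau.2.1)).+1.
  by rewrite -mulgA (minrep_add HC KS wm ytK) lyt lg addnS.
have gtW : tau.1 * tau.2.1 * tau.2.2 t \in W by rewrite groupM // SW.
have lsg : ~~ F s (tau.1 * tau.2.1 * tau.2.2 t).
  by rewrite /Coxeter.F -cE (minrep_add HC KS wm cK) l2 lgt lg -leqNgt !addnS leqnSn.
have cM : Mel (M (1, flip (cnj t tau.2))).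
  have cKK : inKK (tau.1, cnj t tau.2) by apply/andP; split=> //; exact: (perfect_cnj HC KS (KTK t1K) pz).
  by apply: Mel_basis; exact: (flipK cKK).
rewrite cE (U_left HC KS rhoH sS gtW lsg cM).
congr hi; rewrite (U_right HC KS rhoH ttS gW lgt cM).
congr U; rewrite (flip_cnj zt (KTK t1K)).
have sE : sact (tau.2.2 t) (1, flip tau.2) = (1, cnj (tau.2.2 t) (flip tau.2)).
  by apply: (sact_fib HC KS) => //; [exact: minrep1|rewrite mulg1 mul1g].
rewrite -sE -(h_up rho HC KS) ?(hi_h _ HC KS) ?flipK //.
rewrite sE -(flip_cnj zt (KTK t1K)) /ModelSet.hn /= ltn_add2l !(lenV HC) //.
exact: (WKW KS).
Qed.

Lemma b0_loop s tau : s \in S -> inKK tau -> sact s tau = tau ->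
  hi s (b0 tau) = mon (eigi (lsign s tau)) (b0 tau).
Proof.
move=> sS tK lp; have [wm pz] := andP tK; have wW := minrepW wm.
have zt := perfect_tinv HC KS pz; have yK := yK zt; have gW := gW tK.
have [tK1 _ pt] := sact_loopP HC KS sS tK lp; set t := (tau.1^-1 * s * tau.1) in tK1 pt.
have mM : Mel (M (1, flip tau.2)) by apply: Mel_basis; exact: flipK.
have ttK := thK (thA zt) tK1; have ttS := KSe KS ttK.
have e : s * (tau.1 * tau.2.1) = tau.1 * tau.2.1 * tau.2.2 t.
  by rewrite -mulgA -psi_y pt /t !mulgA mulgV mul1g.
rewrite /b0 (U_comm HC KS rhoH sS ttS) //.
have sE : sact (tau.2.2 t) (1, flip tau.2) = (1, flip tau.2).
  rewrite (sact_fib HC KS _ (minrep1 HC KS) _ ttK); last by rewrite mulg1 mul1g.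
  congr (_, _); apply/eqP.
  rewrite (cnj_loop HC KS (perfect_tinv HC KS (flip_perfect pz))) ?KTK //.
  by rewrite (psi_flip zt) // KWK.
rewrite (hi_of_eig (h_loop rho HC KS ttS (flipK tK) sE)) /HeckeAction.U opi_mon; congr (mon (eigi _) _).
(* [th(t) = y^-1 t y] is conjugate to [t] in W_K, so [rho] gives the same eigenvalue. *)
rewrite /HeckeOperators.lsign /= invg1 mul1g mulg1 -/t; have := th_psi zt (KWK tK1); rewrite pt => ->.
by rewrite -{2}(invgK tau.2.1) (rhoJ rhoH (groupVr yK) (KWK tK1)).
Qed.

Lemma mon0 m : mon (false, 0%R) m = m.
Proof. by apply: mvext => x k; rewrite /mon /sh /= subr0. Qed.

(** By [Kmin_struct], [y = w_D] with [D] fixing [z]; so [flip z = z], and each letter of a reduced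
    word of [y] acts on [M_tau] by an inverse eigenvalue. *)
Lemma b0_min tau : inKK tau -> desL S K tau == set0 -> exists p, b0 tau = mon p (M tau).
Proof.
move=> tK d; have [w1 km] := desL0P HC KS tK d; have [wm pz] := andP tK.
have zt := perfect_tinv HC KS pz; have [D [DK yD Dfix]] := Kmin_struct HC KS pz km.
have DS := subset_trans DK KS.
have fz : (1, flip tau.2) = tau.
  rewrite /flip yD (longestV HC DS) -yD -w1; case: (tau) => a [c d']. by [].
have yin : tau.2.1 \in <<D>> by rewrite yD longest_in.
have [ws [h1 h2 h3]] := parabolic_word HC DS yin.
rewrite /b0 fz w1 mul1g /HeckeAction.U (@matsumoto _ _ HC K KS rho rhoH tau.2.1 _ ws); first last.
- exact: Mel_basis.
- by split=> //; apply/allP => x /(allP h1) /= /(subsetP DS).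
- exact: (rw_redw HC (yW KS zt)).
elim: ws h1 {h2 h3} => [_|s ws IH /= /andP [sD h1]]; first by exists (false, 0%R); rewrite mon0.
have [p ->] := IH h1; have sK := subsetP DK _ sD; have sS := KSe KS sK.
have lp : sact s tau = tau.
  have : sact s (tau.1, tau.2) = (tau.1, cnj s tau.2).
    by apply: (sact_fib HC KS) => //; rewrite w1 mulg1 mul1g.
  have /eqP -> : cnj s tau.2 == tau.2 by rewrite (cnj_loop HC KS zt) ?KTK // Dfix.
  by case: (tau).
by rewrite hi_mon (hi_of_eig (h_loop rho HC KS sS tK lp)) mon_mon; eexists.
Qed.

(** The condition is on the minimal elements of the orbit and not on [tau] itself, so that the
    chosen constant depends on the orbit only. *)
Definition cstP tau (p : bool * int) := forall v,
  sameorbit S K tau v -> desL S K v == set0 -> mon p (b0 v) = M v.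
Definition cst tau := epsilon (inhabits (false, 0%R)) (cstP tau).

Lemma cst_ok tau : inKK tau -> cstP tau (cst tau).
Proof.
move=> tK; apply: epsilon_spec; have [v [o vK d _]] := desc_to_min HC KS tK.
have [[c j] e] := b0_min vK d; exists (c, - j)%R => v' o' d'.
have -> : v' = v.
  by apply: (desL0_uniq HC KS vK) => //; apply: orb_trans o'; exact: (orb_sym HC KS tK).
by rewrite e mon_mon /= addbb addNr mon0.
Qed.

Lemma cst_sact s tau : s \in S -> inKK tau -> cst (sact s tau) = cst tau.
Proof.
move=> sS tK; rewrite /cst; congr epsilon; apply: functional_extensionality => p.
rewrite /cstP; have E v : sameorbit S K (sact s tau) v = sameorbit S K tau v.
  apply/idP/idP => o; first exact: orb_trans (orb1 K tau sS) o.
  exact: orb_trans (orb_sact HC KS sS tK) o.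
by have -> : sameorbit S K (sact s tau) = sameorbit S K tau by apply: functional_extensionality.
Qed.

Definition b tau := mon (cst tau) (b0 tau).

Lemma b_Mel tau : inKK tau -> Mel (b tau).
Proof. by move=> tK; apply: Mel_mon; exact: b0_Mel. Qed.

Lemma b_up s tau : s \in S -> inKK tau -> hn tau < hn (sact s tau) -> b (sact s tau) = hi s (b tau).
Proof. by move=> sS tK up; rewrite /b cst_sact // b0_up // hi_mon. Qed.

Lemma b_loop s tau : s \in S -> inKK tau -> sact s tau = tau ->
  hi s (b tau) = mon (eigi (lsign s tau)) (b tau).
Proof.
by move=> sS tK lp; rewrite /b hi_mon b0_loop // !mon_mon addbC addrC.
Qed.

Lemma b_min tau : inKK tau -> desL S K tau == set0 -> b tau = M tau.
Proof. by move=> tK d; apply: (cst_ok tK) => //; exact: connect0. Qed.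

Lemma KK_ind (P : elt gT -> Prop) :
  (forall tau, inKK tau -> desL S K tau == set0 -> P tau) ->
  (forall s tau, s \in S -> inKK tau -> hn tau < hn (sact s tau) -> P tau -> P (sact s tau)) ->
  forall tau, inKK tau -> P tau.
Proof.
move=> P0 Ps tau; have [n] := ubnP (hn tau); elim: n tau => // n IH tau lt tK.
case: (boolP (desL S K tau == set0)) => [d|/(desLn0 HC KS tK) [s sS d]]; first exact: P0.
have vK := inKK_sact HC KS sS tK; rewrite -(sactK HC KS sS tK); apply: Ps => //.
  by rewrite (sactK HC KS).
by apply: IH => //; apply: leq_trans d _.
Qed.

Local Open Scope ring_scope.

Lemma hi_supp s m u k : s \in S -> inKK u -> hi s m u k != 0 ->
  (exists k', m u k' != 0) \/ (exists k', m (sact s u) k' != 0).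
Proof.
move=> sS uK; rewrite /HeckeAction.hi /madd /mopp /HeckeOperators.h uK /eig /mq.
case e1: (m u (k - 1) == 0); last by left; exists (k - 1); rewrite e1.
case e2: (m u (k + 1) == 0); last by left; exists (k + 1); rewrite e2.
case e3: (m (sact s u) k == 0); last by right; exists k; rewrite e3.
rewrite (eqP e1) (eqP e2) (eqP e3) subrr oppr0 !addr0 /=.
by case: ifP => _; case: ifP; rewrite ?addr0 ?eqxx.
Qed.

Lemma b_tri tau : inKK tau -> (forall k, b tau tau k = (k == 0)%:R) /\
  (forall u k, u != tau -> b tau u k != 0 -> prec S K u tau).
Proof.
move: tau; apply: KK_ind => [tau tK d|s tau sS tK up [IH1 IH2]].
  rewrite b_min // /basisv; split=> [k|u k /negbTE ->]; by rewrite ?eqxx.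
have vK := inKK_sact HC KS sS tK; rewrite b_up //; split=> [k|u k un].
  rewrite /HeckeAction.hi /madd /mopp /HeckeOperators.h vK (sactK HC KS) // up.
  have -> : tau != sact s tau by apply: contraTneq up => <-; rewrite ltnn.
  by rewrite /= addrK IH1.
case: (boolP (inKK u)) => uK; last first.
  by have [-> //] := Mel_hi rho s (b_Mel tK); rewrite eqxx.
case/(hi_supp sS uK) => [[k' nz]|[k' nz]].
  case: (eqVneq u tau) => [->|n1]; first exact: (prec_up HC KS).
  by apply: (prec_trans HC KS uK (IH2 u k' n1 nz)); exact: (prec_up HC KS).
have n1 : sact s u != tau.
  by apply: contra un => /eqP <-; rewrite (sactK HC KS).
have := prec_lift HC KS sS (inKK_sact HC KS sS uK) tK (IH2 _ _ n1 nz) up.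
by rewrite (sactK HC KS).
Qed.

Lemma b_bound : exists N, forall tau, inKK tau -> forall u k, (N < absz k)%N -> b tau u k = 0.
Proof.
suff [N hN] : exists N, forall tau, tau \in enum (KKset S K) ->
    forall u k, (N < absz k)%N -> b tau u k = 0.
  by exists N => tau tK; apply: hN; rewrite mem_enum inE.
have : all inKK (enum (KKset S K)) by apply/allP => x; rewrite mem_enum inE.
elim: (enum _) => [|a L IH] /=; first by exists 0%N.
case/andP=> aK /IH [N1 h1]; have [_ [N2 h2]] := b_Mel aK.
exists (maxn N1 N2) => tau; rewrite inE => /orP [/eqP ->|tL] u k kn.
  by apply: h2; apply: leq_ltn_trans kn; exact: leq_maxr.
by apply: (h1 tau tL); apply: leq_ltn_trans kn; exact: leq_maxl.
Qed.

Section WithBound.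
Variable N : nat.
Hypothesis bN : forall tau, inKK tau -> forall u k, (N < absz k)%N -> b tau u k = 0.

(** The antilinear extension of [b]: a term [x^(i-k)] of [m] becomes [x^(k-i)] and meets [x^i] in
    [b tau], contributing to [x^k]. *)
Definition B m : mvec gT := fun u k =>
  \sum_(tau in KKset S K) \sum_(i <- win N) m tau (i - k) * b tau u i.

Lemma B_add m1 m2 : B (madd m1 m2) = madd (B m1) (B m2).
Proof.
apply: mvext => u k; rewrite /B /madd -big_split /=; apply: eq_bigr => tau _.
by rewrite -big_split /=; apply: eq_bigr => i _; rewrite mulrDl.
Qed.
Lemma B_opp m : B (mopp m) = mopp (B m).
Proof.
apply: mvext => u k; rewrite /B /mopp -sumrN; apply: eq_bigr => tau _.
by rewrite -sumrN; apply: eq_bigr => i _; rewrite mulNr.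
Qed.
Lemma B_sh j m : B (sh j m) = sh (- j) (B m).
Proof.
apply: mvext => u k; rewrite /B /sh; apply: eq_bigr => tau _; apply: eq_bigr => i _.
by rewrite opprK opprD addrA.
Qed.
Lemma B_q m : B (mq m) = mopp (mq (B m)).
Proof.
rewrite !mqE B_add B_opp !B_sh; apply: mvext => u k; rewrite /madd /mopp /sh.
by rewrite !opprK opprB addrC.
Qed.
Lemma B_mon p m : B (mon p m) = mon (p.1, - p.2) (B m).
Proof. by rewrite /mon /=; case: p.1; rewrite ?B_opp B_sh. Qed.
Lemma B_zero : B (@mzero gT) = @mzero gT.
Proof.
apply: mvext => u k; rewrite /B big1 // => tau _; rewrite big1 // => i _.
by rewrite mul0r.
Qed.

Lemma B_Mel m : Mel m -> Mel (B m).
Proof.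
case=> ms [N1 m1]; split=> [u k uK|].
  rewrite /B big1 // => tau; rewrite inE => tK; rewrite big1 // => i _.
  by have [-> //] := b_Mel tK; rewrite mulr0.
exists (N1 + N)%N => u k kn; rewrite /B big1 // => tau; rewrite inE => tK.
rewrite big1_seq // => i /andP [_]; rewrite mem_win => iN; rewrite m1 ?mul0r //; lia.
Qed.

Lemma B_basis tau : inKK tau -> B (M tau) = b tau.
Proof.
move=> tK; apply: mvext => u k; rewrite /B (bigD1 tau) ?inE //= [X in _ + X]big1 ?addr0; last first.
  move=> v /andP [_ /negbTE nv]; rewrite big1 // => i _; by rewrite /basisv nv mul0r.
rewrite /basisv eqxx /=; case: (boolP (k \in win N)) => kN.
  rewrite (bigD1_seq k) ?win_uniq //= subrr eqxx mul1r big1 ?addr0 // => i /negbTE ik.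
  by rewrite subr_eq0 ik mul0r.
rewrite big1_seq; last first.
  move=> i /andP [_ iw]; case: eqP => [e|_]; rewrite ?mul0r //.
  by case/negP: kN; have -> : k = i by lia.
by rewrite bN // ltnNge -mem_win.
Qed.

Lemma h_eig_mon c m : eig c m = mon (c, if c then -1 else 1) m.
Proof. by apply: mvext => u k; rewrite /eig /mon /mopp /sh; case: c; rewrite /= ?opprK. Qed.

Lemma B_h s m : s \in S -> Mel m -> B (h s m) = hi s (B m).
Proof.
move=> sS; have h0 : h s (@mzero gT) = @mzero gT.
  apply: mvext => u k; rewrite /HeckeOperators.h /mq /eig /mzero subrr oppr0.
  by case: ifP => _; case: ifP => _; rewrite ?addr0.
have hi0 : hi s (@mzero gT) = @mzero gT.
  by rewrite /HeckeAction.hi h0; apply: mvext => u k; rewrite /madd /mopp /mq /mzero !subrr.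
move: m; apply: Mel_ind.
- by rewrite h0 B_zero hi0.
- by move=> a c _ _ e1 e2; rewrite h_add !B_add e1 e2 hi_add.
- by move=> a _ e; rewrite h_opp !B_opp e hi_opp.
move=> tau j tK; rewrite h_sh !B_sh hi_sh; congr sh; rewrite B_basis //.
have vK := inKK_sact HC KS sS tK; have ss := sactK HC KS sS tK.
case: (hn_sact HC KS sS tK) => [lp|e|e].
- by rewrite (h_loop rho HC KS sS tK lp) h_eig_mon B_mon B_basis // b_loop //; case: (lsign s tau).
- have up : (hn tau < hn (sact s tau))%N by have [] := gap2_lt e.
  by rewrite (h_up rho HC KS) // B_basis // b_up.
have up : (hn (sact s tau) < hn (sact s (sact s tau)))%N by rewrite ss; have [] := gap2_lt e.
have eM : M tau = h s (M (sact s tau)) by rewrite (h_up rho HC KS) // ss.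
have eb : b tau = hi s (b (sact s tau)) by rewrite -b_up // ss.
have -> : h s (M tau) = madd (M (sact s tau)) (mq (M tau)).
  by rewrite {1}eM (h_quad rho HC KS _ sS) -eM.
have hb : h s (b tau) = b (sact s tau) by rewrite eb (h_hi rho HC KS _ sS).
by rewrite B_add B_q (B_basis tK) (B_basis vK) /HeckeAction.hi hb.
Qed.

Lemma B_hi s m : s \in S -> Mel m -> B (hi s m) = h s (B m).
Proof.
move=> sS mM; rewrite {1}/HeckeAction.hi B_add B_opp B_q B_h // /HeckeAction.hi.
by apply: mvext => u k; rewrite /madd /mopp opprK subrK.
Qed.

Lemma BB m : Mel m -> B (B m) = m.
Proof.
move: m; apply: Mel_ind.
- by rewrite !B_zero.
- by move=> a c _ _ e1 e2; rewrite !B_add e1 e2.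
- by move=> a _ e; rewrite !B_opp e.
move=> tau j tK; rewrite !B_sh opprK; congr sh; move: tau tK.
apply: KK_ind => [tau tK d|s tau sS tK up IH]; first by rewrite B_basis // b_min // B_basis // b_min.
have mM := Mel_basis tK.
by rewrite -(h_up rho HC KS) // B_h // B_hi ?IH //; exact: B_Mel.
Qed.

Lemma HsinvE s m : s \in S -> Mel m -> Hsinv S K rho s m = hi s m.
Proof. by move=> sS mM; apply: mvext => u k; rewrite /Hsinv (HsE HC KS rhoH). Qed.

Lemma B_is_bar : is_bar S K rho B.
Proof.
split=> [m mM|tau tK d]; last by rewrite B_basis // b_min.
split; first exact: B_Mel.
- by move=> m' _ u k; rewrite B_add.
- have -> : mx m = sh 1 m by [].
  by move=> u k; rewrite B_sh /sh opprK.
move=> s sS u k; rewrite (HsE HC KS rhoH) // HsinvE //; last exact: B_Mel.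
by rewrite B_h.
Qed.

(** Compatibility with the [H_s] determines the operator upwards from the minimal elements, where it
    is prescribed. Since [is_bar] speaks of sums and multiplication by [x] only, negatives and all
    powers of [x] are derived first. *)
Lemma bar_unique B' m : is_bar S K rho B' -> Mel m -> B' m = B m.
Proof.
case=> hB hmin.
have Badd a c : Mel a -> Mel c -> B' (madd a c) = madd (B' a) (B' c).
  by move=> aM cM; have [_ h1 _ _] := hB a aM; apply: mvext; exact: h1.
have B0 : B' (@mzero gT) = @mzero gT.
  have zM := Mel_zero S K; have := Badd _ _ zM zM.
  have -> : madd (@mzero gT) (@mzero gT) = @mzero gT by apply: mvext => u k; rewrite /madd addr0.
  move=> e; apply: mvext => u k; have := congr1 (fun f => f u k) e; rewrite /madd /mzero; lia.
have Bopp a : Mel a -> B' (mopp a) = mopp (B' a).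
  move=> aM; have := Badd _ _ aM (Mel_opp aM).
  have -> : madd a (mopp a) = @mzero gT by apply: mvext => u k; rewrite /madd /mopp subrr.
  rewrite B0 => e; apply: mvext => u k; have := congr1 (fun f => f u k) e.
  by rewrite /madd /mopp /mzero; lia.
have B1 a : Mel a -> B' (sh 1 a) = sh (-1) (B' a).
  move=> aM; have [_ _ h1 _] := hB a aM; apply: mvext => u k.
  by rewrite [LHS](h1 u k) /sh /mxinv opprK.
have shsh i j a : sh i (sh j a) = sh (i + j) a :> mvec gT.
  by apply: mvext => u k; rewrite /sh opprD addrA.
have sh0 a : sh 0 a = a :> mvec gT by apply: mvext => u k; rewrite /sh subr0.
have Bn (n : nat) a : Mel a -> B' (sh n%:Z a) = sh (- n%:Z) (B' a).
  move=> aM; elim: n => [|n IH]; first by rewrite oppr0 !sh0.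
  have -> : n.+1%:Z = 1 + n%:Z by lia.
  by rewrite -shsh B1 ?IH ?shsh ?opprD //; exact: Mel_sh.
have Bsh j a : Mel a -> B' (sh j a) = sh (- j) (B' a).
  move=> aM; case: j => n; first exact: Bn.
  have := Bn n.+1 (sh (- n.+1%:Z) a) (Mel_sh _ aM); rewrite shsh subrr sh0 => ->.
  by rewrite shsh NegzE opprK subrr sh0.
move: m; apply: Mel_ind.
- by rewrite B0 B_zero.
- by move=> a c aM cM e1 e2; rewrite Badd // B_add e1 e2.
- by move=> a aM e; rewrite Bopp // B_opp e.
move=> tau j tK; rewrite Bsh ?B_sh; last exact: Mel_basis.
congr sh; move: tau tK; apply: KK_ind => [tau tK d|s tau sS tK up IH].
  by rewrite B_basis // b_min //; apply: mvext; exact: hmin.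
have mM := Mel_basis tK; have [B'M _ _ h1] := hB _ mM.
rewrite -(h_up rho HC KS) // B_h // -(HsE HC KS rhoH) // -IH.
apply: mvext => u k; rewrite (h1 s sS u k) HsinvE //.
Qed.

(** By triangularity only [b u] contributes at [u], with coefficient 1, which leaves the
    substitution of [x^-1] for [x]. *)
Lemma B_top m u k : inKK u -> Mel m ->
  (forall tau, inKK tau -> tau != u -> prec S K u tau -> forall j, m tau j = 0) ->
  B m u k = m u (- k).
Proof.
move=> uK [_ [N1 m1]] hm; rewrite /B (bigD1 u) ?inE //= [X in _ + X]big1 ?addr0; last first.
  move=> tau /andP []; rewrite inE => tK nt; rewrite big1 // => i _.
  case: (eqVneq (b tau u i) 0) => [->|nz]; rewrite ?mulr0 //.
  by rewrite (hm tau tK nt) ?mul0r //; apply: (b_tri tK).2 nz; rewrite eq_sym.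
have z0 : (0 : int) \in win N by rewrite mem_win.
rewrite (bigD1_seq 0) ?win_uniq //= (b_tri uK).1 eqxx mulr1 sub0r big1 ?addr0 // => i /negbTE i0.
by rewrite (b_tri uK).1 i0 mulr0.
Qed.

(** The Kazhdan-Lusztig step. At a highest [u] in [P] the coefficient is antisymmetric under
    [x -> x^-1], so it is its negative part minus the bar of that part. Subtracting this removes
    [u], and the lower terms created stay in the downward closed [P]. *)
Lemma antisym_split (P : {set elt gT}) m : (forall u, u \in P -> inKK u) ->
  (forall u v, u \in P -> inKK v -> prec S K v u -> v \in P) ->
  Mel m -> B m = mopp m -> (forall u k, m u k != 0 -> u \in P) ->
  exists q, [/\ Mel q, forall u k, q u k != 0 -> u \in P /\ k < 0 & madd q (mopp (B q)) = m].
Proof.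
have [n] := ubnP #|P|; elim: n P m => // n IH P m lt PK Pd mM mB mP.
case: (set_0Vmem P) => [P0|[u0 u0P]].
  exists (@mzero gT); split; [exact: Mel_zero|by move=> u k; rewrite eqxx|].
  rewrite B_zero; apply: mvext => u k; rewrite /madd /mopp /mzero subrr; apply/esym/eqP.
  by apply: contraT => /mP; rewrite P0 inE.
have [u uP umax] : exists2 u, u \in P & forall v, v \in P -> (hn v <= hn u)%N.
  by case: (@arg_maxnP _ u0 (mem P) hn u0P) => u h1 h2; exists u.
have uK := PK u uP.
have noprec v : v \in P -> prec S K u v -> False.
  by move=> vP; rewrite (precE HC KS) // => /and3P [_ h1 _]; have := umax v vP; rewrite leqNgt h1.
have mu (k : int) : m u (- k) = - m u k.
  rewrite -B_top //; first by rewrite mB.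
  move=> tau tK nt pr j; apply/eqP; apply: contraT => /mP /noprec; by move=> /(_ pr).
have mu0 : m u 0 = 0 by move: (mu 0); rewrite oppr0; move: (m u 0); clear => x; lia.
pose q0 : mvec gT := fun v k => if (v == u) && (k < 0) then m u k else 0.
have q0M : Mel q0.
  case: (mM) => ms [N1 m1]; split=> [v k vK|].
    by rewrite /q0; case: eqP => //= e; rewrite e uK in vK.
  by exists N1 => v k kn; rewrite /q0 m1 //; case: ifP.
have Bq0u k : B q0 u k = q0 u (- k).
  by apply: B_top => // tau tK nt _ j; rewrite /q0 (negbTE nt).
have Bq0P v k : B q0 v k != 0 -> v \in P.
  move=> nz; case: (boolP (inKK v)) => vK; last by have [e _] := B_Mel q0M; rewrite e ?eqxx in nz.
  apply: contraT => vP; case/eqP: nz; rewrite /B big1 // => tau _; rewrite big1 // => i _.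
  rewrite /q0; case: eqP => [->|_]; rewrite ?mul0r //=.
  case: (eqVneq (b u v i) 0) => [->|nz]; rewrite ?mulr0 //.
  have nvu : v != u by apply: contraNneq vP => ->.
  by case/negP: vP; apply: (Pd u v uP vK); apply: (b_tri uK).2 nz.
pose d := madd q0 (mopp (B q0)); have dM : Mel d by apply: Mel_add => //; apply: Mel_opp; exact: B_Mel.
pose m' := madd m (mopp d); have m'M : Mel m' by apply: Mel_add => //; exact: Mel_opp.
have m'B : B m' = mopp m'.
  rewrite /m' /d !(B_add, B_opp) mB BB //; apply: mvext => v k.
  by rewrite /madd /mopp; lia.
have m'u k : m' u k = 0.
  rewrite /m' /d /madd /mopp Bq0u /q0 eqxx /=.
  move: (mu k) mu0; clear => e e0; have [k0|[k0|k0]] : k < 0 \/ 0 < k \/ k = 0 by lia.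
  - have -> : (- k < 0) = false by lia.
    by rewrite k0 subr0 subrr.
  - have -> : (- k < 0) = true by lia.
    have -> : (k < 0) = false by lia.
    by rewrite e; lia.
  by rewrite k0 oppr0 e0 /= ?subrr ?subr0.
have m'P v k : m' v k != 0 -> v \in P :\ u.
  move=> nz; rewrite !inE; case: (eqVneq v u) nz => [->|nv nz] /=; first by rewrite m'u eqxx.
  case: (eqVneq (m v k) 0) => [e1|/mP //]; case: (eqVneq (B q0 v k) 0) => [e2|/Bq0P //].
  by move: nz; rewrite /m' /d /madd /mopp e1 e2 /q0 (negbTE nv).
have [|||q1 [q1M q1P q1e]] := IH (P :\ u) m' _ _ _ m'M m'B m'P.
- by move: lt; rewrite (cardsD1 u P) uP.
- by move=> v /setD1P [_ /PK].
- move=> x v /setD1P [xn xP] vK pr; rewrite !inE (Pd x v) // andbT.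
  by apply/eqP => e; apply: (noprec x xP); rewrite -e.
exists (madd q0 q1); split; first exact: Mel_add.
  move=> v k; case: (eqVneq (q1 v k) 0) => [e|nz _].
    rewrite /madd e addr0 /q0; case: ifP => [/andP [/eqP -> k0] _|_]; last by rewrite eqxx.
    by split.
  by have [/setD1P [_ vP] k0] := q1P v k nz.
rewrite B_add; apply: mvext => v k; have := congr1 (fun f => f v k) q1e.
by rewrite /m' /d /madd /mopp; lia.
Qed.

Lemma canon_exists : exists C, canon_pred S K rho C.
Proof.
have ex tau : exists c : mvec gT, inKK tau -> [/\ Mel c, B c = c,
    (forall k, c tau k = (k == 0)%:R) &
    (forall u k, u != tau -> c u k != 0 -> prec S K u tau && (k < 0))].
  case: (boolP (inKK tau)) => tK; last by exists (@mzero gT).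
  have MM := Mel_basis tK; have bM := b_Mel tK.
  pose m := madd (b tau) (mopp (M tau)).
  have mM : Mel m by apply: Mel_add => //; exact: Mel_opp.
  have mB : B m = mopp m.
    rewrite /m B_add B_opp -B_basis // BB //; apply: mvext => u k.
    by rewrite /madd /mopp; lia.
  pose P := [set v | inKK v && prec S K v tau].
  have nprec : prec S K tau tau = false by rewrite (precE HC KS) // ltnn andbF.
  have [||u k nz|q [qM qP qe]] := antisym_split (P := P) _ _ mM mB.
  - by move=> u; rewrite inE => /andP [].
  - by move=> u v; rewrite !inE => /andP [uK pu] vK pv; rewrite vK; exact: (prec_trans HC KS vK pv pu).
  - have uK : inKK u by apply: contraT => uK; case: mM => e _; rewrite e ?eqxx in nz.
    rewrite inE uK /=; move: nz; rewrite /m /madd /mopp /basisv.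
    case: (eqVneq u tau) => [->|nu]; first by rewrite (b_tri tK).1 subrr eqxx.
    by rewrite /= subr0; exact: (b_tri tK).2.
  have q0 k : q tau k = 0.
    by apply/eqP; apply: contraT => /qP []; rewrite inE nprec andbF.
  (* [q - B q = b tau - M_tau] says that [M_tau + q] is fixed by [B]. *)
  exists (madd (M tau) q) => _; split; first exact: Mel_add.
  - rewrite B_add B_basis //; apply: mvext => u k; have := congr1 (fun f => f u k) qe.
    by rewrite /m /madd /mopp; lia.
  - by move=> k; rewrite /madd q0 addr0 /basisv eqxx.
  move=> u k nu; rewrite /madd /basisv (negbTE nu) add0r => /qP [].
  by rewrite inE => /andP [_ ->].
exists (fun tau => epsilon (inhabits (@mzero gT)) (fun c => inKK tau -> [/\ Mel c, B c = c,
    (forall k, c tau k = (k == 0)%:R) &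
    (forall u k, u != tau -> c u k != 0 -> prec S K u tau && (k < 0))])).
exists B; split; first exact: B_is_bar.
move=> tau tK; move: (epsilon_spec (inhabits (@mzero gT)) _ (ex tau)) => /= /(_ tK) [h1 h2 h3 h4].
by split=> //; rewrite h2.
Qed.

(** The choice behind [canon] comes with an unspecified bar operator, which uniqueness identifies
    with [B]. *)
Lemma canon_spec tau : inKK tau -> let C := canon S K rho tau in
  [/\ Mel C, B C = C, (forall k, C tau k = (k == 0)%:R) &
      (forall u k, u != tau -> C u k != 0 -> prec S K u tau && (k < 0))].
Proof.
move=> tK; have [B' [B'b hC]] : canon_pred S K rho (canon S K rho).
  by apply: epsilon_spec; exact: canon_exists.
have [h1 h2 h3 h4] := hC tau tK; split=> //.
by rewrite -(bar_unique B'b h1); exact: mvext.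
Qed.

End WithBound.
End Bar.

End BarInvolution.
Import BarInvolution.

(** * The dual map on model sets *)

Module Duality.

Opaque cnj.

Section Dual.
Variables (gT : finGroupType) (S : {set gT}).
Hypothesis HC : coxeter_system S.
Variable J : {set gT}.
Hypothesis JS : J \subset S.
Implicit Types (a s t w : gT) (z : gT * {perm gT}) (tau : elt gT).
Notation l := (len S).
Notation W := (<<S>>).
Notation F := (F S).
Notation w0 := (longest S S).
Notation wJ := (longest S J).
Notation J' := (Jv S J).

Let SS : S \subset S := subxx S.
Let w0w0 : w0 * w0 = 1 := longest2 HC SS.
Let w0i : w0^-1 = w0 := longestV HC SS.
Let wJwJ : wJ * wJ = 1 := longest2 HC JS.
Let wJi : wJ^-1 = wJ := longestV HC JS.
Let w0W : w0 \in W := longest_in S S.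
Let wJJ : wJ \in <<J>> := longest_in S J.
Let wJW : wJ \in W := WKW JS wJJ.
Let K0 a : w0 * (w0 * a) = a. Proof. by rewrite mulgA w0w0 mul1g. Qed.
Let K0r a : a * w0 * w0 = a. Proof. by rewrite -mulgA w0w0 mulg1. Qed.
Let KJ a : wJ * (wJ * a) = a. Proof. by rewrite mulgA wJwJ mul1g. Qed.
Let KJr a : a * wJ * wJ = a. Proof. by rewrite -mulgA wJwJ mulg1. Qed.

Lemma JvS : J' \subset S.
Proof. by apply/subsetP => x /imsetP [s sJ ->]; apply: (longestJ HC SS); exact: (subsetP JS). Qed.

Lemma JvE : J' = J :^ w0.
Proof. by apply: eq_imset => a; rewrite conjgE w0i mulgA. Qed.

Lemma mem_Jv a : (w0 * a * w0 \in J') = (a \in J).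
Proof. by rewrite JvE mem_conjg conjgE invgK w0i !mulgA w0w0 mul1g K0r. Qed.

Lemma mem_WJv a : (a \in <<J'>>) = (w0 * a * w0 \in <<J>>).
Proof. by rewrite JvE genJ mem_conjg conjgE invgK w0i mulgA. Qed.

Lemma WJv a : a \in <<J>> -> w0 * a * w0 \in <<J'>>.
Proof. by rewrite mem_WJv !mulgA w0w0 mul1g K0r. Qed.

Lemma WJvP x : x \in <<J'>> -> exists2 a, a \in <<J>> & x = w0 * a * w0.
Proof. by rewrite mem_WJv => h; exists (w0 * x * w0); rewrite // !mulgA w0w0 mul1g K0r. Qed.

(** The isomorphism from W_J to W_(J^vee) through which fibres correspond: [s w = w t] becomes the
    same relation for [w w_J w0] with [gam t]. *)
Definition gam a := w0 * wJ * a * wJ * w0.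

Lemma gamE a : gam a = w0 * (wJ * a * wJ) * w0. Proof. by rewrite /gam !mulgA. Qed.
Lemma gamM a c : gam a * gam c = gam (a * c).
Proof. by rewrite /gam !mulgA K0r KJr. Qed.
Lemma gamJ t : t \in J -> gam t \in J'.
Proof. by move=> tJ; rewrite gamE mem_Jv (longestJ HC JS). Qed.

Lemma reflJv r : r \in refls J' -> exists2 a, a \in refls J & r = gam a.
Proof.
case/TKP=> v [s [/WJvP [v1 v1J ->] /imsetP [s1 s1J ->] ->]].
exists (wJ * (v1 * s1 * v1^-1) * wJ^-1).
  by apply: TKJ => //; apply/TKP; exists v1, s1.
by rewrite gamE wJi !invMg w0i !mulgA !K0r !KJr.
Qed.

Lemma AdE (v x : gT) : Ad v x = v * x * v^-1.
Proof. by rewrite permE conjgE invgK mulgA. Qed.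

Notation dz := (dualz S J).

Lemma dthE z a : z.2 \in autKK J -> a \in <<J>> -> (dz z).2 (w0 * a * w0) = w0 * wJ * z.2 a * wJ * w0.
Proof.
move=> tA aJ; set p := Ad w0 * z.2 * Ad wJ * Ad w0.
have pE x : p x = w0 * (wJ * z.2 (w0 * x * w0) * wJ) * w0.
  by rewrite /p !permM !AdE w0i wJi.
have pN : p \in 'N(<<J'>> | 'P).
  apply/astabsP => x; rewrite /= /aperm pE !mem_WJv !mulgA w0w0 mul1g K0r.
  rewrite groupMr // groupMl //.
  by have := thAut tA; rewrite inE => /andP [/perm_closed -> _].
rewrite /dualz /= -/p restr_permE ?WJv // pE.
by rewrite !mulgA w0w0 mul1g K0r.
Qed.

Lemma dth_out z x : x \notin <<J'>> -> (dz z).2 x = x.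
Proof. by move=> xn; rewrite (out_perm (restr_perm_on _ _)). Qed.

Lemma th_longest z : tinv J z -> z.2 wJ = wJ.
Proof.
move=> zt; apply: (longest_uniq HC JS); first by rewrite (thW (thA zt)).
move=> s sJ; rewrite -(thth zt s) (F_th HC JS zt (KWK (thK (thA zt) sJ)) wJJ).
by apply: (F_longest HC JS); apply: KTK; exact: (thK (thA zt)).
Qed.

Lemma dth_gam z a : tinv J z -> a \in <<J>> -> (dz z).2 (gam a) = w0 * z.2 a * w0.
Proof.
move=> zt aJ; rewrite gamE (dthE (thA zt)) ?groupM //.
rewrite !(thM (thA zt)) ?groupM // (th_longest zt) !mulgA.
by rewrite -(mulgA w0) wJwJ mulg1 KJr.
Qed.

Lemma dualz_tinv z : tinv J z -> tinv J' (dz z).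
Proof.
move=> zt; have tA := thA zt; have yJ := yK zt.
have tE := dthE tA.
have yE : (dz z).1 = w0 * (wJ * z.1) * w0 by rewrite /dualz /= !mulgA.
split.
- by rewrite yE WJv // groupM.
- rewrite inE; apply/andP; split.
    rewrite inE restr_perm_on; apply/morphicP => _ _ /WJvP [a aJ ->] /WJvP [c cJ ->].
    have -> : w0 * a * w0 * (w0 * c * w0) = w0 * (a * c) * w0 by rewrite !mulgA K0r.
    rewrite -/((dz z).2) !tE ?groupM // (thM tA) // !mulgA K0r KJr. by [].
  rewrite eqEcard card_imset ?leqnn ?andbT; last exact: perm_inj.
  apply/subsetP => _ /imsetP [_ /imsetP [s sJ ->] ->].
  rewrite -/((dz z).2) tE ?KWK //; have := gamJ (thK tA sJ). by [].
- rewrite yE tE ?groupM // (thM tA) // (th_longest zt) !mulgA K0r KJr.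
  have -> : w0 * wJ * z.1 * z.2 z.1 = w0 * wJ by case: zt => _ _ e _; rewrite -mulgA e mulg1.
  by rewrite KJr w0w0.
move=> x; case: (boolP (x \in <<J'>>)) => [/WJvP [a aJ ->]|xn]; last by rewrite !dth_out ?dth_out.
have taJ := thW tA aJ; rewrite tE //.
by rewrite -/(gam (z.2 a)) (dth_gam zt) // (thth zt).
Qed.

Lemma psi_dual z a : tinv J z -> a \in <<J>> -> psi (dz z) (gam a) = gam (psi z a).
Proof.
move=> zt aJ; rewrite /psi (dth_gam zt) // /dualz /= !invMg w0i wJi /gam !mulgA.
by rewrite K0r K0r.
Qed.

Lemma dualz_perfect z : perfect J z -> perfect J' (dz z).
Proof.
case/(perfectP HC JS) => zt zc; apply/(perfectP HC JvS); split; first exact: dualz_tinv.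
move=> r /reflJv [a aJ ->]; have aW := TKWK aJ; rewrite (psi_dual zt) // !gamM.
by rewrite (zc a).
Qed.

Lemma len_w0 v : v \in W -> l (v * w0) + l v = l w0. Proof. exact: (len_longest HC SS). Qed.

Lemma dual_len w : minrep S J w -> l (w * wJ * w0) + l w + l wJ = l w0.
Proof.
move=> wm; have wW := minrepW wm; have := len_w0 (groupM wW wJW).
by rewrite (minrep_add HC JS wm wJJ) addnA.
Qed.

Lemma dual_minrep w : minrep S J w -> minrep S J' (w * wJ * w0).
Proof.
move=> wm; have wW := minrepW wm; rewrite /minrep !groupM //=.
apply/forall_inP => _ /imsetP [s sJ ->]; have sS := subsetP JS _ sJ.
have -> : w * wJ * w0 * (w0 * s * w0) = w * (wJ * s) * w0 by rewrite !mulgA K0r.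
have wsJ : wJ * s \in <<J>> by rewrite groupM // KWK.
have e1 := dual_len wm; have e2 := len_w0 (groupM wW (WKW JS wsJ)).
have e3 := minrep_add HC JS wm wsJ; have e4 := len_longestl HC JS (KWK sJ).
have e5 := lenS1 HC sS; llia.
Qed.

Lemma dual_inKK tau : inKK S J tau -> inKK S J' (dualtau S J tau).
Proof. by case/andP=> wm pz; apply/andP; split; [exact: dual_minrep|exact: dualz_perfect]. Qed.

Lemma dual_inj : {in KKset S J &, injective (dualtau S J)}.
Proof.
move=> [w [y th]] [w1 [y1 th1]]; rewrite !inE => /andP [_ /= pz] /andP [_ /= pz1].
have zt := perfect_tinv HC JS pz; have zt1 := perfect_tinv HC JS pz1.
move=> e; have e1 : w = w1.
  by have := congr1 fst e => /= /(mulIg _)/(mulIg _).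
have e2 : y = y1.
  by have := congr1 (fun x => x.2.1) e => /= /(mulIg _)/(mulgI _).
have e3 : th = th1.
  apply/permP => a; case: (boolP (a \in <<J>>)) => aJ; last first.
    by rewrite !(out_Aut _ aJ) //; [exact: (thAut (thA zt1))|exact: (thAut (thA zt))].
  have e' : (dz (y, th)).2 = (dz (y1, th1)).2 := congr1 (fun x : elt gT => x.2.2) e.
  have := congr1 (fun p : {perm gT} => p (gam a)) e'.
  by rewrite (dth_gam zt aJ) (dth_gam zt1 aJ) => /(mulIg _)/(mulgI _).
by rewrite e1 e2 e3.
Qed.

Lemma dual_fib s w t : s * w = w * t -> s * (w * wJ * w0) = w * wJ * w0 * gam t.
Proof. by move=> e; rewrite /gam !mulgA e K0r KJr. Qed.

Lemma dual_sact s tau : s \in S -> inKK S J tau ->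
  sact S J' s (dualtau S J tau) = dualtau S J (sact S J s tau).
Proof.
move=> sS tK; have [wm pz] := andP tK; have zt := perfect_tinv HC JS pz.
case: (sactP HC JS sS tK) => [ms|t e tJ nm f].
  by rewrite /sact /dualtau /= !mulgA (dual_minrep ms).
have sw : s * tau.1 = tau.1 * t by rewrite e !mulgA mulgV mul1g.
rewrite /dualtau /= (sact_fib HC JvS _ (dual_minrep wm) (dual_fib sw) (gamJ tJ)).
congr (_, _); rewrite !cnjE (dth_gam zt) ?KWK // /dualz /=; congr (_, _).
by rewrite /gam !mulgA !K0r !KJr ?K0r.
Qed.

(** Both [w -> w w_J w0] and [y -> w0 w_J y w0] reverse length up to a constant; the constants add
    up to [2 l(w0) - l(w_J)], as the first counts twice. *)
Lemma dual_hn tau : inKK S J tau -> hn S (dualtau S J tau) + hn S tau + l wJ = (2 * l w0)%N.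
Proof.
case/andP=> wm pz; have zt := perfect_tinv HC JS pz; rewrite /hn /dualtau /dualz /=.
have e1 := dual_len wm; have yJ := yK zt.
have e2 := len_longestl HC JS yJ.
have e3 : l (w0 * wJ * tau.2.1 * w0) = l (wJ * tau.2.1).
  by rewrite -(mulgA w0 wJ) (len_longestJ HC SS) //; apply: (WKW JS); rewrite groupM.
rewrite e3; llia.
Qed.

Lemma dual_lt tau ups : inKK S J tau -> inKK S J ups ->
  (hn S (dualtau S J tau) < hn S (dualtau S J ups)) = (hn S ups < hn S tau).
Proof.
move=> tK uK; have := dual_hn tK; have := dual_hn uK.
move: (hn S _) (hn S _) (hn S _) (hn S _) (l _) (l _); clear => a b c d e f; lia.
Qed.

Lemma Jv_Jv : Jv S J' = J.
Proof.
apply/setP => x; have {1}<- : w0 * (w0 * x * w0) * w0 = x by rewrite !mulgA w0w0 mul1g K0r.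
have -> : (w0 * (w0 * x * w0) * w0 \in Jv S J') = (w0 * x * w0 \in J').
  by apply/imsetP/idP => [[y yJ /mulIg /mulgI ->] //|yJ]; exists (w0 * x * w0).
exact: mem_Jv.
Qed.

End Dual.

(** By counting: the map is injective for [J] and for [J^vee], and the dual of [J^vee] is [J]
    again. *)
Lemma dual_surj (gT : finGroupType) (S J : {set gT}) : coxeter_system S -> J \subset S ->
  dualtau S J @: KKset S J = KKset S (Jv S J).
Proof.
move=> HC JS; have sub (I : {set gT}) : I \subset S -> dualtau S I @: KKset S I \subset KKset S (Jv S I).
  move=> IS; apply/subsetP => x /imsetP [tau tK ->]; rewrite inE in tK.
  by rewrite inE dual_inKK.
have card (I : {set gT}) : I \subset S -> #|KKset S I| <= #|KKset S (Jv S I)|.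
  by move=> IS; rewrite -(card_in_imset (dual_inj HC IS)); apply: subset_leq_card; exact: sub.
apply/eqP; rewrite eqEcard sub //= (card_in_imset (dual_inj HC JS)).
by have := card _ (JvS HC JS); rewrite Jv_Jv.
Qed.

End Duality.
Import Duality.

(** * Parity of the canonical basis and the pairing with the dual module *)

Module Pairing.

Opaque cnj.

Lemma odd_absD (i j : int) : odd `|(i - j)%R| = odd `|i| (+) odd `|j|.
Proof. lia. Qed.

Lemma win_sum (N N' : nat) (g : int -> int) : (forall k, N < `|k| -> g k = 0%R) -> N <= N' ->
  (\sum_(k <- win N') g k = \sum_(k <- win N) g k)%R.
Proof.
move=> g0 NN; rewrite (bigID (fun k => `|k| <= N)) /= [X in (_ + X)%R]big1 ?addr0; last first.
  by move=> k; rewrite -ltnNge; exact: g0.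
rewrite -big_filter; apply: perm_big; apply: uniq_perm; rewrite ?filter_uniq ?win_uniq //.
move=> k; rewrite mem_filter !mem_win; case: (leqP `|k| N) => // kN.
by rewrite (leq_trans kN NN).
Qed.

Section Parity.
Variables (gT : finGroupType) (S : {set gT}).
Hypothesis HC : coxeter_system S.
Variable K : {set gT}.
Hypothesis KS : K \subset S.
Variable rho : gT -> int.
Hypothesis rhoH : sign_hom K rho.
Implicit Types (s : gT) (m n : mvec gT) (tau u v : elt gT).
Notation Mel := (Mel S K).
Notation M := (@basisv gT).
Notation inKK := (inKK S K).
Notation sact := (sact S K).
Notation hn := (hn S).
Notation hi := (hi S K rho).
Notation b := (b S K rho).
Variable N : nat.
Hypothesis bN : forall tau, inKK tau -> forall u k, (N < `|k|)%N -> b tau u k = 0%R.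
Notation B := (B S K rho N).
Local Open Scope ring_scope.

(** The half rounds down, harmlessly: [hn] moves by two along an orbit, so its half moves by one. *)
Definition par u (k : int) := odd `|k|%N (+) odd (hn u)./2.

Lemma half_sact s u : s \in S -> inKK u -> sact s u != u -> odd (hn (sact s u))./2 = ~~ odd (hn u)./2.
Proof.
move=> sS uK mv; case: (hn_sact HC KS sS uK) => [e|->|->] /=; rewrite ?negbK //.
by rewrite e eqxx in mv.
Qed.

Lemma hi_loop_val s n u k : inKK u -> sact s u = u ->
  hi s n u k = if lsign rho s u then - n u (k - 1) else n u (k + 1).
Proof.
move=> uK lp; have := @hi_of_eig gT S K rho s (lsign rho s u).
rewrite /HeckeAction.hi /madd /mopp /HeckeOperators.h uK lp eqxx /= /eig /mq => _.
by case: ifP => _; rewrite opprB; [rewrite addrA addNr sub0r|rewrite addrC subrK].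
Qed.

Lemma hi_dn_val s n u k : inKK u -> (hn (sact s u) < hn u)%N -> hi s n u k = n (sact s u) k.
Proof.
move=> uK dn; have mv : sact s u != u by apply: contraTneq dn => ->; rewrite ltnn.
by rewrite /HeckeAction.hi /madd /mopp /HeckeOperators.h uK mv dn /= addrK.
Qed.

Lemma hi_up_val s n u k : inKK u -> (hn u < hn (sact s u))%N ->
  hi s n u k = n (sact s u) k - (n u (k - 1) - n u (k + 1)).
Proof.
move=> uK up; have mv : sact s u != u by apply: contraTneq up => ->; rewrite ltnn.
have dn : (hn (sact s u) < hn u)%N = false by apply/negbTE; rewrite -leqNgt ltnW.
by rewrite /HeckeAction.hi /madd /mopp /HeckeOperators.h uK mv dn /= addr0 /mq.
Qed.

Lemma b_par tau : inKK tau -> forall u k, b tau u k != 0 -> par u k = par tau 0.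
Proof.
move: tau; apply: (KK_ind HC KS) => [tau tK d u k|s tau sS tK up IH u k].
  rewrite (b_min HC KS rhoH) // /basisv; case: (eqVneq u tau) => [->|] //=.
  by case: (eqVneq k 0) => [->|]; rewrite ?eqxx.
rewrite (b_up HC KS rhoH) // => nz.
have mvt : sact s tau != tau by apply: contraTneq up => ->; rewrite ltnn.
have E : par (sact s tau) 0 = ~~ par tau 0 by rewrite /par half_sact // addbN.
case: (boolP (inKK u)) => uK; last first.
  by case: (Mel_hi rho s (b_Mel HC KS rho tK)) => e _; rewrite e ?eqxx in nz.
have o1 : odd `|(k - 1)%R|%N = ~~ odd `|k|%N by rewrite odd_absD addbT.
have o2 : odd `|(k + 1)%R|%N = ~~ odd `|k|%N.
  by have := odd_absD k (-1); rewrite opprK addbT.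
case: (eqVneq (b tau u (k - 1)) 0) => [z1|/IH <-] in E *; last by rewrite E /par o1 addNb negbK.
case: (eqVneq (b tau u (k + 1)) 0) => [z2|/IH <-] in E *; last by rewrite E /par o2 addNb negbK.
case: (eqVneq (sact s u) u) => [lp|mv].
  by move: nz; rewrite hi_loop_val // z1 z2 oppr0; case: ifP; rewrite eqxx.
have nz2 : b tau (sact s u) k != 0.
  case: (ltnP (hn (sact s u)) (hn u)) => [dn|]; first by rewrite -hi_dn_val.
  rewrite leq_eqVlt => /orP [/eqP e|up2]; last by move: nz; rewrite hi_up_val // z1 z2 subrr subr0.
  by case: (hn_sact HC KS sS uK) => [e2|e2|e2]; rewrite ?e2 ?eqxx in mv e; lia.
by rewrite E -(IH _ _ nz2) /par (half_sact sS uK mv) addbN negbK.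
Qed.

Definition part (p : bool) m : mvec gT := fun u k => if par u k == p then m u k else 0.

Lemma Mel_part p m : Mel m -> Mel (part p m).
Proof.
case=> ms [N1 m1]; split=> [u k uK|]; first by rewrite /part ms //; case: ifP.
by exists N1 => u k kn; rewrite /part m1 //; case: ifP.
Qed.

Lemma B_part p m : B (part p m) = part p (B m).
Proof.
apply: mvext => u k; rewrite /part /BarInvolution.B.
have -> : (if par u k == p then \sum_(tau in KKset S K) \sum_(i <- win N) m tau (i - k) * b tau u i else 0)
  = \sum_(tau in KKset S K) \sum_(i <- win N)
      (if par u k == p then m tau (i - k) * b tau u i else 0).
  by case: ifP => // _; rewrite big1 // => tau _; rewrite big1.
apply: eq_bigr => tau; rewrite inE => tK; apply: eq_bigr => i _.
case: (eqVneq (b tau u i) 0) => [->|/(b_par tK) e]; first by rewrite !mulr0 if_same.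
have -> : par tau (i - k) = par u k.
  rewrite /par odd_absD; move: e; rewrite /par /=.
  by case: (odd `|i|); case: (odd `|k|); case: (odd (hn u)./2); case: (odd (hn tau)./2).
by case: ifP; rewrite ?mul0r.
Qed.

(** At a highest element of the support the coefficient would be symmetric under [x -> x^-1] and
    have only negative exponents. *)
Lemma inv_neg_zero m : Mel m -> B m = m -> (forall u k, m u k != 0 -> k < 0) -> m = @mzero gT.
Proof.
move=> mM mB mneg; pose H := \max_(v : elt gT) hn v.
have Hle v : (hn v <= H)%N by exact: leq_bigmax.
have key (n : nat) : forall u, inKK u -> (H - hn u < n)%N -> forall k, m u k = 0.
  elim: n => // n IH u uK lt.
  have top k : m u (- k) = m u k.
    rewrite -[in RHS]mB (B_top HC KS rhoH) // => tau tK nt; rewrite (precE HC KS) // => /and3P [_ lt2 _].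
    apply: IH => //; move: lt lt2 (Hle tau); generalize (hn u) (hn tau) H; clear => a c d; lia.
  move=> k; apply/eqP; apply: contraT => nz; have k0 := mneg _ _ nz.
  by have := nz; rewrite -top => /mneg; move: k0; clear; lia.
apply: mvext => u k; case: (boolP (inKK u)) => uK; last by case: mM => e _; rewrite e.
exact: (key (H - hn u).+1).
Qed.

(** The part of [C_tau] of the wrong parity is again bar invariant, and it loses the leading term,
    so it lies in negative degrees and vanishes. *)
Lemma canon_par tau u k : inKK tau -> canon S K rho tau u k != 0 -> par u k = par tau 0.
Proof.
move=> tK nz; have [h1 h2 h3 h4] := canon_spec HC KS rhoH bN tK; set C := canon S K rho tau in h1 h2 h3 h4 nz *.
have z0 : part (~~ par tau 0) C = @mzero gT.
  apply: inv_neg_zero; [exact: Mel_part|by rewrite B_part h2|].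
  move=> v j; rewrite /part; case: ifP => [/eqP e|]; last by rewrite eqxx.
  case: (eqVneq v tau) => [ev|nv /(h4 _ _ nv) /andP [] //].
  rewrite ev h3; case: (eqVneq j 0) => [j0|]; last by rewrite eqxx.
  by move: e; rewrite ev j0; case: (par tau 0).
have := congr1 (fun f => f u k) z0; rewrite /part /mzero; case: ifP => [_ e|].
  by rewrite e eqxx in nz.
by case: (par u k); case: (par tau 0).
Qed.

End Parity.

Section Form.
Variables (gT : finGroupType) (S : {set gT}).
Hypothesis HC : coxeter_system S.
Variable J : {set gT}.
Hypothesis JS : J \subset S.
Notation J' := (Jv S J).
Variables rho rho' : gT -> int.
Hypothesis rhoH : sign_hom J rho.
Hypothesis rhoH' : sign_hom J' rho'.
Hypothesis Hr : forall t, t \in J -> rho' (gam S J t) = (- rho t)%R.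
Implicit Types (s t : gT) (m n : mvec gT) (tau u v : elt gT).
Notation Mel := (Mel S J).
Notation M := (@basisv gT).
Notation inKK := (inKK S J).
Notation sact := (sact S J).
Notation hn := (hn S).
Notation f := (dualtau S J).
Notation h := (h S J rho).
Notation hi := (hi S J rho).
Notation h' := (HeckeOperators.h S J' rho').
Notation hi' := (HeckeAction.hi S J' rho').
Notation b := (b S J rho).
Variables N N' : nat.
Hypothesis bN : forall tau, inKK tau -> forall u k, (N < `|k|)%N -> b tau u k = 0%R.
Hypothesis bN' : forall tau, Defs.inKK S J' tau -> forall u k, (N' < `|k|)%N -> BarInvolution.b S J' rho' tau u k = 0%R.
Notation B := (B S J rho N).
Notation B' := (BarInvolution.B S J' rho' N').
Let J'S : J' \subset S := JvS HC JS.
Local Open Scope ring_scope.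

Definition eps u : int := if odd (hn u)./2 then -1 else 1.
Definition bnd m : nat := epsilon (inhabits 0%N) (fun q : nat => forall tau k, (q < `|k|)%N -> m tau k = 0).
(** Only the constant term of the pairing is recorded; other coefficients are reached by shifting an
    argument. By [PhiE] any bound on the exponents of [m] gives the same value. *)
Definition Phi m n : int :=
  \sum_(tau in KKset S J) eps tau * \sum_(k <- win (bnd m)) m tau k * n (f tau) (- k).

Lemma PhiE (q : nat) m n : (forall tau k, (q < `|k|)%N -> m tau k = 0) ->
  Phi m n = \sum_(tau in KKset S J) eps tau * \sum_(k <- win q) m tau k * n (f tau) (- k).
Proof.
move=> hq; have hb : forall tau k, (bnd m < `|k|)%N -> m tau k = 0.
  by apply: (epsilon_spec (inhabits 0%N) (fun p : nat => forall tau k, (p < `|k|)%N -> m tau k = 0)); exists q.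
apply: eq_bigr => tau _; congr (_ * _).
rewrite -(@win_sum (bnd m) (maxn (bnd m) q)) ?leq_maxl //; last by move=> k /hb ->; rewrite mul0r.
by rewrite (@win_sum q) ?leq_maxr // => k /hq ->; rewrite mul0r.
Qed.

Lemma Phi_zero n : Phi (@mzero gT) n = 0.
Proof. by rewrite /Phi big1 // => tau _; rewrite big1 ?mulr0 // => k _; rewrite mul0r. Qed.

Lemma Phi_add m1 m2 n : Mel m1 -> Mel m2 -> Phi (madd m1 m2) n = Phi m1 n + Phi m2 n.
Proof.
case=> _ [N1 h1] [_ [N2 h2]]; pose q := maxn N1 N2.
have g1 tau k : (q < `|k|)%N -> m1 tau k = 0.
  by move=> kq; apply: h1; apply: leq_ltn_trans kq; exact: leq_maxl.
have g2 tau k : (q < `|k|)%N -> m2 tau k = 0.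
  by move=> kq; apply: h2; apply: leq_ltn_trans kq; exact: leq_maxr.
have g3 tau k : (q < `|k|)%N -> madd m1 m2 tau k = 0 by move=> kq; rewrite /madd g1 ?g2.
rewrite (PhiE _ g1) (PhiE _ g2) (PhiE _ g3) -big_split; apply: eq_bigr => tau _ /=.
by rewrite -mulrDr -big_split; congr (_ * _); apply: eq_bigr => k _; rewrite /madd mulrDl.
Qed.

Lemma Phi_opp m n : Mel m -> Phi (mopp m) n = - Phi m n.
Proof.
case=> _ [N1 h1]; have g tau k : (N1 < `|k|)%N -> mopp m tau k = 0 by move=> kq; rewrite /mopp h1 ?oppr0.
rewrite (PhiE _ h1) (PhiE _ g) -sumrN; apply: eq_bigr => tau _.
by rewrite -mulrN -sumrN; congr (_ * _); apply: eq_bigr => k _; rewrite /mopp mulNr.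
Qed.

Lemma Phi_basis j tau n : inKK tau -> Phi (sh j (M tau)) n = eps tau * n (f tau) (- j).
Proof.
move=> tK; have g v k : (`|j| < `|k|)%N -> sh j (M tau) v k = 0.
  move=> jk; rewrite /sh /basisv subr_eq0; case: (eqVneq k j) => [e|_]; last by rewrite andbF.
  by rewrite e ltnn in jk.
rewrite (PhiE _ g) (bigD1 tau) ?inE //= [X in _ + X]big1 ?addr0; last first.
  move=> v /andP [_ /negbTE nv]; rewrite big1 ?mulr0 // => k _; by rewrite /sh /basisv nv mul0r.
congr (_ * _); rewrite (bigD1_seq j) ?win_uniq ?mem_win //= /sh /basisv !eqxx subrr eqxx mul1r.
by rewrite big1 ?addr0 // => k /negbTE kj; rewrite subr_eq0 kj mul0r.
Qed.

Lemma eps_sact s tau : s \in S -> inKK tau -> sact s tau != tau -> eps (sact s tau) = - eps tau.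
Proof.
by move=> sS tK mv; rewrite /eps (half_sact HC JS) //; case: (odd _); rewrite ?opprK.
Qed.

Lemma lsign_dual s tau : s \in S -> inKK tau -> sact s tau = tau ->
  lsign rho' s (f tau) = ~~ lsign rho s tau.
Proof.
move=> sS tK lp; have [tJ _ _] := sact_loopP HC JS sS tK lp.
have e : (s * tau.1 = tau.1 * (tau.1^-1 * s * tau.1))%g by rewrite !mulgA mulgV mul1g.
have e2 := dual_fib HC JS e; rewrite /lsign /dualtau [X in rho' X]/=.
have -> : ((tau.1 * longest S J * longest S S)^-1 * s * (tau.1 * longest S J * longest S S))%g
  = gam S J (tau.1^-1 * s * tau.1)%g by rewrite -mulgA e2 mulKg.
rewrite Hr //; have [_ hv] := rhoH; have := hv _ (KWK tJ).
by case=> ->; rewrite ?opprK.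
Qed.

(** On an arrow the sign comes from [eps], and going up from [tau] is going down from its dual. At a
    loop the eigenvalues [-x^-1] and [x] of [h s] face [x^-1] and [-x] of the inverse operator on
    the dual side, because of [Hr]. *)
Lemma Phi_adj s m n : s \in S -> Mel m -> Phi (h s m) n = - Phi m (hi' s n).
Proof.
move=> sS; have h0 : h s (@mzero gT) = @mzero gT.
  apply: mvext => u k; rewrite /HeckeOperators.h /mq /eig /mzero subrr oppr0.
  by case: ifP => _; case: ifP => _; rewrite ?addr0.
move: m; apply: Mel_ind.
- by rewrite h0 !Phi_zero oppr0.
- move=> a c aM cM e1 e2; rewrite h_add !Phi_add ?e1 ?e2 ?opprD //; exact: Mel_h.
- by move=> a aM e; rewrite h_opp !Phi_opp ?e //; exact: Mel_h.
move=> tau j tK; rewrite h_sh Phi_basis //.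
have fK := dual_inKK HC JS tK; have vK := inKK_sact HC JS sS tK.
have fs := dual_sact HC JS sS tK.
have shM i (u : elt gT) : inKK u -> Mel (sh i (M u)) by move=> uK; apply: Mel_sh; exact: Mel_basis.
have shsh i (a : mvec gT) : sh j (sh i a) = sh (j + i) a.
  by apply: mvext => u k; rewrite /sh opprD addrA.
have shopp (a : mvec gT) : sh j (mopp a) = mopp (sh j a) by [].
case: (hn_sact HC JS sS tK) => [lp|e|e].
- rewrite lp in fs; rewrite (h_loop rho HC JS sS tK lp) eigE (hi_loop_val _ _ _ fK fs) lsign_dual //.
  case: (lsign rho s tau) => /=.
    by rewrite shopp Phi_opp ?shsh ?Phi_basis ?opprD ?opprK //; exact: shM.
  by rewrite shsh Phi_basis // opprD mulrN opprK.
- have [up _] := gap2_lt e; have mv : sact s tau != tau by apply: contraTneq up => ->; rewrite ltnn.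
  rewrite (h_up rho HC JS) // Phi_basis // hi_dn_val ?fs ?dual_lt //.
  by rewrite eps_sact // mulNr.
have [dn _] := gap2_lt e; have mv : sact s tau != tau by apply: contraTneq dn => ->; rewrite ltnn.
have eM : M tau = h s (M (sact s tau)) by rewrite (h_up rho HC JS) ?(sactK HC JS).
have -> : h s (M tau) = madd (M (sact s tau)) (mq (M tau)).
  by rewrite {1}eM (h_quad rho HC JS _ sS) -eM.
have -> : sh j (madd (M (sact s tau)) (mq (M tau))) =
    madd (sh j (M (sact s tau))) (madd (sh (j + 1) (M tau)) (mopp (sh (j - 1) (M tau)))).
  by rewrite mqE -!shsh.
rewrite !Phi_add ?Phi_opp ?Phi_basis //; try (by [exact: shM | apply: Mel_opp; exact: shM]).
  rewrite hi_up_val ?fs ?dual_lt // eps_sact // !opprD opprK.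
  move: (eps tau) (n _ _) (n _ _) (n _ _); clear => x a c d; lia.
by apply: Mel_add; [exact: shM|apply: Mel_opp; exact: shM].
Qed.

Lemma Phi_adj_hi s m n : s \in S -> Mel m -> Phi (hi s m) n = - Phi m (h' s n).
Proof.
move=> sS mM; have iM := Mel_hi rho s mM.
by rewrite -{2}(h_hi rho HC JS m sS) Phi_adj // opprK (hi_h rho' HC J'S).
Qed.

Lemma dual_orb tau ups : inKK tau -> inKK ups -> sameorbit S J' (f tau) (f ups) -> sameorbit S J tau ups.
Proof.
move=> tK uK /connectP [p hp e].
suff [v [o ev]] : exists v, sameorbit S J tau v /\ last (f tau) p = f v.
  have vK := orb_closed HC JS tK o; rewrite -e in ev.
  by rewrite (dual_inj HC JS _ _ ev) // inE.
elim: p tau tK hp {e} => [|a p IH] tau tK /=; first by exists tau; split=> //; exact: connect0.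
case/andP=> /exists_inP [s sS /eqP ->]; rewrite dual_sact // => hp.
have [v [o ev]] := IH _ (inKK_sact HC JS sS tK) hp; exists v; split=> //.
exact: orb_trans (orb1 J tau sS) o.
Qed.

Lemma Phi_bar m n : Mel m -> Defs.Mel S J' n -> Phi (B m) n = Phi m (B' n).
Proof.
move=> mM; move: m mM n; apply: Mel_ind.
- by move=> n _; rewrite (B_zero) !Phi_zero.
- move=> a c aM cM e1 e2 n nM; rewrite B_add !Phi_add ?e1 ?e2 //; exact: B_Mel.
- by move=> a aM e n nM; rewrite B_opp !Phi_opp ?e //; exact: B_Mel.
move=> tau j tK; rewrite B_sh (B_basis JS bN) //; move: tau tK.
apply: (KK_ind HC JS) => [tau tK d n nM|s tau sS tK up IH n nM].
  have fK := dual_inKK HC JS tK.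
  rewrite (b_min HC JS rhoH) // !Phi_basis // (B_top HC J'S rhoH') //.
  (* The dual of a minimal [tau] is highest in its orbit: anything above it would be the dual of an
     element below [tau]. So [B_top] applies there. *)
  move=> u uK _; rewrite (precE HC J'S) // => /and3P [o lt _].
  have : u \in KKset S J' by rewrite inE.
  rewrite -(dual_surj HC JS) => /imsetP [v]; rewrite inE => vK eu.
  rewrite eu in o lt; have {}o := dual_orb tK vK o.
  have [v0 [o2 v0K d2 le]] := desc_to_min HC JS vK.
  have e := desL0_uniq HC JS tK (orb_trans o o2) d d2; rewrite e in le.
  by move: lt; rewrite dual_lt // ltnNge le.
have vK := inKK_sact HC JS sS tK; have bM := b_Mel HC JS rho tK.
rewrite (b_up HC JS rhoH) // -hi_sh Phi_adj_hi //; last exact: Mel_sh.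
rewrite IH; last exact: Mel_h.
rewrite (B_h HC J'S rhoH' bN') // -Phi_adj //; last by apply: Mel_sh; exact: Mel_basis.
by rewrite h_sh (h_up rho HC JS).
Qed.

Lemma mu_dual tau ups : inKK tau -> inKK ups ->
  mu S J' rho' (f tau) (f ups) = mu S J rho ups tau.
Proof.
move=> tK uK; have fK := dual_inKK HC JS uK; have ftK := dual_inKK HC JS tK.
have [c1 c2 c3 c4] := canon_spec HC JS rhoH bN tK.
have [d1 d2 d3 d4] := canon_spec HC J'S rhoH' bN' fK.
rewrite /mu; set C := canon S J rho tau in c1 c2 c3 c4 *.
have par_C := @canon_par _ _ HC J JS rho rhoH N bN tau ups (-1) tK; rewrite -/C in par_C.
set D := canon S J' rho' (f ups) in d1 d2 d3 d4 *.
case: (eqVneq tau ups) => [e|ne]; first by move: d3 c3; rewrite -e => -> ->.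
have C0 u : C u 0 = (u == tau)%:R.
  case: (eqVneq u tau) => [->|nu]; first by rewrite c3.
  by apply/eqP; apply: contraT => /(c4 _ _ nu) /andP [].
have D0 u : inKK u -> D (f u) 0 = (u == ups)%:R.
  move=> uK2; case: (eqVneq u ups) => [->|nu]; first by rewrite d3.
  have nf : f u != f ups.
    by apply: contra nu => /eqP h0; apply/eqP; apply: (dual_inj HC JS) h0; rewrite inE.
  by apply/eqP; apply: contraT => /(d4 _ _ nf) /andP [].
have Cneg u k : (0 < k)%R -> C u k = 0.
  move=> k0; apply/eqP; apply: contraT; case: (eqVneq u tau) => [->|nu].
    by rewrite c3; move: k0; case: (eqVneq k 0) => [->|]; rewrite ?eqxx.
  by move/(c4 _ _ nu) => /andP [_]; move: k0; clear; lia.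
have Dneg u k : (0 < k)%R -> D u k = 0.
  move=> k0; apply/eqP; apply: contraT; case: (eqVneq u (f ups)) => [->|nu].
    by rewrite d3; move: k0; case: (eqVneq k 0) => [->|]; rewrite ?eqxx.
  by move/(d4 _ _ nu) => /andP [_]; move: k0; clear; lia.
have [_ [q0 hq0]] := c1; pose q := q0.+1.
have hq u k : (q < `|k|)%N -> C u k = 0 by move=> kq; apply: hq0; apply: ltnW.
(* [sh 1] brings the coefficient of [x^-1] of the pairing into the constant term, [sh (-1)] that of
   [x]. Bar invariance equates the two, and the second vanishes since [C] and [D] have no positive
   exponents. *)
have P1 : Phi C (sh 1 D) = Phi C (sh (-1) D).
  by rewrite -{1}c2 Phi_bar ?B_sh ?d2 //; exact: Mel_sh.
have P2 : Phi C (sh (-1) D) = 0.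
  rewrite (PhiE _ hq) big1 // => u _; rewrite big1 ?mulr0 // => k _; rewrite /sh.
  case: (boolP (0 < k)%R) => k0; first by rewrite Cneg ?mul0r.
  by rewrite (Dneg _ (- k - -1)) ?mulr0 //; move: k0; clear; lia.
(* Nonpositive exponents add up to -1 only as 0 and -1 in either order, and exponent 0 occurs only
   at the leading term of [C] or of [D]. *)
have P3 : Phi C (sh 1 D) = eps tau * D (f tau) (-1) + eps ups * C ups (-1).
  rewrite (PhiE _ hq); have inner u : u \in KKset S J ->
      eps u * \sum_(k <- win q) C u k * sh 1 D (f u) (- k) =
      eps u * D (f u) (-1) * (u == tau)%:R + eps u * C u (-1) * (u == ups)%:R.
    rewrite inE => uK2; rewrite (bigD1_seq 0) ?win_uniq ?mem_win //=.
    rewrite -[X in _ * (_ + X)]big_filter (bigD1_seq (-1)) ?filter_uniq ?mem_filter ?win_uniq ?mem_win //.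
    rewrite big1_seq ?addr0; last first.
      move=> k; rewrite mem_filter => /and3P [k1 k2 _]; rewrite /sh.
      case: (boolP (0 < k)%R) => k0; first by rewrite Cneg ?mul0r.
      by rewrite (Dneg _ (- k - 1)) ?mulr0 //; move: k0 k1 k2; clear; lia.
    rewrite /sh oppr0 sub0r opprK subrr C0 D0 //=.
    by rewrite addr0 mulrDr !mulrA [_ * D _ _]mulrAC.
  rewrite (eq_bigr _ inner) big_split /=.
  have pick v (g : elt gT -> int) : inKK v -> \sum_(u in KKset S J) g u * (u == v)%:R = g v.
    move=> vK; rewrite (bigD1 v) ?inE //= eqxx mulr1 big1 ?addr0 // => u /andP [_ /negbTE ->].
    by rewrite mulr0.
  by rewrite (pick tau (fun u => eps u * D (f u) (-1))) // (pick ups (fun u => eps u * C u (-1))).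
(* A nonzero coefficient at exponent -1 forces [ups] and [tau] to have opposite parity, so the two
   signs [eps] differ and the sum being 0 makes the coefficients equal. *)
move: P3; rewrite P1 P2; case: (eqVneq (C ups (-1)) 0) => [->|/par_C].
  by rewrite mulr0 addr0 /eps => /esym; case: ifP => _; rewrite ?mulN1r ?mul1r //; lia.
rewrite /par /eps /=; move: (D (f tau) (-1)) (C ups (-1)); clear => x y.
by case: (odd _); case: (odd _) => //= _; rewrite ?mulN1r ?mul1r; lia.
Qed.

Lemma asc_dual tau : inKK tau -> asc_m S J' rho' (f tau) = S :\: asc_m S J rho tau.
Proof.
move=> tK; apply/setP => s; rewrite in_setD; case sS: (s \in S); last first.
  by rewrite andbF !inE sS.
have fK := dual_inKK HC JS tK; have vK := inKK_sact HC JS sS tK; have fs := dual_sact HC JS sS tK.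
rewrite andbT !in_setU !(ascLE HC) // fs dual_lt //.
have E (K : {set gT}) r u : K \subset S -> Defs.inKK S K u -> (s \in ascE S K r u) = (Defs.sact S K s u == u) && lsign r s u.
  by move=> KS uK; rewrite inE sS /= (eqLE HC KS).
rewrite !E // fs; case: (hn_sact HC JS sS tK) => [lp|/gap2_lt [g1 g2]|/gap2_lt [g1 g2]].
- by rewrite lp ltnn !eqxx /= lsign_dual.
- have nl : sact s tau != tau by apply: contraTneq g1 => ->; rewrite ltnn.
  have nf : f (sact s tau) != f tau.
    by apply: contra nl => /eqP h0; apply/eqP; apply: (dual_inj HC JS) h0; rewrite inE.
  by rewrite g1 g2 (negbTE nf).
by rewrite g1 g2; have /negbTE -> : sact s tau != tau by apply: contraTneq g1 => ->; rewrite ltnn.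
Qed.

End Form.

End Pairing.
Import Pairing.

(** * The sign character and the two dualities *)

Section Main.
Variables (gT : finGroupType) (S : {set gT}).
Hypothesis HC : coxeter_system S.
Notation l := (len S).
Notation W := (<<S>>).
Implicit Types (a c s t : gT) (tau : elt gT).

Lemma len_parity_s s c : s \in S -> c \in W -> odd (l (s * c)) = ~~ odd (l c).
Proof.
move=> sS cW; case: (boolP (F S s c)) => f; last by rewrite (len_sF HC).
by rewrite (len_sT HC sS cW f) /= negbK.
Qed.

Lemma len_parity a c : a \in W -> c \in W -> odd (l (a * c)) = odd (l a) (+) odd (l c).
Proof.
move=> + cW; case/len_word=> ws [wsS _ <-].
elim: ws wsS => [_|s ws IH /= /andP [sS wsS]]; first by rewrite /= mul1g (len1 S).
have wW := wprod_gen wsS.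
by rewrite /= -mulgA (len_parity_s sS (groupM wW cW)) (IH wsS) (len_parity_s sS wW) addNb.
Qed.

Variable K : {set gT}.
Hypothesis KS : K \subset S.

Lemma sgnrho_hom rho : sign_hom K rho -> sign_hom K (sgnrho S rho).
Proof.
case=> hM hV; split=> [a c aK cK|a aK]; rewrite /sgnrho.
  rewrite hM // mulrACA; congr (_ * _)%R.
  by rewrite -signr_odd len_parity ?(WKW KS) // signr_addb !signr_odd.
by rewrite -signr_odd; case: (hV a aK) => ->; case: (odd _); auto.
Qed.

Lemma sigv_hom sigma : sign_hom K sigma -> sign_hom (Jv S K) (sigv S sigma).
Proof.
have w0i := longestV HC (subxx S).
case=> hM hV; split=> [a c|a]; rewrite /sigv !(mem_WJv HC) => aK; last first.
  by rewrite AdE w0i; exact: hV.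
move=> cK; rewrite -hM ?AdE ?w0i //; congr sigma.
by rewrite !mulgA -(mulgA _ (longest S S) (longest S S)) (longest2 HC (subxx S)) mulg1.
Qed.

Lemma sigv_gam sigma t : sign_hom K sigma -> t \in K -> sigv S sigma (gam S K t) = sigma t.
Proof.
move=> sH tK; have w0w0 := longest2 HC (subxx S).
rewrite /sigv AdE (longestV HC (subxx S)) gamE.
have -> : longest S S * (longest S S * (longest S K * t * longest S K) * longest S S) * longest S S
   = longest S K * t * longest S K.
  by rewrite !mulgA w0w0 mul1g -[X in X = _]mulgA w0w0 mulg1.
have := rhoJ sH (longest_in S K) (KWK tK); by rewrite (longestV HC KS).
Qed.

(** Equal height means a loop, where [w^-1 s w] is a simple reflection in [K], and [sgn] is -1 on
    it. *)
Lemma asc_nE rho tau : sign_hom K rho -> inKK S K tau -> asc_n S K rho tau = asc_m S K (sgnrho S rho) tau.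
Proof.
move=> rH tK; apply/setP => s; rewrite !in_setU; congr (_ || _); rewrite !inE.
case sS: (s \in S) => //=; rewrite (eqLE HC KS) //; case: eqP => //= lp.
have [tJ _ _] := sact_loopP HC KS sS tK lp.
rewrite /sgnrho (lenS1 HC (subsetP KS _ tJ)) expr1 mulN1r.
by have [_ hV] := rH; case: (hV _ (KWK tJ)) => ->.
Qed.

End Main.

(** The common form of both dualities: the sign comes from twisting by [sgn] the character for
    [J^vee] in the first and the one for [J] in the second. *)
Lemma dual_graphs_twisted (gT : finGroupType) (S J : {set gT}) (rho rho' : gT -> int) :
  coxeter_system S -> J \subset S -> sign_hom J rho -> sign_hom (Jv S J) rho' ->
  (forall t, t \in J -> rho' (gam S J t) = (- rho t)%R) ->
  dual_graphs S (KKset S J) (KKset S (Jv S J)) (dualtau S J)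
    (omega_m S J rho) (omega_m S (Jv S J) rho') (asc_m S J rho) (asc_m S (Jv S J) rho').
Proof.
move=> HC JS rH rH' Hr; have J'S := JvS HC JS.
have [N bN] := b_bound HC JS rho; have [N' bN'] := b_bound HC J'S rho'.
have ad tau : inKK S J tau -> asc_m S (Jv S J) rho' (dualtau S J tau) = S :\: asc_m S J rho tau.
  by move=> tK; apply: asc_dual.
have aS tau : asc_m S J rho tau \subset S.
  by apply/subsetP => s; rewrite !inE => /orP [] /andP [].
have md tau ups : inKK S J tau -> inKK S J ups ->
    mu S (Jv S J) rho' (dualtau S J tau) (dualtau S J ups) = mu S J rho ups tau.
  by move=> tK uK; exact: (mu_dual HC JS rH rH' Hr bN bN').
split.
- by move=> v; rewrite !inE; exact: dual_inKK.
- exact: dual_inj.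
- by move=> v'; rewrite -(dual_surj HC JS) => /imsetP [v vV ->]; exists v.
- move=> u v; rewrite !inE => uK vK; rewrite /omega_m !ad // !md //.
  have -> : (S :\: asc_m S J rho u \subset S :\: asc_m S J rho v) =
            (asc_m S J rho v \subset asc_m S J rho u); last by rewrite addrC.
  apply/idP/idP => [h|]; last exact: setDS.
  by have := setDS S h; rewrite !setDDr !setDv !set0U !(setIidPr (aS _)).
by move=> v; rewrite inE => vK; exact: ad.
Qed.

Theorem mainTheorem19 (gT : finGroupType) (S J : {set gT}) (sigma : gT -> int) :
  coxeter_system S -> J \subset S -> sign_hom J sigma ->
  dual_graphs S (KKset S J) (KKset S (Jv S J)) (dualtau S J)
    (omega_m S J sigma) (omega_n S (Jv S J) (sigv S sigma))
    (asc_m S J sigma) (asc_n S (Jv S J) (sigv S sigma))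
  /\
  dual_graphs S (KKset S J) (KKset S (Jv S J)) (dualtau S J)
    (omega_n S J sigma) (omega_m S (Jv S J) (sigv S sigma))
    (asc_n S J sigma) (asc_m S (Jv S J) (sigv S sigma)).
Proof.
move=> HC JS sH; have J'S := JvS HC JS; have vH := sigv_hom HC sH.
have lg t : t \in J -> len S (gam S J t) = 1%N by move=> tJ; rewrite (lenS1 HC) ?(subsetP J'S) ?gamJ.
split.
  have [] := dual_graphs_twisted HC JS sH (sgnrho_hom HC J'S vH).
    by move=> t tJ; rewrite /sgnrho lg // expr1 mulN1r sigv_gam.
  move=> d1 d2 d3 d4 d5; split=> // v vV; rewrite -d5 //.
  by apply: asc_nE => //; have := d1 v vV; rewrite inE.
have [] := dual_graphs_twisted HC JS (sgnrho_hom HC JS sH) vH.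
  move=> t tJ; rewrite sigv_gam // /sgnrho (lenS1 HC) ?(subsetP JS) //.
  by rewrite expr1 mulN1r opprK.
move=> d1 d2 d3 d4 d5; split=> // v vV; rewrite d5 //; congr (_ :\: _).
by apply/esym; apply: asc_nE => //; rewrite inE in vV.
Qed.
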